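(* Let $\mathbf Y$ be an extremal tree model on an undirected tree $T=(V,E)$, $V=[d]$. Then $\mathbf Y$ is $\mathrm{EMTP}_2$ if and only if all its bivariate margins are $\mathrm{EMTP}_2$, that is, if and only if all $W_e$ in the tree representation $W^k_i=\sum_{e\in\mathrm{ph}(ki;T^k)}W_e$ of its extremal functions have log-concave densities. Consequently, Hüsler--Reiss tree models (extremal tree models that are Hüsler--Reiss distributed) are always $\mathrm{EMTP}_2$.
   Context: $[d]=\{1,\dots,d\}$; $\boldsymbol 1$ is the vector of ones; $\vee,\wedge$ are componentwise maximum and minimum. Multivariate Pareto distribution: a random vector $\mathbf Y$ supported on $\mathcal L=\{\mathbf x\in\mathbb R^d:\max_i x_i>0\}$ such that $\mathbb P(\mathbf Y\le \mathbf z)=\lim_{u\to\infty}\mathbb P(\mathbf X-u\boldsymbol 1\le\mathbf z\mid \max_i X_i>u)$ for $\mathbf z\in\mathcal L$, for some random vector $\mathbf X$ with standard exponential margins. It satisfies $\mathbb P(\mathbf Y\in t\boldsymbol 1+A)=e^{-t}\mathbb P(\mathbf Y\in A)$ for $t>0$, Borel $A\subset\mathcal L$. $\mathbf Y$ is assumed to have a Lebesgue density. For $k\in[d]$, $\mathbf Y^k$ is $\mathbf Y$ conditioned on $\{Y_k>0\}$; $\mathbf Y^k\overset{d}{=}\mathbf W^k+E\boldsymbol 1$ with $E$ standard exponential independent of $\mathbf W^k$, $W^k_k=0$ a.s. ($\mathbf W^k$ is the $k$th extremal function). For $I\subset[d]$ the margin $\mathbf Y_I$ is the multivariate Pareto distribution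 given by $(Y_i)_{i\in I}$ conditioned on $\max_{i\in I}Y_i>0$. A random vector with density $f$ is $\mathrm{MTP}_2$ if $f(\mathbf x\vee\mathbf y)f(\mathbf x\wedge\mathbf y)\ge f(\mathbf x)f(\mathbf y)$ for all $\mathbf x,\mathbf y$; a multivariate Pareto distribution $\mathbf Y$ is $\mathrm{EMTP}_2$ if $\mathbf Y^k$ is $\mathrm{MTP}_2$ for every component index $k$. Extremal conditional independence $\mathbf Y_A\perp_e\mathbf Y_B\mid\mathbf Y_C$ means that $\mathbf Y^k_A$ and $\mathbf Y^k_B$ are conditionally independent given $\mathbf Y^k_C$ for all $k\in[d]$. An extremal tree model on $T$ is a multivariate Pareto distribution that is Markov to $T$: $Y_i\perp_e Y_j\mid\mathbf Y_{V\setminus\{i,j\}}$ whenever $(i,j)\notin E$. For $k\in V$ let $T^k=(V,E^k)$ be $T$ with all edges directed away from $k$, and $\mathrm{ph}(ki;T^k)$ the set of directed edges on the path from $k$ to $i$. It is known that for an extremal tree model and any $k\in V$, the extremal function has the representation (in distribution) $W^k_i=\sum_{e\in\mathrm{ph}(ki;T^k)}W_e$, $i\in V$, where $\{W_e:e\in E^k\}$ are independent and, for $e=(i,j)$, $W_e$ has the distribution of $W^i_j$, the $j$th component of the $i$th extremal function. Hüsler--Reiss distribution: let $\Gamma$ be a symmetric $d\times d$ matrix with zero diagonal and $\boldsymbol x^T\Gamma\boldsymbol x<0$ for all $\boldsymbol x\neq\boldsymbol 0$ with $\boldsymbol x^T\boldsymbol 1=0$; the Hüsler--Reiss distribution with parameter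 $\Gamma$ is the multivariate Pareto distribution for which, for each $k$, $(W^k_i)_{i\ne k}\sim N(-\mathrm{diag}(\Sigma^{(k)})/2,\Sigma^{(k)})$ with $\Sigma^{(k)}_{ij}=\frac12(\Gamma_{ik}+\Gamma_{jk}-\Gamma_{ij})$. *)

(* Defs.v *)
From HB Require Import structures.
From mathcomp Require Import all_boot all_order all_algebra.
From mathcomp Require Import all_classical all_reals all_analysis.

Set Implicit Arguments.
Unset Strict Implicit.
Unset Printing Implicit Defensive.

Import Order.TTheory GRing.Theory Num.Theory.
Import numFieldNormedType.Exports.

Local Open Scope classical_set_scope.
Local Open Scope ring_scope.

(* A random vector in R^n is a random element of [n.-tuple R]; its law is a
   set function on [n.-tuple R] (in the theorem it is always a probability). *)

Section Lebesgue.
Context {R : realType}.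

Fixpoint lebesgue_tuple (n : nat) : set (n.-tuple R) -> \bar R :=
  match n with
  | 0 => dirac [tuple]
  | m.+1 =>
    pushforward (lebesgue_measure \x lebesgue_tuple (n := m))%E
      (fun p : R * m.-tuple R => [tuple of p.1 :: p.2])
  end.

Arguments lebesgue_tuple n : clear implicits.

Definition is_density d (T : measurableType d) (leb law : set T -> \bar R)
    (f : T -> R) : Prop :=
  [/\ measurable_fun setT f,
      (forall x, 0 <= f x) &
      forall A, measurable A -> law A = (\int[leb]_(x in A) (f x)%:E)%E].

Definition cond_law d (T : measurableType d) (mu : set T -> \bar R)
    (B A : set T) : \bar R := (mu (A `&` B) / mu B)%E.

End Lebesgue.

Arguments lebesgue_tuple {R} n.

Section TotalPositivity.
Context {R : realType}.

Definition tmax n (x y : n.-tuple R) : n.-tuple R :=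
  [tuple Num.max (tnth x i) (tnth y i) | i < n].

Definition tmin n (x y : n.-tuple R) : n.-tuple R :=
  [tuple Num.min (tnth x i) (tnth y i) | i < n].

(* Densities are only determined up to null sets: a law is MTP2, respectively
   has a log-concave density, when some version of its density has the property
   everywhere. *)
Definition MTP2 n (mu : set (n.-tuple R) -> \bar R) : Prop :=
  exists2 f : n.-tuple R -> R,
    is_density (lebesgue_tuple n) mu f &
    forall x y, f x * f y <= f (tmax x y) * f (tmin x y).

Definition has_logconcave_density (mu : set R -> \bar R) : Prop :=
  exists2 h : R -> R,
    is_density lebesgue_measure mu h &
    forall x y t : R, 0 < t < 1 ->
      (h x) `^ t * (h y) `^ (1 - t) <= h (t * x + (1 - t) * y).

End TotalPositivity.

Section ConditionalIndependence.
Context {R : realType} {d d1 d2 d3 : measure_display}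
  {T : measurableType d} {T1 : measurableType d1} {T2 : measurableType d2}
  {T3 : measurableType d3}.
Variable Q : set T -> \bar R.

(* [p \o h] is a version of the conditional probability Q(E | h). *)
Definition is_cond_prob (h : T -> T3) (E : set T) (p : T3 -> R) : Prop :=
  [/\ measurable_fun setT p,
      (forall z, 0 <= p z) &
      forall C, measurable C ->
        Q (E `&` h @^-1` C) = (\int[Q]_(y in h @^-1` C) (p (h y))%:E)%E].

Definition cond_indep (f : T -> T1) (g : T -> T2) (h : T -> T3) : Prop :=
  forall A B, measurable A -> measurable B ->
  exists pA pB : T3 -> R,
    [/\ is_cond_prob h (f @^-1` A) pA,
        is_cond_prob h (g @^-1` B) pB &
        is_cond_prob h (f @^-1` A `&` g @^-1` B) (fun z => pA z * pB z)].

End ConditionalIndependence.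

Section MultivariatePareto.
Context {R : realType}.

Definition exceed n (u : R) : set (n.-tuple R) :=
  [set x | exists i, u < tnth x i].

Arguments exceed n u : clear implicits.

Definition calL n : set (n.-tuple R) := exceed n 0.

Arguments calL n : clear implicits.

Definition tshift n (x : n.-tuple R) (t : R) : n.-tuple R :=
  [tuple tnth x i + t | i < n].

(* [nu] is the law of the vector X of which [mu] is the threshold limit. *)
Definition multivariate_pareto n (mu : set (n.-tuple R) -> \bar R) : Prop :=
  mu (calL n) = 1%E /\
  exists nu : probability (n.-tuple R) R,
    (forall i (A : set R), measurable A ->
      nu [set x | A (tnth x i)] = exponential_prob 1 A) /\
    (forall z, calL n z ->
      cond_law nu (exceed n u) [set x | forall i, tnth x i - u <= tnth z i]
        @[u --> +oo] --> mu [set y | forall i, tnth y i <= tnth z i]).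

(* The law of Y^k. *)
Definition law_k n (mu : set (n.-tuple R) -> \bar R) (k : 'I_n) :
    set (n.-tuple R) -> \bar R :=
  cond_law mu [set y | 0 < tnth y k].

(* [nu] is the law of W^k, where Y^k has the law of W^k + E 1. *)
Definition extremal_function n (mu : set (n.-tuple R) -> \bar R) (k : 'I_n)
    (nu : probability (n.-tuple R) R) : Prop :=
  nu [set w | tnth w k = 0] = 1%E /\
  forall A, measurable A ->
    law_k mu k A =
    (nu \x exponential_prob (1 : R))%E [set p | A (tshift p.1 p.2)].

Definition subvec n (I : {set 'I_n}) (x : n.-tuple R) : #|I|.-tuple R :=
  [tuple tnth x (enum_val a) | a < #|I|].

(* The law of the multivariate Pareto margin Y_I. *)
Definition margin n (mu : set (n.-tuple R) -> \bar R) (I : {set 'I_n}) :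
    set (#|I|.-tuple R) -> \bar R :=
  cond_law (pushforward mu (subvec I)) (calL #|I|).

Definition EMTP2 n (mu : set (n.-tuple R) -> \bar R) : Prop :=
  forall k, MTP2 (law_k mu k).

Definition extremal_cond_indep n (mu : set (n.-tuple R) -> \bar R)
    (A B C : {set 'I_n}) : Prop :=
  forall k, cond_indep (law_k mu k) (subvec A) (subvec B) (subvec C).

End MultivariatePareto.

Arguments exceed {R} n u.
Arguments calL {R} n.
Arguments margin {R n} mu I.

Section Trees.
Context {n : nat}.
Variable T : rel 'I_n.

Definition is_tree : Prop :=
  [/\ (0 < n)%N, symmetric T, irreflexive T,
      (forall i j, connect T i j) &
      forall c : seq 'I_n, cycle T c -> uniq c -> (size c <= 2)%N].

(* ph(ki; T^k); the list [zip (k :: p) p] consists of the successive directed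
   edges of the path [k :: p]. *)
Definition ph (k i : 'I_n) : {set 'I_n * 'I_n} :=
  finset (fun e => `[< exists p : seq 'I_n,
    [/\ path T k p, uniq (k :: p), last k p = i & e \in zip (k :: p) p] >]).

(* E^k *)
Definition directed_edges (k : 'I_n) : {set 'I_n * 'I_n} :=
  finset (fun e => T e.1 e.2 && (e \in ph k e.2)).

End Trees.

Section TreeModels.
Context {R : realType} {n : nat}.

Definition extremal_tree_model (T : rel 'I_n)
    (mu : set (n.-tuple R) -> \bar R) : Prop :=
  multivariate_pareto mu /\
  forall i j, i != j -> ~~ T i j ->
    extremal_cond_indep mu [set i]%SET [set j]%SET (~: [set i; j])%SET.

(* [W k] is the law of W^k; [We e] is the random variable W_e, constrained only
   for e in E^k.  This is a predicate of its own and not a consequence of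
   [extremal_tree_model]: the pairwise Markov property alone implies the
   representation only under a positivity condition on the density. *)
Definition tree_representation (T : rel 'I_n)
    (W : 'I_n -> probability (n.-tuple R) R) (k : 'I_n)
    d (Omega : measurableType d) (P : probability Omega R)
    (We : 'I_n * 'I_n -> {RV P >-> R}) : Prop :=
  [/\ (forall B : 'I_n * 'I_n -> set R, (forall e, measurable (B e)) ->
        P [set w | forall e, e \in directed_edges T k -> B e (We e w)] =
        (\prod_(e in directed_edges T k) fine (P (We e @^-1` B e)))%:E),
      (forall i j, (i, j) \in directed_edges T k ->
        forall A : set R, measurable A ->
        distribution P (We (i, j)) A = W i [set w | A (tnth w j)]) &
      forall A, measurable A ->
        W k A = P [set w | A [tuple \sum_(e in ph T k i) We e w | i < n]]].

End TreeModels.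

Section HueslerReiss.
Context {R : realType}.

Definition mvnormal_pdf n (m : 'I_n -> R) (S : 'M[R]_n) (x : n.-tuple R) : R :=
  let v := \row_j (tnth x j - m j) in
  (Num.sqrt ((2 * pi) ^+ n * \det S))^-1 *
  expR (- ((v *m invmx S *m v^T) 0 0) / 2).

Definition HR_parameter n (G : 'M[R]_n) : Prop :=
  [/\ G^T = G, (forall i, G i i = 0) &
      forall x : 'cV[R]_n, x != 0 -> \sum_i x i 0 = 0 ->
        (x^T *m G *m x) 0 0 < 0].

(* Sigma^(k), with [lift k] enumerating the indices different from k. *)
Definition HR_sigma n (G : 'M[R]_n) (k : 'I_n) : 'M[R]_n.-1 :=
  \matrix_(i, j) ((G (lift k i) k + G (lift k j) k
                   - G (lift k i) (lift k j)) / 2).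

Definition drop_comp n (k : 'I_n) (x : n.-tuple R) : n.-1.-tuple R :=
  [tuple tnth x (lift k j) | j < n.-1].

Definition huesler_reiss n (mu : set (n.-tuple R) -> \bar R) (G : 'M[R]_n) :
    Prop :=
  [/\ HR_parameter G, multivariate_pareto mu &
      forall k, exists2 nu : probability (n.-tuple R) R,
        extremal_function mu k nu &
        is_density (lebesgue_tuple n.-1) (pushforward nu (drop_comp k))
          (mvnormal_pdf (fun j => - HR_sigma G k j j / 2) (HR_sigma G k))].

End HueslerReiss.

(* Main.v *)
(* Since Y^k = W^k + E 1, the pair (Y^i_i, Y^i_j) is distributed as (E, E + D) with
   D = W^i_j.  For an MTP2 density, the four functions theorem bounds a product of
   probabilities of two sets by that of their joins and meets; for thin neighbourhoods
   of diagonals the exponential factors cancel, and D satisfies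
   P(D in I) P(D in J) <= P(D in I - s) P(D in J + s) for intervals I to the right of J,
   up to their endpoints.  Hence the averages of the law of D over shrinking intervals
   are log-concave, and so is a version of its density.  Conversely, the density of
   Y^k in a tree model is the product of exp(-y_k) and of the h_e(y_j - y_i) for e = (i, j)
   in E^k, and (x, y) |-> h(y - x) is totally positive for a log-concave h.

   For a Huesler-Reiss distribution the density of Y^k is exp(-y_k) times a Gaussian
   factor with a precision matrix Theta, Theta 1 = 0.  If Theta_ab <> 0, the density
   satisfies on some product of intervals a strict form of total positivity in (y_a, y_b),
   or of its converse, with a constant c > 1, which excludes conditional independence;
   so Theta vanishes off the edges.  With x the indicator of one side of an edge (i, j),
   Theta_ij = x Theta (1 - x)^T = - x Theta x^T <= 0.  The off-diagonal entries being
   nonpositive, the density is MTP2. *)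
Require Import Defs.
From HB Require Import structures.
From mathcomp Require Import all_boot all_order all_algebra.
From mathcomp Require Import all_classical all_reals all_analysis.
From mathcomp Require Import measurable_realfun ring lra.

Set Implicit Arguments.
Unset Strict Implicit.
Unset Printing Implicit Defensive.

Import Order.TTheory GRing.Theory Num.Theory.
Import numFieldNormedType.Exports.

Local Open Scope classical_set_scope.
Local Open Scope ring_scope.

(** * Lebesgue measure on tuples *)

(** A density is fixed only up to null sets, while [MTP2] and log-concavity are inequalities at
    every point; a version of a joint density cannot be evaluated along a line of constant
    [y_j - y_i]. Hence the passage through masses of sets: the four functions theorem turns the
    pointwise hypothesis into a property of the law, and a good version of the density of [D] is
    rebuilt from it. Thin strips replace lines; their width leaves a slack, removed in the limit
    because the distribution function of [D] is continuous.

    The equivalent conditions meet in the log-concavity of the law of [W^i_j] for all pairs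
    [i != j]. For pairs that are not edges it is read off from the EMTP2 property of the whole
    vector.

    The Huesler-Reiss claim comes without a tree representation, so Gaussian increments cannot
    simply be inserted in the equivalence: the pairwise Markov property itself has to be exploited.
    As it only concerns conditional probabilities for almost every value of the other coordinates,
    it is tested on masses of rectangles. *)

Section SigmaFiniteMeasure.
Context d (T : measurableType d) (R : realType).
Variables (m : {measure set T -> \bar R}) (sf : sigma_finite setT m).

Let m' : set T -> \bar R := m.

HB.instance Definition _ := Measure.on m'.

HB.instance Definition _ := Measure_isSigmaFinite.Build _ _ _ m' sf.

(** The existential form turns a proof of sigma-finiteness found in the middle of an argument into
    an object carrying the structure that Fubini's theorem expects. The neighbouring lemmas have
    this form for the same reason. *)
Lemma sigma_finite_measure_exists :
  exists sm : {sigma_finite_measure set T -> \bar R},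
    (sm : set T -> \bar R) = m.
Proof. by exists m'. Qed.

End SigmaFiniteMeasure.

(* The canonical sigma-finite structure of [m1 \x m2] is shadowed by the one for
   probabilities. *)
Lemma product_sigma_finite_measure_exists d1 d2 (T1 : measurableType d1)
    (T2 : measurableType d2) (R : realType)
    (m1 : {sigma_finite_measure set T1 -> \bar R})
    (m2 : {sigma_finite_measure set T2 -> \bar R}) :
  exists sm : {sigma_finite_measure set (T1 * T2)%type -> \bar R},
    (sm : set (T1 * T2)%type -> \bar R) = (m1 \x m2)%E.
Proof.
apply: (@sigma_finite_measure_exists _ _ _
  ((m1 \x m2)%E : {measure set (T1 * T2)%type -> \bar R})).
have /sigma_finiteP[F [TF ndF Foo]] := sigma_finiteT m1.
have /sigma_finiteP[G [TG ndG Goo]] := sigma_finiteT m2.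
exists (fun n => F n `*` G n).
  rewrite -setXTT TF TG; apply/seteqP; split=> [[x y] [[k _ Fx] [l _ Gy]]|].
    exists (maxn k l) => //; split.
      by move: Fx; apply/subsetPset/ndF/leq_maxl.
    by move: Gy; apply/subsetPset/ndG/leq_maxr.
  by move=> [x y] [k _ [Fx Gy]]; split; exists k.
move=> k; have [? ?] := Foo k; have [? ?] := Goo k.
split; first exact: measurableX.
by rewrite /= product_measure1E// lte_mul_pinfty// ge0_fin_numE.
Qed.

Section ImageMeasure.
Context d d' (T1 : measurableType d) (T2 : measurableType d') (R : realType).

Lemma image_measure_exists (m : {measure set T1 -> \bar R}) (f : T1 -> T2) :
  measurable_fun [set: T1] f ->
  exists m' : {measure set T2 -> \bar R},
    (m' : set T2 -> \bar R) = pushforward m f.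
Proof.
move=> mf; unshelve eexists.
  refine (pushforward m f : {measure set _ -> \bar R}); exact: mf.
by [].
Qed.

Lemma image_sigma_finite_measure_exists
    (m : {sigma_finite_measure set T1 -> \bar R}) (f : T1 -> T2) (g : T2 -> T1) :
  measurable_fun [set: T1] f -> measurable_fun [set: T2] g -> cancel f g ->
  exists m' : {sigma_finite_measure set T2 -> \bar R},
    (m' : set T2 -> \bar R) = pushforward m f.
Proof.
move=> mf mg fK; have [m' m'E] := image_measure_exists m mf.
have sf : sigma_finite setT m'.
  have [F UF mF] := sigma_finiteT m.
  exists (fun k => g @^-1` F k).
    rewrite -preimage_bigcup -UF; exact/esym/preimage_setT.
  move=> k; have [mFk Fk] := mF k; split.
    by rewrite -[X in measurable X]setTI; exact: mg.
  rewrite m'E /pushforward -comp_preimage.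
  by rewrite (_ : g \o f = id) ?preimage_id//; apply/funext => x /=; rewrite fK.
by have [sm smE] := sigma_finite_measure_exists sf; exists sm; rewrite smE.
Qed.

End ImageMeasure.

(* The library's Lebesgue measure and exponential law live on [measurableTypeR R],
   whose sigma-algebra is convertible to, but whose structure is not unifiable
   with, the canonical one of [R]: both are repackaged on the latter. *)
Section RealLine.
Context {R : realType}.

Definition lebR : set R -> \bar R := lebesgue_measure.

HB.instance Definition _ := isMeasure.Build _ _ _ lebR
  (@measure0 _ _ _ (@lebesgue_measure R)) (@measure_ge0 _ _ _ (@lebesgue_measure R))
  (@measure_semi_sigma_additive _ _ _ (@lebesgue_measure R)).

Let lebR_sigma_finite : sigma_finite setT lebR.
Proof. exact: (sigma_finiteT (@lebesgue_measure R)). Qed.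

HB.instance Definition _ := Measure_isSigmaFinite.Build _ _ _ lebR
  lebR_sigma_finite.

Lemma integral_lebR (D : set R) (f : R -> \bar R) :
  measurable D -> measurable_fun D f -> (forall x, D x -> 0 <= f x)%E ->
  (\int[lebesgue_measure]_(x in D) f x = \int[lebR]_(x in D) f x)%E.
Proof.
move=> mD mf f0.
have mid : measurable_fun setT (fun x : measurableTypeR R => x : R).
  by move=> _ A mA; rewrite setTI.
rewrite -(ge0_integral_pushforward mid lebesgue_measure mD mf)//.
by move=> y; rewrite inE; exact: f0.
Qed.

Let expM : probability (measurableTypeR R) R.
Proof. by refine (exponential_prob (1 : R) : probability _ _); exact: ltr01. Defined.

Definition expR1 : set R -> \bar R := exponential_prob 1.

HB.instance Definition _ := isMeasure.Build _ _ _ expR1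
  (@measure0 _ _ _ expM) (@measure_ge0 _ _ _ expM)
  (@measure_semi_sigma_additive _ _ _ expM).

HB.instance Definition _ := Measure_isProbability.Build _ _ _ expR1
  (@probability_setT _ _ _ expM).

Lemma expR1E (A : set R) : measurable A ->
  expR1 A = (\int[lebR]_(x in A) (exponential_pdf 1 x)%:E)%E.
Proof.
move=> mA; rewrite -integral_lebR//.
  apply/measurable_EFinP; apply: measurable_funTS.
  exact: measurable_exponential_pdf.
by move=> x _; rewrite lee_fin exponential_pdf_ge0.
Qed.

End RealLine.

Section LebesgueTuple.
Context {R : realType}.
Implicit Types n : nat.

Definition tcons n (p : R * n.-tuple R) : n.+1.-tuple R :=
  [tuple of p.1 :: p.2].

Lemma measurable_tcons n : measurable_fun setT (@tcons n).
Proof. exact: measurable_cons. Qed.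

Definition tuncons n (x : n.+1.-tuple R) : R * n.-tuple R :=
  (thead x, [tuple of behead x]).

Lemma tconsK n : cancel (@tcons n) (@tuncons n).
Proof.
by move=> [s x]; rewrite /tuncons /tcons/= theadE; congr pair; exact/val_inj.
Qed.

Lemma measurable_tuncons n : measurable_fun setT (@tuncons n).
Proof.
apply/measurable_fun_pairP; split; first exact: measurable_tnth.
exact: measurable_behead.
Qed.

Lemma lebesgue_tuple_sigma_finite n :
  exists m : {sigma_finite_measure set (n.-tuple R) -> \bar R},
    (m : set _ -> \bar R) = lebesgue_tuple n.
Proof.
elim: n => [|n [m IH]].
  by exists (dirac ([tuple] : 0.-tuple R) : {sigma_finite_measure set _ -> \bar R}).
have mc : measurable_fun setT (@tcons n : measurableTypeR R * n.-tuple R -> _).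
  exact: measurable_tcons.
have mu : measurable_fun setT (@tuncons n : _ -> measurableTypeR R * n.-tuple R).
  exact: measurable_tuncons.
have [m1 m1E] := product_sigma_finite_measure_exists (@lebesgue_measure R) m.
have [m' m'E] := image_sigma_finite_measure_exists m1 mc mu (@tconsK n).
by exists m'; rewrite m'E /= m1E IH.
Qed.

(** [lebesgue_tuple] is a bare set function; [leb] is the same function bundled with a sigma-finite
    measure structure. *)
Definition leb n : {sigma_finite_measure set (n.-tuple R) -> \bar R} :=
  projT1 (cid (lebesgue_tuple_sigma_finite n)).

Lemma lebE n : (leb n : set _ -> \bar R) = lebesgue_tuple n.
Proof. exact: (projT2 (cid (lebesgue_tuple_sigma_finite n))). Qed.

Lemma leb0E : (leb 0 : set _ -> \bar R) = dirac [tuple].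
Proof. exact: lebE. Qed.

Lemma lebS n (A : set (n.+1.-tuple R)) : measurable A ->
  leb n.+1 A = (lebR \x leb n)%E (@tcons n @^-1` A).
Proof.
move=> mA; rewrite lebE /= -lebE /pushforward /product_measure1 integral_lebR//.
apply: measurable_fun_xsection.
by rewrite -[X in measurable X]setTI; exact: measurable_tcons.
Qed.

Definition box n (B : 'I_n -> set R) : set (n.-tuple R) :=
  [set x | forall i, B i (tnth x i)].

Lemma measurable_box n (B : 'I_n -> set R) :
  (forall i, measurable (B i)) -> measurable (box B).
Proof.
move=> mB.
have -> : box B = \bigcap_(i in [set: 'I_n]) ((@tnth _ R ^~ i) @^-1` B i).
  by apply/seteqP; split=> [x Bx i _|x Bx i]; exact: Bx.
apply: fin_bigcap_measurable; first exact: finite_finset.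
by move=> i _; rewrite -[X in measurable X]setTI; exact: measurable_tnth.
Qed.

Lemma box_cons n (B : 'I_n.+1 -> set R) :
  @tcons n @^-1` box B = B ord0 `*` box (fun i => B (lift ord0 i)).
Proof.
apply/seteqP; split=> [[s x] /= Bx|[s x] [/= B0 Bx] i].
  by split=> [|i]; [exact: (Bx ord0)|have := Bx (lift ord0 i); rewrite tnthS].
by case: (unliftP ord0 i) => [j|] ->; rewrite ?tnthS//; exact: Bx.
Qed.

Lemma leb_box n (B : 'I_n -> set R) : (forall i, measurable (B i)) ->
  leb n (box B) = (\prod_(i < n) lebesgue_measure (B i))%E.
Proof.
elim: n B => [|n IH] B mB.
  rewrite leb0E big_ord0 diracE mem_set// => -[]//.
rewrite lebS; last exact: measurable_box.
rewrite box_cons product_measure1E//; last exact: measurable_box.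
by rewrite IH// big_ord_recl.
Qed.

Lemma measurable_tupleE n : @measurable _ (n.-tuple R) =
  <<s [set box B | B in [set B | forall i, measurable (B i)]] >>.
Proof.
apply/seteqP; split.
  apply: smallest_sub; first exact: smallest_sigma_algebra.
  rewrite -bigcup_seq => A [i /= _ [B mB <-]].
  apply: sub_gen_smallest; exists (fun j => if j == i then B else setT).
    by move=> j /=; case: ifP.
  rewrite setTI; apply/seteqP; split=> x /=.
    by move=> /(_ i); rewrite /= eqxx.
  by move=> Bx j; case: eqP => // ->.
apply: smallest_sub; first exact: sigma_algebra_measurable.
by move=> _ [B mB <-]; exact: measurable_box.
Qed.

Definition cube n (N : nat) : set (n.-tuple R) :=
  box (fun=> `[- N%:R, N%:R]%classic).

(** Boxes generate the sigma-algebra and are stable under intersection, and the cubes exhaust the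
    space. Gluing, insertion and product densities are checked on boxes through this lemma. *)
Lemma eq_measure_box n (m1 m2 : {measure set (n.-tuple R) -> \bar R}) :
  (forall B : 'I_n -> set R, (forall i, measurable (B i)) ->
    m1 (box B) = m2 (box B)) ->
  (forall N : nat, m1 (cube N) < +oo)%E ->
  forall A, measurable A -> m1 A = m2 A.
Proof.
move=> m12 m1oo; apply: (measure_unique
    [set box B | B in [set B | forall i, measurable (B i)]]
    (@cube n)) => //.
- exact: measurable_tupleE.
- move=> _ _ [B mB <-] [C mC <-]; exists (fun i => B i `&` C i).
    by move=> i; exact: measurableI.
  apply/seteqP; split=> x /= BCx; first by split=> i; case: (BCx i).
  by case: BCx => Bx Cx i; split.
- move=> N; by exists (fun=> `[- N%:R, N%:R]%classic).
- apply/seteqP; split=> // x _.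
  exists (\max_(i < n) Num.bound `|tnth x i|)%N => //= i /=.
  rewrite in_itv/= -ler_norml (le_trans (ltW (archi_boundP _)))// ler_nat.
  exact: leq_bigmax.
- by move=> _ [B mB <-]; exact: m12.
Qed.

Lemma leb_cube_lty n N : (leb n (cube N) < +oo)%E.
Proof.
rewrite /cube leb_box//; elim/big_rec: _ => [|i x _ x1]; first by rewrite ltry.
rewrite lte_mul_pinfty// ?lebesgue_measure_itv//=.
  by case: ifP.
Qed.

Lemma ge0_integral_lebS n (f : n.+1.-tuple R -> \bar R) :
  measurable_fun setT f -> (forall x, 0 <= f x)%E ->
  (\int[leb n.+1]_x f x = \int[lebR]_s \int[leb n]_x f (tcons (s, x)))%E.
Proof.
move=> mf f0.
have [m' m'E] := image_measure_exists (lebR \x leb n)%E (@measurable_tcons n).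
have -> : (\int[leb n.+1]_x f x = \int[m']_x f x)%E.
  by apply: eq_measure_integral => A mA _; rewrite m'E; exact: lebS.
rewrite m'E ge0_integral_pushforward//; last exact: measurable_tcons.
rewrite preimage_setT (@fubini_tonelli1 _ _ _ _ _ lebR (leb n))//.
by apply: measurableT_comp => //; exact: measurable_tcons.
by move=> x; exact: f0.
Qed.

End LebesgueTuple.

(** * The four functions theorem *)

Section FourFunctions.
Context {R : realType}.
Local Open Scope ereal_scope.

(** For real arguments with [c > 0]: [c (c + d - a - b) >= (c - a) (c - b) >= 0], because
    [a b <= c d]. *)
Lemma lee_add_of_lee_mul (a b c d : \bar R) :
  0 <= a -> 0 <= b -> 0 <= c -> 0 <= d ->
  a <= c -> b <= c -> a * b <= c * d -> a + b <= c + d.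
Proof.
case: c => [c| |]//; last by move=> _ _ _ d0 _ _ _; rewrite addye ?leey// gt_eqF// (lt_le_trans _ d0).
case: a => [a| |]//; case: b => [b| |]//; case: d => [d| |]//; last first.
  by move=> *; rewrite addey ?leey.
rewrite -!EFinM -!EFinD !lee_fin => a0 b0 c0 d0 ac bc abcd.
have [c_gt0|] := ltP 0%R c; last by move=> c_le0; lra.
rewrite -(ler_pM2l c_gt0).
have : (0 <= (c - a) * (c - b))%R by rewrite mulr_ge0// subr_ge0.
nra.
Qed.

Lemma lee_of_lee_double (x y : \bar R) : 0 <= y -> x + x <= y + y -> x <= y.
Proof.
case: y => [y| |]; case: x => [x| |] //= y0; rewrite ?leey ?leNye//.
by rewrite -!EFinD !lee_fin => ?; lra.
Qed.

(* By Fubini both sides are integrals over pairs; adding the values at [(s, t)] and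
   [(t, s)] reduces the claim to [lee_add_of_lee_mul]. *)
Lemma four_functions_real (f1 f2 f3 f4 : R -> \bar R) :
  measurable_fun setT f1 -> measurable_fun setT f2 ->
  measurable_fun setT f3 -> measurable_fun setT f4 ->
  (forall x, 0 <= f1 x) -> (forall x, 0 <= f2 x) ->
  (forall x, 0 <= f3 x) -> (forall x, 0 <= f4 x) ->
  (forall s t, f1 s * f2 t <= f3 (Num.max s t) * f4 (Num.min s t)) ->
  (\int[lebR]_x f1 x) * (\int[lebR]_x f2 x) <=
  (\int[lebR]_x f3 x) * (\int[lebR]_x f4 x).
Proof.
move=> m1 m2 m3 m4 p1 p2 p3 p4 H.
have inner (f g : R -> \bar R) : measurable_fun setT f -> measurable_fun setT g ->
    (forall x, 0 <= f x) -> (forall x, 0 <= g x) -> forall s,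
    \int[lebR]_t (f s * g t + f t * g s) =
    f s * \int[lebR]_x g x + (\int[lebR]_x f x) * g s.
  move=> mf mg f0 g0 s; rewrite ge0_integralD//.
  - by rewrite ge0_integralZl// ge0_integralZr.
  - by move=> t _; rewrite mule_ge0.
  - by apply: emeasurable_funM.
  - by move=> t _; rewrite mule_ge0.
  - by apply: emeasurable_funM.
have pos (f : R -> \bar R) : (forall x, 0 <= f x) -> 0 <= \int[lebR]_x f x.
  by move=> f0; apply: integral_ge0.
have outer (f g : R -> \bar R) : measurable_fun setT f -> measurable_fun setT g ->
    (forall x, 0 <= f x) -> (forall x, 0 <= g x) ->
    (\int[lebR]_x f x) * (\int[lebR]_x g x) + (\int[lebR]_x f x) * (\int[lebR]_x g x) =
    \int[lebR]_s \int[lebR]_t (f s * g t + f t * g s).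
  move=> mf mg f0 g0.
  have I0 := pos _ f0; have J0 := pos _ g0.
  rewrite [RHS](eq_integral _ _ (fun s _ => inner f g mf mg f0 g0 s)).
  rewrite ge0_integralD//.
  - by rewrite ge0_integralZr// ge0_integralZl.
  - by move=> s _; rewrite mule_ge0.
  - by apply: emeasurable_funM.
  - by move=> s _; rewrite mule_ge0.
  - by apply: emeasurable_funM.
have mouter (f g : R -> \bar R) : measurable_fun setT f -> measurable_fun setT g ->
    (forall x, 0 <= f x) -> (forall x, 0 <= g x) ->
    measurable_fun setT (fun s => \int[lebR]_t (f s * g t + f t * g s)).
  move=> mf mg f0 g0; under eq_fun do rewrite (inner f g)//.
  by apply: emeasurable_funD; apply: emeasurable_funM.
have minner (f g : R -> \bar R) : measurable_fun setT f -> measurable_fun setT g ->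
  forall s, measurable_fun setT (fun t => f s * g t + f t * g s).
  by move=> mf mg s; apply: emeasurable_funD; apply: emeasurable_funM.
have le_st s t : (s <= t)%R ->
    f1 s * f2 t + f1 t * f2 s <= f3 t * f4 s + f3 s * f4 t.
  move=> st; apply: lee_add_of_lee_mul; rewrite ?mule_ge0//.
  - by have := H s t; rewrite (max_idPr st) (min_idPl st).
  - by have := H t s; rewrite (max_idPl st) (min_idPr st).
  (* The product condition of [lee_add_of_lee_mul] is the product of the hypotheses at [(s, s)] and
     [(t, t)], with the factors regrouped. *)
  have := H s s; have := H t t; rewrite !maxxx !minxx => Ht Hs.
  rewrite muleACA [f2 t * _]muleC muleACA.
  rewrite [leRHS]muleC [leRHS]muleACA [f4 t * _]muleC [leRHS]muleACA.
  by apply: lee_pmul; rewrite ?mule_ge0.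
apply: lee_of_lee_double; rewrite ?mule_ge0 ?pos// !outer//.
have nonneg (f g : R -> \bar R) : (forall x, 0 <= f x) -> (forall x, 0 <= g x) ->
    forall s t, 0 <= f s * g t + f t * g s.
  by move=> f0 g0 s t; rewrite adde_ge0// mule_ge0.
apply: ge0_le_integral => //; try exact: mouter.
  by move=> s _; apply: integral_ge0 => t _; exact: nonneg.
move=> s _; apply: ge0_le_integral => //; try exact: minner;
    try by move=> t _; exact: nonneg.
  move=> t _; have [st|ts] := leP s t; first by rewrite [leRHS]addeC le_st.
  by rewrite addeC le_st// ltW.
Qed.

Lemma tmax_tcons n (s t : R) (x y : n.-tuple R) :
  tmax (tcons (s, x)) (tcons (t, y)) = tcons (Num.max s t, tmax x y).
Proof.
apply: eq_from_tnth => i; rewrite tnth_mktuple.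
by case: (unliftP ord0 i) => [j|] ->; rewrite ?tnthS ?tnth0 ?tnth_mktuple.
Qed.

Lemma tmin_tcons n (s t : R) (x y : n.-tuple R) :
  tmin (tcons (s, x)) (tcons (t, y)) = tcons (Num.min s t, tmin x y).
Proof.
apply: eq_from_tnth => i; rewrite tnth_mktuple.
by case: (unliftP ord0 i) => [j|] ->; rewrite ?tnthS ?tnth0 ?tnth_mktuple.
Qed.

Lemma measurable_tcons_section d n (T : measurableType d)
    (f : n.+1.-tuple R -> T) (s : R) :
  measurable_fun setT f -> measurable_fun setT (fun x => f (tcons (s, x))).
Proof.
move=> mf; apply: measurableT_comp => //.
by apply: (@measurable_cons _ _ _ _ (fun=> s) n id).
Qed.

Lemma measurable_integral_tcons n (f : n.+1.-tuple R -> \bar R) :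
  measurable_fun setT f -> (forall x, 0 <= f x) ->
  measurable_fun setT (fun s => \int[leb n]_x f (tcons (s, x))).
Proof.
move=> mf f0; apply: (@measurable_fun_fubini_tonelli_F _ _ _ _ _ (leb n)
  (f \o @tcons R n)) => //; last by move=> x; exact: f0.
by apply: measurableT_comp => //; exact: measurable_tcons.
Qed.

(* Ahlswede-Daykin/Karlin-Rinott, by induction on the dimension. *)
Lemma four_functions n (f1 f2 f3 f4 : n.-tuple R -> \bar R) :
  measurable_fun setT f1 -> measurable_fun setT f2 ->
  measurable_fun setT f3 -> measurable_fun setT f4 ->
  (forall x, 0 <= f1 x) -> (forall x, 0 <= f2 x) ->
  (forall x, 0 <= f3 x) -> (forall x, 0 <= f4 x) ->
  (forall x y, f1 x * f2 y <= f3 (tmax x y) * f4 (tmin x y)) ->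
  (\int[leb n]_x f1 x) * (\int[leb n]_x f2 x) <=
  (\int[leb n]_x f3 x) * (\int[leb n]_x f4 x).
Proof.
elim: n => [|n IH] in f1 f2 f3 f4 *.
  move=> m1 m2 m3 m4 p1 p2 p3 p4 H.
  rewrite leb0E !integral_dirac// !diracT !mul1e.
  by have := H [tuple] [tuple]; rewrite (tuple0 (tmax _ _)) (tuple0 (tmin _ _)).
move=> m1 m2 m3 m4 p1 p2 p3 p4 H; rewrite !ge0_integral_lebS//.
apply: four_functions_real; try exact: measurable_integral_tcons;
  try by move=> s; apply: integral_ge0.
move=> s t; apply: IH => //; try exact: measurable_tcons_section.
by move=> x y; rewrite -tmax_tcons -tmin_tcons.
Qed.

(** The four functions are the density restricted to the four sets. The conclusion involves the law
    alone, whatever version of the density was chosen, and applies to events in a few coordinates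
    without computing marginal densities. *)
Lemma MTP2_set n (Q : set (n.-tuple R) -> \bar R) (A B C D : set (n.-tuple R)) :
  MTP2 Q -> measurable A -> measurable B -> measurable C -> measurable D ->
  (forall x y, A x -> B y -> C (tmax x y) /\ D (tmin x y)) ->
  Q A * Q B <= Q C * Q D.
Proof.
move=> [f [mf f0 Qf] Hf] mA mB mC mD ABCD.
rewrite !Qf// -lebE !(integral_mkcond _ (fun x => (f x)%:E)).
have mr E : measurable E -> measurable_fun setT ((fun x => (f x)%:E) \_ E).
  move=> mE; apply/(measurable_restrictT _ _).1 => //.
  by apply: measurable_funTS; apply/measurable_EFinP.
have r0 E x : 0 <= ((fun x => (f x)%:E) \_ E) x.
  by rewrite patchE; case: ifP => // _; rewrite lee_fin.
apply: four_functions => //; try exact: mr; try exact: r0.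
move=> x y; rewrite {1 2}/patch; case: ifPn => [xA|_]; last by rewrite mul0e mule_ge0 ?r0.
case: ifPn => [yB|_]; last by rewrite mule0 mule_ge0 ?r0.
have [Cxy Dxy] := ABCD x y (set_mem xA) (set_mem yB).
by rewrite !patchE !mem_set// -!EFinM lee_fin.
Qed.

End FourFunctions.

(** * Log-concave densities *)

Section LogConcave.
Context {R : realType}.
Implicit Types (g h : R -> R).

Definition logconcave h := forall x y t : R, 0 < t < 1 ->
  h x `^ t * h y `^ (1 - t) <= h (t * x + (1 - t) * y).

Lemma powR_interpolate (c a b t : R) : 0 <= c -> 0 <= a -> 0 <= b -> 0 < t < 1 ->
  (c * a) `^ t * (c * b) `^ (1 - t) = c * (a `^ t * b `^ (1 - t)).
Proof.
move=> c0 a0 b0 /andP[t0 t1]; rewrite !powRM// mulrACA; congr *%R.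
rewrite -powRD; first by rewrite subrKC powRr1.
by rewrite subrKC oner_eq0.
Qed.

(* With [f := ln g - chord], a minimiser [c] of [f] is the midpoint of two points
   one of which is an endpoint, where [f = 0]; hence [2 f c >= f c + 0]. *)
Lemma logconcave_of_shift g : continuous g -> (forall x, 0 <= g x) ->
  (forall a b s, 0 <= s <= a - b -> g a * g b <= g (a - s) * g (b + s)) ->
  logconcave g.
Proof.
move=> cg g0 gs.
suff H x y t : y <= x -> 0 < t < 1 ->
    g x `^ t * g y `^ (1 - t) <= g (t * x + (1 - t) * y).
  move=> x y t t01; have [yx|/ltW xy] := leP y x; first exact: H.
  have := H y x (1 - t) xy; rewrite opprB subrKC mulrC [X in _ <= g X]addrC; apply.
  by move: t01 => /andP[? ?]; rewrite subr_gt0 ltrBlDr ltrDl; apply/andP.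
move=> yx /andP[t0 t1].
have [->|gx0] := eqVneq (g x) 0; first by rewrite powR0 ?mul0r// gt_eqF.
have [->|gy0] := eqVneq (g y) 0; first by rewrite powR0 ?mulr0// subr_eq0 gt_eqF.
have gx : 0 < g x by rewrite lt_neqAle eq_sym gx0 g0.
have gy : 0 < g y by rewrite lt_neqAle eq_sym gy0 g0.
pose p (u : R) := u * x + (1 - u) * y.
(* Positivity between the endpoints, so that logarithms can be taken: for [s = (1 - u) (x - y)] the
   shift inequality bounds [g x * g y > 0] by a product with the factor [g (p u)]. *)
have gp u : 0 <= u <= 1 -> 0 < g (p u).
  move=> u01; have := gs x y ((1 - u) * (x - y)).
  have -> : x - (1 - u) * (x - y) = p u by rewrite /p; ring.
  have := mulr_gt0 gx gy => gxy /(_ _) gxyp.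
  have : 0 < g (p u) * g (y + (1 - u) * (x - y)).
    apply: lt_le_trans gxy (gxyp _); apply/andP; split; first by nra.
    by nra.
  move=> H; rewrite lt_neqAle g0 andbT eq_sym; apply/eqP => gpu0.
  by move: H; rewrite gpu0 mul0r ltxx.
pose f u := ln (g (p u)) - (u * ln (g x) + (1 - u) * ln (g y)).
have cp : continuous p by move=> u; apply: cvgD; apply: cvgM; try exact: cvg_cst; try exact: cvg_id; apply: cvgB; [exact: cvg_cst|exact: cvg_id].
have cf : {within `[0, 1], continuous f}.
  apply: continuous_in_subspaceT => u; rewrite inE/= in_itv/= => u01.
  apply: cvgB.
    apply: continuous_comp; last exact/continuous_ln/gp.
    exact: continuous_comp (cp u) (cg _).
  by apply: cvgD; apply: cvgM; try exact: cvg_cst; try exact: cvg_id; apply: cvgB; [exact: cvg_cst|exact: cvg_id].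
have [c c01 fmin] := EVT_min ler01 cf.
have f0 : f 0 = 0 by rewrite /f /p mul0r add0r subr0 !mul1r mul0r add0r subrr.
have f1 : f 1 = 0 by rewrite /f /p subrr !mul0r !addr0 !mul1r subrr.
have mid d : 0 <= d -> 0 <= c - d -> c + d <= 1 -> f (c + d) + f (c - d) <= 2 * f c.
  move=> d0 cd0 cd1.
  have cd01 : 0 <= c - d <= 1 by lra.
  have cD01 : 0 <= c + d <= 1 by lra.
  have c01' : 0 <= c <= 1 by lra.
  have := gs (p (c + d)) (p (c - d)) (d * (x - y)).
  have -> : p (c + d) - d * (x - y) = p c by rewrite /p; ring.
  have -> : p (c - d) + d * (x - y) = p c by rewrite /p; ring.
  have -> : p (c + d) - p (c - d) = 2 * d * (x - y) by rewrite /p; ring.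
  have d01 : 0 <= d * (x - y) <= 2 * d * (x - y) by apply/andP; split; nra.
  move=> /(_ d01); rewrite -ler_ln ?posrE ?mulr_gt0 ?gp// !lnM ?posrE ?gp//.
  rewrite /f => ?; lra.
have fc : 0 <= f c.
  move: c01; rewrite in_itv/= => /andP[c0 c1].
  have [cle|cgt] := leP c (1 / 2).
    have := mid c c0; rewrite subrr f0.
    have : f c <= f (c + c) by apply: fmin; rewrite in_itv/=; lra.
    move=> ? /(_ _ _); move=> H; have := H (lexx _); have : c + c <= 1 by lra.
    by move=> ? /(_ ltac:(done)); lra.
  have := mid (1 - c); rewrite subrKC f1.
  have : f c <= f (c - (1 - c)) by apply: fmin; rewrite in_itv/=; lra.
  move=> ? H; have : f (c - (1 - c)) <= 2 * f c.
    by rewrite -[leLHS]add0r; apply: H; lra.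
  by lra.
have : 0 <= f t.
  by apply: le_trans fc _; apply: fmin; rewrite in_itv/= !ltW.
have gpt : 0 < g (p t) by apply: gp; rewrite !ltW.
by rewrite /f subr_ge0 => fle; rewrite /powR !gt_eqF// -expRD -[leRHS]lnK ?posrE// ler_expR.
Qed.
End LogConcave.

Section LimInf.
Context {R : realType}.
Implicit Type u : (\bar R)^nat.
Local Open Scope ereal_scope.

Lemma limn_einfE u : limn_einf u = ereal_sup (range (einfs u)).
Proof. by rewrite limn_einf_lim; apply/cvg_lim => //; exact: cvg_einfs_sup. Qed.

Lemma limn_einf_gt u (a : \bar R) : a < limn_einf u ->
  exists N, forall k, (N <= k)%N -> a < u k.
Proof.
rewrite limn_einfE => /ereal_sup_gt[_ [N _ <-] aN]; exists N => k Nk.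
by apply: lt_le_trans aN _; apply: ereal_inf_lbound; exists k.
Qed.

Lemma le_limn_einf u (a : \bar R) N : (forall k, (N <= k)%N -> a <= u k) ->
  a <= limn_einf u.
Proof.
move=> au; rewrite limn_einfE; apply: (@le_trans _ _ (einfs u N)).
  by apply: le_ereal_inf_tmp => _ [k /= Nk <-]; exact: au.
by apply: ereal_sup_ubound; exists N.
Qed.

Lemma cvg_limn_einf u l : u @ \oo --> l -> limn_einf u = l.
Proof.
by move=> ul; rewrite is_cvg_limn_einfE ?(cvg_lim _ ul)//; apply/cvg_ex; exists l.
Qed.

Lemma measurable_limn_einf d (T : measurableType d) (f : (T -> \bar R)^nat) :
  (forall n, measurable_fun setT (f n)) ->
  measurable_fun setT (fun x => limn_einf (f ^~ x)).
Proof.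
move=> mf; apply: measurableT_comp => //.
by apply: measurable_fun_limn_esup => n; exact: measurableT_comp.
Qed.

End LimInf.

Section LogConcaveLimit.
Context {R : realType}.

Lemma itv_not_negligible (N : set R) (a b : R) : lebR.-negligible N -> a < b ->
  exists2 x, a < x < b & ~ N x.
Proof.
move=> [A [mA A0 NA]] ab; apply: contrapT => H.
have : (lebR `]a, b[%classic <= lebR A)%E.
  apply: le_measure; rewrite ?inE// => x; rewrite /= in_itv/= => xab.
  by apply: NA; apply: contrapT => Nx; apply: H; exists x.
by rewrite [lebR A]A0 /lebR lebesgue_measure_itv/= lte_fin ab -EFinD lee_fin leNgt subr_gt0 ab.
Qed.

Lemma negligible_set1 (a : R) : lebR.-negligible [set a].
Proof. by exists [set a]; split => //; rewrite /lebR lebesgue_measure_set1. Qed.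

(* The version is [liminf g n]; it is finite, since an infinite value would make it
   infinite on an interval, where it agrees almost everywhere with [h]. *)
Lemma logconcave_ae_limit (h : R -> R) (g : nat -> R -> R) :
  measurable_fun setT h -> (forall x, 0 <= h x) ->
  (\int[lebR]_x (h x)%:E != 0)%E ->
  (forall n, measurable_fun setT (g n)) -> (forall n x, 0 <= g n x) ->
  (forall n, logconcave (g n)) ->
  {ae lebR, forall x, g n x @[n --> \oo] --> h x} ->
  exists hh : R -> R, [/\ measurable_fun setT hh, (forall x, 0 <= hh x),
    logconcave hh & {ae lebR, forall x, hh x = h x}].
Proof.
move=> mh h0 inth mg g0 lg gh.
pose L x : \bar R := limn_einf (fun n => (g n x)%:E).
have L0 x : (0 <= L x)%E by apply: (@le_limn_einf _ _ _ 0%N) => k _; rewrite lee_fin.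
have Lh x : g n x @[n --> \oo] --> h x -> L x = (h x)%:E.
  by move=> gx; apply: cvg_limn_einf; apply: cvg_EFin => //; exact: nearW.
have mL : measurable_fun setT L.
  by apply: measurable_limn_einf => n; exact/measurable_EFinP.
(* Log-concavity of [L] is phrased with real numbers strictly below its values, as [L] may a priori
   be infinite. *)
have Lpow x y t (a b : R) : 0 < t < 1 -> 0 <= a -> 0 <= b ->
    (a%:E < L x)%E -> (b%:E < L y)%E ->
    ((a `^ t * b `^ (1 - t))%:E <= L (t * x + (1 - t) * y)%R)%E.
  move=> t01 a0 b0 /limn_einf_gt[N aN] /limn_einf_gt[M bM].
  apply: (@le_limn_einf _ _ _ (maxn N M)) => k; rewrite geq_max => /andP[Nk Mk].
  rewrite lee_fin; apply: le_trans (lg k x y t t01).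
  move: t01 => /andP[t0 t1].
  have := aN k Nk; have := bM k Mk; rewrite !lte_fin => bk ak.
  by apply: ler_pM; rewrite ?powR_ge0// ge0_ler_powR ?nnegrE ?subr_ge0// ltW.
have Lfin x : L x \is a fin_num.
  rewrite ge0_fin_numE// ltNge leye_eq; apply/negP => /eqP Lx.
  have [y [hy yx Ly]] : exists y, [/\ h y != 0, y != x & L y = (h y)%:E].
    apply: contrapT => H; move/eqP: inth; apply.
    rewrite (@ge0_ae_eq_integral _ _ _ lebR setT _ (cst 0%E))//.
    - by rewrite integral0.
    - exact/measurable_EFinP.
    - by move=> y _; rewrite lee_fin.
    have nx : {ae lebR, forall y, y != x}.
      apply: negligibleS (negligible_set1 x) => y /= /negP; rewrite negbK.
      by move/eqP.
    apply: filterS2 gh nx => y gy yx _ /=.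
    have [->//|hy] := eqVneq (h y) 0.
    by exfalso; apply: H; exists y; split => //; exact: Lh.
  have {}hy : 0 < h y by rewrite lt_neqAle eq_sym hy h0.
  have Loo t : 0 < t < 1 -> L (t * x + (1 - t) * y) = +oo%E.
    move=> t01; apply/eqyP => A A0; have /andP[t0 t1] := t01.
    pose b := h y / 2; have b0 : 0 < b by rewrite divr_gt0.
    (* [a] solves [a^t b^(1 - t) = A]; it lies below [L x = +oo], so [L] at the convex combination
       is at least the arbitrary [A]. *)
    pose a := (A / b `^ (1 - t)) `^ t^-1.
    have aE : a `^ t = A / b `^ (1 - t).
      rewrite /a -powRrM mulVf ?gt_eqF// powRr1// divr_ge0 ?powR_ge0//.
      exact: ltW.
    have := @Lpow x y t a b t01 (powR_ge0 _ _) (ltW b0); rewrite Lx Ly ltry aE.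
    rewrite divfK ?gt_eqF ?powR_gt0//; apply => //.
    by rewrite lte_fin /b ltr_pdivrMr// mulr_natr mulr2n ltrDl.
  have : exists2 z, Order.min x y < z < Order.max x y & L z = (h z)%:E.
    have mxy : Order.min x y < Order.max x y.
      by move: yx; rewrite neq_lt gt_min !lt_max !ltxx /= orbF orbC.
    have [z zxy /contrapT gz] := itv_not_negligible gh mxy.
    by exists z => //; exact: Lh.
  move=> [z zxy Lz].
  pose t := (z - y) / (x - y).
  have xy0 : x - y != 0 by rewrite subr_eq0 eq_sym.
  have : L (t * x + (1 - t) * y) = +oo%E.
    apply: Loo; rewrite /t; move: yx; rewrite neq_lt => /orP[yx|xy].
      move: zxy; rewrite (min_r (ltW yx)) (max_l (ltW yx)) => /andP[z1 z2].
      by rewrite divr_gt0 ?subr_gt0// ltr_pdivrMr ?subr_gt0// mul1r ltrD2r.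
    move: zxy; rewrite (min_l (ltW xy)) (max_r (ltW xy)) => /andP[z1 z2].
    rewrite -mulrNN -invrN !opprB divr_gt0 ?subr_gt0//.
    by rewrite ltr_pdivrMr ?subr_gt0// mul1r ltrD2l ltrN2.
  have -> : t * x + (1 - t) * y = z.
    have -> : t * x + (1 - t) * y = t * (x - y) + y by ring.
    by rewrite /t divfK// subrK.
  by rewrite Lz.
exists (fine \o L); split.
- exact: measurableT_comp.
- by move=> x; exact: fine_ge0.
- move=> x y t t01 /=; have /andP[t0 t1] := t01.
  set A := fine (L x); set B := fine (L y); set z := t * x + _.
  have A0 : 0 <= A by exact: fine_ge0.
  have B0 : 0 <= B by exact: fine_ge0.
  have [->|An0] := eqVneq A 0; first by rewrite powR0 ?mul0r ?fine_ge0// gt_eqF.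
  have [->|Bn0] := eqVneq B 0.
    by rewrite powR0 ?mulr0 ?fine_ge0// subr_eq0 gt_eqF.
  have {An0}A_gt0 : 0 < A by rewrite lt_neqAle eq_sym An0.
  have {Bn0}B_gt0 : 0 < B by rewrite lt_neqAle eq_sym Bn0.
  (* Shrinking both values by [c < 1] produces the strict lower bounds that [Lpow] asks for. If the
     inequality failed, the [c] for which [c * P] is the midpoint of [fine (L z)] and [P] would
     contradict this. *)
  have Hc (c : R) : 0 < c < 1 -> c * (A `^ t * B `^ (1 - t)) <= fine (L z).
    move=> /andP[c0 c1]; rewrite -powR_interpolate ?(ltW c0)// -lee_fin fineK//.
    apply: Lpow; rewrite ?mulr_ge0 ?(ltW c0)// -[ltRHS]fineK// lte_fin.
      by rewrite -[ltRHS]mul1r ltr_pM2r.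
    by rewrite -[ltRHS]mul1r ltr_pM2r.
  rewrite leNgt; apply/negP => lt; set P := _ * _ in Hc lt.
  have P0 : 0 < P by rewrite mulr_gt0// powR_gt0.
  have Lz0 : 0 <= fine (L z) by exact: fine_ge0.
  pose c := (fine (L z) / P + 1) / 2.
  have cP : c * P = (fine (L z) + P) / 2 by rewrite /c; field; rewrite gt_eqF.
  have : c * P <= fine (L z).
    apply: Hc; have : 0 <= fine (L z) / P by rewrite divr_ge0// ltW.
    have : fine (L z) / P < 1 by rewrite ltr_pdivrMr// mul1r.
    by rewrite /c; lra.
  by rewrite cP; lra.
- by apply: filterS gh => x gx; rewrite /= Lh.
Qed.

End LogConcaveLimit.

(** * Null sets defined by a coordinate or a difference of coordinates *)

Section NullSets.
Context {R : realType}.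

Lemma lebR_shift (A : set R) (c : R) : measurable A ->
  lebR [set x | A (x + c)] = lebR A.
Proof.
move=> mA.
have mf : measurable_fun setT (fun x : measurableTypeR R => (x + c) : measurableTypeR R).
  by apply: (@measurable_funD _ _ R _ id (fun=> c)) => //; exact: measurable_id.
have [m' m'E] := image_measure_exists lebesgue_measure mf.
transitivity (m' A); first by rewrite m'E.
apply/esym/lebesgue_measure_unique => // _ [[a b] _ <-]; rewrite m'E /pushforward/=.
have -> : (fun x : R => x + c) @^-1` `]a, b]%classic = `](a - c), (b - c)]%classic.
  by apply/seteqP; split=> x /=; rewrite !in_itv/= ltrBlDr lerBrDr.
by rewrite !lebesgue_measure_itv/= !lte_fin ltrD2r -!EFinB; case: ifP => // _; congr EFin; ring.
Qed.

Lemma leb_null_coord n (i : 'I_n) (N : set R) : measurable N -> lebR N = 0%E ->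
  leb n [set x | N (tnth x i)] = 0%E.
Proof.
move=> mN N0.
have -> : [set x | N (tnth x i)] = box (fun j => if j == i then N else setT).
  apply/seteqP; split=> x /=; last by move=> /(_ i); rewrite /= eqxx.
  by move=> Nx j /=; case: eqP => // ->.
rewrite leb_box; last by move=> j; case: ifP.
by rewrite (bigD1 i)//= eqxx [lebesgue_measure N]N0 mul0e.
Qed.

Lemma measurable_tnth_diff n (i j : 'I_n) :
  measurable_fun setT (fun x : n.-tuple R => tnth x j - tnth x i).
Proof. by apply: measurable_funB; exact: measurable_tnth. Qed.

(** Induction on the dimension, slicing off the first coordinate [s]. If it is one of the two, the
    slice constrains a single coordinate to a translate of [N], possibly reflected; otherwise the
    induction hypothesis applies. *)
Lemma leb_null_diff n (i j : 'I_n) (N : set R) : i != j -> measurable N ->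
  lebR N = 0%E -> leb n [set x | N (tnth x j - tnth x i)] = 0%E.
Proof.
move=> + mN N0; elim: n i j => [[]//|n IH] i j ij.
have mA : measurable [set x : n.+1.-tuple R | N (tnth x j - tnth x i)].
  by rewrite -[X in measurable X]setTI; exact: measurable_tnth_diff.
rewrite lebS//; apply: integral0_eq => s _ /=.
have -> : xsection (@tcons R n @^-1` [set x | N (tnth x j - tnth x i)]) s =
    [set x : n.-tuple R | N (tnth (tcons (s, x)) j - tnth (tcons (s, x)) i)].
  by apply/seteqP; split=> x; rewrite /xsection/= inE.
case: (unliftP ord0 i) (unliftP ord0 j) ij => [i'|] -> [j'|] -> ij.
- under [X in leb n X]eq_set do rewrite !tnthS.
  by apply: IH; apply: contra_neq ij => ->.
- under [X in leb n X]eq_set do rewrite tnthS tnth0.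
  pose N' := [set u : R | N (s - u)].
  have mN' : measurable N'.
    by rewrite -[X in measurable X]setTI; exact: measurable_funB.
  apply: (@leb_null_coord _ _ N') => //.
  have mV : measurable [set v : R | N (v + s)].
    by rewrite -[X in measurable X]setTI; exact: measurable_funD.
  rewrite -N0 -(lebR_shift s mN) /lebR -[RHS]lebesgue_measureN//.
  by congr (lebesgue_measure _); apply/seteqP; split=> v; rewrite /N' /= addrC.
- under [X in leb n X]eq_set do rewrite tnthS tnth0.
  apply: (@leb_null_coord _ _ [set u : R | N (u - s)]); last by rewrite lebR_shift.
  by rewrite -[X in measurable X]setTI; exact: measurable_funB.
- by rewrite eqxx in ij.
Qed.
End NullSets.

(** * Recovering a log-concave density from masses of intervals *)

Section LogConcaveRegularisation.
Context {R : realType}.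
Variable nu : probability R R.
Hypothesis nu_ac : forall N : set R, measurable N -> lebR N = 0%E -> nu N = 0%E.

Lemma density_exists : exists h : R -> R, [/\ measurable_fun setT h,
  (forall x, 0 <= h x), lebR.-integrable setT (EFin \o h) &
  forall A, measurable A -> nu A = (\int[lebR]_(x in A) (h x)%:E)%E].
Proof.
have ac : nu `<< lebR.
  by move=> A A0 B BA mB; apply: nu_ac => //; exact: A0.
have [f [f0 ffin intf fE]] := radon_nikodym_sigma_finite ac.
exists (fine \o f); split.
- by apply: measurableT_comp => //; exact: measurable_int intf.
- by move=> x; exact: fine_ge0.
- by apply: eq_integrable intf => // x _ /=; rewrite fineK.
- by move=> A mA; rewrite fE//; apply: eq_integral => x _ /=; rewrite fineK.
Qed.

Let F x := fine (nu `]-oo, x]%classic).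

Let nu_fin A : measurable A -> nu A \is a fin_num.
Proof. by move=> mA; exact: fin_num_measure. Qed.

Let nu_oc a b : a <= b -> nu `]a, b]%classic = (F b - F a)%:E.
Proof.
move=> ab; rewrite EFinB !fineK ?nu_fin//.
have -> : `]a, b]%classic = `]-oo, b]%classic `\` `]-oo, a]%classic.
  apply/seteqP; split=> x /=; rewrite !in_itv/=.
    by move=> /andP[ax xb]; split => //; apply/negP; rewrite -ltNge.
  by move=> [-> /negP]; rewrite -ltNge => ->.
rewrite measureD//; last by rewrite ltey_eq nu_fin.
congr (_ - nu _)%E; apply/seteqP; split=> x /=; rewrite !in_itv/=; first by case.
by move=> xa; rewrite xa (le_trans xa).
Qed.

Let nu_oo a b : a <= b -> nu `]a, b[%classic = (F b - F a)%:E.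
Proof.
move=> ab; rewrite -nu_oc//; move: ab; rewrite le_eqVlt => /predU1P[->|ab].
  by congr (nu _); apply/seteqP; split=> x /=; rewrite !in_itv/=; case: ltgtP.
rewrite -(@setUitv1 _ _ _ b true) ?bnd_simp// measureU//.
  by rewrite [X in (_ + X)%E]nu_ac ?adde0// /lebR lebesgue_measure_set1.
by apply/seteqP; split=> x //= [xab xb]; move: xab; rewrite xb in_itv/= ltxx andbF.
Qed.

Let F_nd a b : a <= b -> F a <= F b.
Proof. by move=> ab; rewrite -subr_ge0 -lee_fin -nu_oc. Qed.

Let F_continuous : continuous F.
Proof.
have [h [mh h0 inth hE]] := density_exists.
move=> x; apply/cvgrPdist_lt => e e0.
have [d [d0 dH]] := integral_normr_continuous inth e0.
have main a b : a <= b -> b - a < d -> F b - F a < e.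
  move=> ab bad.
  have lab : lebR `]a, b]%classic = (b - a)%:E.
    rewrite /lebR lebesgue_measure_itv/= lte_fin; case: ltP => // ba.
    by have -> : a = b by [apply/eqP; rewrite eq_le ab ba]; rewrite subrr.
  have := dH `]a, b]%classic (measurable_itv _).
  rewrite /= lab lte_fin => /(_ bad); apply: le_lt_trans.
  under eq_Rintegral do rewrite ger0_norm//.
  by rewrite /Rintegral -hE// nu_oc.
near=> y.
have xyd : `|x - y| < d by near: y; apply: cvgr_dist_lt.
have [xy|/ltW yx] := leP x y.
  rewrite distrC ger0_norm ?subr_ge0 ?F_nd//; apply: main => //.
  by move: xyd; rewrite distrC ger0_norm// subr_ge0.
rewrite ger0_norm ?subr_ge0 ?F_nd//; apply: main => //.
by move: xyd; rewrite ger0_norm// subr_ge0.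
Unshelve. all: by end_near. Qed.

(** Log-concavity for masses of intervals of length [e], moved towards each other by [s]. The slack
    [d] shortens the intervals on the left and lengthens those on the right; it is the width of the
    strips from which the inequality is obtained, and [G_shift] lets it tend to [0]. *)
Hypothesis nu_itv : forall a b s e d : R, 0 <= s <= a - b -> 0 < d < e ->
  (nu `]a, (a + e - d)%R[%classic * nu `]b, (b + e - d)%R[%classic <=
   nu `](a - s - d)%R, (a - s + e)%R[%classic *
   nu `](b + s - d)%R, (b + s + e)%R[%classic)%E.

Let G e x := F (x + e) - F x.

Let G_continuous e : continuous (G e).
Proof.
move=> x; apply: cvgB; last exact: F_continuous.
apply: (@continuous_comp _ _ _ (fun x => x + e) F); last exact: F_continuous.
by apply: cvgD; [exact: cvg_id|exact: cvg_cst].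
Qed.

Let G_shift e a b s : 0 < e -> 0 <= s <= a - b ->
  G e a * G e b <= G e (a - s) * G e (b + s).
Proof.
move=> e0 sab; rewrite -subr_ge0.
pose phi d := (F (a - s + e) - F (a - s - d)) * (F (b + s + e) - F (b + s - d)) -
  (F (a + e - d) - F a) * (F (b + e - d) - F b).
have phi0 : phi 0 = G e (a - s) * G e (b + s) - G e a * G e b.
  by rewrite /phi !subr0.
have cphi : phi d @[d --> 0^'+] --> phi 0.
  apply: cvg_at_right_filter.
  have cF c : F (c - d) @[d --> 0] --> F (c - 0).
    apply: (@continuous_comp _ _ _ (fun d => c - d) F); last exact: F_continuous.
    by apply: cvgB; [exact: cvg_cst|exact: cvg_id].
  apply: cvgB; apply: cvgM; apply: cvgB; try exact: cvg_cst; exact: cF.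
rewrite -phi0; apply: (cvgr_to_ge cphi).
near=> d; have d0 : 0 < d by near: d; exact: nbhs_right_gt.
have de : d < e by near: d; exact: nbhs_right_lt.
have d01 : 0 < d < e by rewrite d0 de.
have := nu_itv sab d01; have /andP[s0 sab'] := sab.
have l1 : a <= a + e - d by lra.
have l2 : b <= b + e - d by lra.
have l3 : a - s - d <= a - s + e by lra.
have l4 : b + s - d <= b + s + e by lra.
rewrite (nu_oo l1) (nu_oo l2) (nu_oo l3) (nu_oo l4) -!EFinM lee_fin.
by rewrite /phi subr_ge0.
Unshelve. all: by end_near. Qed.

(* The functions [n (F (x + 1/n) - F x)] are log-concave and converge to the density
   almost everywhere by Lebesgue's differentiation theorem. *)
Lemma logconcave_regularisation : has_logconcave_density nu.
Proof.
have [h [mh h0 inth hE]] := density_exists.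
pose g (n : nat) x := n.+1%:R * G n.+1%:R^-1 x.
have gc n : continuous (g n).
  by move=> x; apply: cvgM; [exact: cvg_cst|exact: G_continuous].
have g0 n x : 0 <= g n x.
  by rewrite mulr_ge0// subr_ge0 F_nd// lerDl ltW.
have [] := @logconcave_ae_limit R h g mh h0.
- by rewrite -hE// probability_setT onee_neq0.
- by move=> n; exact: continuous_measurable_fun.
- exact: g0.
- move=> n; apply: logconcave_of_shift => //.
  by move=> a b s sab; rewrite /g mulrACA [leRHS]mulrACA ler_pM2l// G_shift.
- have inth' : lebesgue_measure.-integrable setT (EFin \o h).
    have [mh' fin] := integrableP _ _ _ inth; apply/integrableP; split => //.
    by rewrite integral_lebR//; exact: measurableT_comp.
  have intNy y : lebesgue_measure.-integrable `]-oo, y] (EFin \o h).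
    exact: integrableS measurableT _ (@subsetT _ _) inth'.
  have hF : (fun x => \int[lebesgue_measure]_(t in `]-oo, x]) h t) = F.
    apply/funext => x; rewrite /Rintegral /F hE// integral_lebR//.
      by apply: measurable_funTS; exact/measurable_EFinP.
    by move=> z _; rewrite lee_fin.
  have := FTC1Ny intNy (open_integrable_locally openT inth').
  rewrite /= hF => -[N [mN N0 NP]].
  have : {ae lebR, forall x, derivable F x 1 /\ derive1 F x = h x} by exists N.
  apply: filterS => x [dF <-].
  have h0' : (fun n : nat => n.+1%:R^-1 : R) @ \oo --> 0^'.
    move=> A nA; have : \forall n \near \oo, n.+1%:R^-1 != 0 :> R -> A n.+1%:R^-1.
      exact: (@cvg_harmonic R _ nA).
    by apply: filterS => n; apply; rewrite gt_eqF.
  have dF' : (fun d => d^-1 *: (F (d *: 1 + x) - F x)) @ 0^' --> derive1 F x.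
    by rewrite derive1E; exact: dF.
  have := cvg_comp _ _ h0' dF'; apply: cvg_trans.
  apply: near_eq_cvg; apply: nearW => n /=.
  by rewrite /g /G invrK /GRing.scale /= mulr1 [_ + x]addrC.
- move=> hh [mhh hh0 lhh hhh]; exists hh => //; split => //.
  move=> A mA; rewrite integral_lebR//; last 2 first.
    by apply: measurable_funTS; exact/measurable_EFinP.
    by move=> x _; rewrite lee_fin.
  rewrite hE//; apply: ge0_ae_eq_integral => //.
  + by apply: measurable_funTS; exact/measurable_EFinP.
  + by apply: measurable_funTS; exact/measurable_EFinP.
  + by move=> x _; rewrite lee_fin.
  + by move=> x _; rewrite lee_fin.
  + by apply: filterS hhh => x -> _.
Qed.
End LogConcaveRegularisation.

(** * Differences of coordinates of MTP2 vectors *)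

Section DifferenceLogConcave.
Context {R : realType}.

Lemma lebR_itv (i : interval R) : lebR [set` i] =
  (if i.1 < i.2 then (i.2 : \bar R) - i.1 else 0)%E.
Proof. exact: lebesgue_measure_itv. Qed.

Lemma density_null d (T : measurableType d) (leb law : set T -> \bar R) (f : T -> R)
    (m : {measure set T -> \bar R}) (A : set T) :
  leb = m -> is_density leb law f -> measurable A -> leb A = 0%E -> law A = 0%E.
Proof.
move=> -> [mf f0 lawE] mA mA0; rewrite lawE//.
apply: null_set_integral => //.
by apply: measurable_funTS; exact/measurable_EFinP.
Qed.

Lemma expR1T : expR1 [set: R] = 1%E.
Proof. exact: (@probability_setT _ _ _ (expR1 : probability R R)). Qed.

Lemma expR1_itv_gt0 (x y : R) : 0 < x -> x < y -> (0 < expR1 `]x, y[%classic)%E.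
Proof.
move=> x0 xy; rewrite expR1E//.
apply: (@lt_le_trans _ _ (\int[lebR]_(t in `]x, y[) (expR (- y))%:E)%E).
  rewrite integral_cst//= lebR_itv/= lte_fin xy -EFinB -EFinM lte_fin.
  by rewrite mulr_gt0 ?expR_gt0// subr_gt0.
apply: ge0_le_integral => //.
- apply/measurable_EFinP; apply: measurable_funTS; exact: measurable_exponential_pdf.
- move=> t; rewrite /= in_itv/= => /andP[xt ty].
  rewrite lee_fin exponential_pdfE ?(ltW (lt_trans x0 xt))//.
  by rewrite mul1r mulN1r ler_expR lerN2 ltW.
Qed.

(* The rectangles of side [d] around the lines [y_i = x] make the exponential
   factors of both sides equal, so that they cancel. *)
Lemma MTP2_difference_logconcave n (Q : set (n.-tuple R) -> \bar R) (i j : 'I_n)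
    (nu : probability R R) : i != j -> MTP2 Q ->
  (forall A : set (R * R), measurable A ->
    Q [set y | A (tnth y i, tnth y j)] =
    (expR1 \x nu)%E [set p | A (p.1, p.1 + p.2)]) ->
  has_logconcave_density nu.
Proof.
move=> ij Q2 QE.
have mpair : measurable_fun setT (fun y : n.-tuple R => (tnth y i, tnth y j)).
  by apply/measurable_fun_pairP; split; exact: measurable_tnth.
have mpre (A : set (R * R)) : measurable A ->
    measurable [set y : n.-tuple R | A (tnth y i, tnth y j)].
  by move=> mA; rewrite -[X in measurable X]setTI; exact: mpair.
have mshear : measurable_fun setT (fun p : R * R => (p.1, p.1 + p.2)).
  apply/measurable_fun_pairP; split; first exact: measurable_fst.
  exact: (measurable_funD measurable_fst measurable_snd).
have mpre2 (A : set (R * R)) : measurable A ->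
    measurable [set p : R * R | A (p.1, p.1 + p.2)].
  by move=> mA; rewrite -[X in measurable X]setTI; exact: mshear.
apply: logconcave_regularisation.
  (* Absolute continuity of [nu]: the event that [y_j - y_i] lies in [N] has [Q]-mass [nu N], and it
     is Lebesgue null when [N] is. *)
  move=> N mN N0.
  pose A := [set p : R * R | N (p.2 - p.1)].
  have mA : measurable A.
    rewrite -[X in measurable X]setTI; exact: (measurable_funB measurable_snd measurable_fst).
  have := QE A mA.
  have [f Qf _] := Q2.
  rewrite (density_null (esym (lebE n)) Qf); last 2 first.
  - exact: mpre.
  - by rewrite -lebE; exact: leb_null_diff.
  rewrite (_ : [set p | A (p.1, p.1 + p.2)] = setT `*` N); last first.
    by apply/seteqP; split=> p; rewrite /A /= addrAC subrr add0r; [split|case].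
  by rewrite product_measure1E//= expR1T mul1e.
move=> a b s e d /andP[s0 sab] /andP[d0 de].
(* The corners satisfy [x <= x'] and [z <= z'], so the join of points of [rect x z'] and [rect x' z]
   is in [rect x' z'] and their meet in [rect x z]. The differences are [z' - x = a], [z - x' = b],
   [z - x = a - s] and [z' - x' = b + s]. Starting at [1] keeps the first coordinate where the
   exponential density is positive. *)
pose x : R := 1; pose x' := 1 + (a - b - s); pose z := a + 1 - s; pose z' := a + 1.
pose rect u v := `]u, u + d[%classic `*` `]v, v + e[%classic.
have mrect u v : measurable (rect u v) by exact: measurableX.
have Qle : (Q [set y | rect x z' (tnth y i, tnth y j)] *
    Q [set y | rect x' z (tnth y i, tnth y j)] <=
    Q [set y | rect x' z' (tnth y i, tnth y j)] *
    Q [set y | rect x z (tnth y i, tnth y j)])%E.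
  apply: MTP2_set => //; try exact: mpre.
  move=> y y'; rewrite /rect /= !in_itv/= !tnth_mktuple.
  rewrite !lt_max !gt_max !lt_min !gt_min /x /x' /z /z'.
  move=> [/andP[a1 a2] /andP[a3 a4]] [/andP[b1 b2] /andP[b3 b4]].
  by do ![split|apply/andP; split]; try (apply/orP; lra); lra.
(* On a strip of width [d] the first coordinate is known up to [d], so an interval for the second
   one encloses and is enclosed by intervals for the difference, at the cost of [d]. *)
have lower u v : (expR1 `]u, (u + d)%R[%classic *
    nu `](v - u)%R, (v - u + e - d)%R[%classic <=
    Q [set y | rect u v (tnth y i, tnth y j)])%E.
  rewrite QE// -product_measure1E//; apply: le_measure; rewrite ?inE//.
  - exact: measurableX.
  - exact: mpre2.
  - move=> p [] /=; rewrite /rect /= !in_itv/= => /andP[? ?] /andP[? ?].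
    by split; apply/andP; split; lra.
have upper u v : (Q [set y | rect u v (tnth y i, tnth y j)] <=
    expR1 `]u, (u + d)%R[%classic *
    nu `](v - u - d)%R, (v - u + e)%R[%classic)%E.
  rewrite QE// -product_measure1E//; apply: le_measure; rewrite ?inE//.
  - exact: mpre2.
  - exact: measurableX.
  - move=> p [] /=; rewrite /rect /= !in_itv/= => /andP[? ?] /andP[? ?].
    by split; apply/andP; split; lra.
have E0 u : 0 < u -> (0 < expR1 `]u, (u + d)%R[%classic)%E.
  by move=> u0; apply: expR1_itv_gt0 => //; rewrite ltrDl.
have x'0 : 0 < x' by rewrite /x'; lra.
have fE u : expR1 `]u, (u + d)%R[%classic \is a fin_num by exact: fin_num_measure.
have le4 := le_trans (lee_pmul _ _ (lower x z') (lower x' z)) (le_trans Qle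
  (lee_pmul _ _ (upper x' z') (upper x z))).
rewrite -(@lee_pmul2l _ (expR1 `]x, (x + d)%R[%classic * expR1 `]x', (x' + d)%R[%classic)%E); last 2 first.
- by rewrite fin_numM.
- by rewrite mule_gt0// E0.
have -> : a - s = z - x by rewrite /z /x; ring.
have -> : b + s = z' - x' by rewrite /z' /x'; ring.
rewrite muleACA [leRHS]muleACA [leRHS]muleC.
have -> : a = z' - x by rewrite /z' /x; ring.
have -> : b = z - x' by rewrite /z /x'; ring.
apply: le4; rewrite ?mule_ge0//.
- by rewrite QE//; exact: measure_ge0.
- by rewrite QE//; exact: measure_ge0.
Qed.
End DifferenceLogConcave.

(** * Changes of variables *)

Section Gluing.
Context {R : realType}.

(** Rebuilds a vector from its subvector outside [{i, j}] and the pair of remaining coordinates.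
    Every other index occurs in the enumeration of the complement, so the default [0] is never
    reached. *)
Definition tglue n (i j : 'I_n) (p : #|~: [set i; j]|.-tuple R * (R * R)) : n.-tuple R :=
  [tuple if k == i then p.2.1 else if k == j then p.2.2 else
    if [pick a | enum_val a == k] is Some a then tnth p.1 a else 0 | k < n].

Arguments tglue {n} i j p.

Lemma tglue_fst n (i j : 'I_n) p : tnth (tglue i j p) i = p.2.1.
Proof. by rewrite tnth_mktuple eqxx. Qed.

Lemma tglue_snd n (i j : 'I_n) p : i != j -> tnth (tglue i j p) j = p.2.2.
Proof. by rewrite tnth_mktuple eq_sym => /negPf ->; rewrite eqxx. Qed.

Lemma tglue_rest n (i j : 'I_n) p a : tnth (tglue i j p) (enum_val a) = tnth p.1 a.
Proof.
have := enum_valP a; rewrite !inE negb_or tnth_mktuple => /andP[/negPf -> /negPf ->].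
by case: pickP => [b /eqP/enum_val_inj ->//|/(_ a)]; rewrite eqxx.
Qed.

Lemma tglue_cases n (i j : 'I_n) k :
  [\/ k = i, k = j | exists a : 'I_#|~: [set i; j]%SET|, k = enum_val a].
Proof.
have [->|ki] := eqVneq k i; first by constructor 1.
have [->|kj] := eqVneq k j; first by constructor 2.
have kC : k \in ~: [set i; j]%SET by rewrite !inE negb_or ki.
by constructor 3; exists (enum_rank_in kC k); rewrite enum_rankK_in.
Qed.

Lemma measurable_tglue n (i j : 'I_n) : i != j -> measurable_fun setT (tglue i j).
Proof.
move=> ij; apply/measurable_fun_tnthP => k.
have [->|->|[a ->]] := tglue_cases i j k.
- rewrite (_ : _ \o _ = fun p => p.2.1); last by apply/funext => p /=; rewrite tglue_fst.
  exact: (measurableT_comp measurable_fst measurable_snd).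
- rewrite (_ : _ \o _ = fun p => p.2.2); last by apply/funext => p /=; rewrite tglue_snd.
  exact: (measurableT_comp measurable_snd measurable_snd).
- rewrite (_ : _ \o _ = fun p => tnth p.1 a); last by apply/funext => p /=; rewrite tglue_rest.
  exact: (measurableT_comp (measurable_tnth a) measurable_fst).
Qed.

Lemma leb_tglue n (i j : 'I_n) (A : set (n.-tuple R)) : i != j -> measurable A ->
  leb n A = (leb #|~: [set i; j]%SET| \x (lebR \x lebR))%E (tglue i j @^-1` A).
Proof.
move=> ij mA.
have [l2 l2E] := product_sigma_finite_measure_exists (@lebR R) (@lebR R).
rewrite -l2E; have [m' m'E] := image_measure_exists
  (leb #|~: [set i; j]%SET| \x l2)%E (measurable_tglue ij).
transitivity (m' A); last by rewrite m'E.
apply: eq_measure_box mA => [B mB|N]; last exact: leb_cube_lty.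
rewrite m'E /pushforward.
have -> : tglue i j @^-1` box B = box (fun a => B (enum_val a)) `*` (B i `*` B j).
  apply/seteqP; split=> p /=.
    move=> Bp; split; first by move=> a; have := Bp (enum_val a); rewrite tglue_rest.
    by split; [have := Bp i; rewrite tglue_fst|have := Bp j; rewrite tglue_snd].
  move=> [Bz [Bi Bj]] k; have [->|->|[a ->]] := tglue_cases i j k.
  - by rewrite tglue_fst.
  - by rewrite tglue_snd.
  - by rewrite tglue_rest; exact: Bz.
have mbox : measurable (box (fun a : 'I_#|~: [set i; j]%SET| => B (enum_val a))).
  exact: measurable_box.
rewrite /= product_measure1E//=; last exact: measurableX.
rewrite l2E product_measure1E// !leb_box//.
rewrite (bigD1 i)//= (bigD1 j) 1?eq_sym//=.
rewrite muleA muleC; congr (_ * _)%E.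
rewrite -(big_enum_val (fun k => lebesgue_measure (B k))).
by apply: eq_bigl => k; rewrite !inE negb_or.
Qed.

Lemma ge0_integral_tglue n (i j : 'I_n) (f : n.-tuple R -> \bar R) : i != j ->
  measurable_fun setT f -> (forall x, 0 <= f x)%E ->
  (\int[leb n]_x f x =
   \int[leb #|~: [set i; j]%SET|]_z \int[lebR]_u \int[lebR]_v f (tglue i j (z, (u, v))))%E.
Proof.
move=> ij mf f0.
have [l2 l2E] := product_sigma_finite_measure_exists (@lebR R) (@lebR R).
have [m' m'E] := image_measure_exists
  (leb #|~: [set i; j]%SET| \x l2)%E (measurable_tglue ij).
have -> : (\int[leb n]_x f x = \int[m']_x f x)%E.
  by apply: eq_measure_integral => A mA _; rewrite m'E /pushforward/= l2E; exact: leb_tglue.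
have mfg : measurable_fun setT (f \o tglue i j).
  by apply: measurableT_comp => //; exact: measurable_tglue.
rewrite m'E ge0_integral_pushforward//; last exact: measurable_tglue.
rewrite preimage_setT (@fubini_tonelli1 _ _ _ _ _ (leb #|~: [set i; j]%SET|) l2)//; last first.
  by move=> p; exact: f0.
apply: eq_integral => z _; rewrite /fubini_F.
transitivity (\int[lebR \x lebR]_y (f \o tglue i j) (z, y))%E.
  by apply: eq_measure_integral => A mA _; rewrite l2E.
rewrite (@fubini_tonelli1 _ _ _ _ _ (@lebR R) (@lebR R))//.
  apply: measurableT_comp mfg _.
  by apply/measurable_fun_pairP; split; [exact: measurable_cst|exact: measurable_id].
by move=> y; exact: f0.
Qed.

Definition shear n (i j : 'I_n) (x : n.-tuple R) : n.-tuple R :=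
  [tuple if k == j then tnth x j - tnth x i else tnth x k | k < n].

Lemma measurable_shear n (i j : 'I_n) : measurable_fun setT (@shear n i j).
Proof.
apply/measurable_fun_tnthP => k; rewrite /comp.
under eq_fun do rewrite tnth_mktuple.
by case: eqP => _; [exact: measurable_tnth_diff|exact: measurable_tnth].
Qed.

End Gluing.

Arguments tglue {R n} i j p.

Section ChangeOfVariables.
Context {R : realType}.

Lemma shear_tglue n (i j : 'I_n) z (u v : R) : i != j ->
  shear i j (tglue i j (z, (u, v))) = tglue i j (z, (u, v - u)) :> n.-tuple R.
Proof.
move=> ij; apply: eq_from_tnth => k; rewrite tnth_mktuple.
have [->|->|[a ->]] := tglue_cases i j k.
- by rewrite (negPf ij) !tglue_fst.
- by rewrite eqxx !tglue_snd// tglue_fst.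
- have := enum_valP a; rewrite !inE negb_or => /andP[_ /negPf ->].
  by rewrite !tglue_rest.
Qed.

(** In glued coordinates the shear is [v |-> v - u] with everything else fixed, and Lebesgue measure
    on the line is translation invariant. *)
Lemma leb_shear n (i j : 'I_n) (A : set (n.-tuple R)) : i != j -> measurable A ->
  leb n (shear i j @^-1` A) = leb n A.
Proof.
move=> ij mA.
have mSA : measurable (shear i j @^-1` A).
  by rewrite -[X in measurable X]setTI; exact: measurable_shear.
have ind (B : set (n.-tuple R)) : measurable B ->
    leb n B = (\int[leb #|~: [set i; j]%SET|]_z \int[lebR]_u \int[lebR]_v
      (\1_B (tglue i j (z, (u, v))))%:E)%E.
  move=> mB; rewrite -[B in LHS]setIT -integral_indic//.
  rewrite (ge0_integral_tglue (f := fun x => (\1_B x)%:E) ij)//.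
  exact/measurable_EFinP.
rewrite (ind _ mSA) (ind _ mA).
apply: eq_integral => z _; apply: eq_integral => u _.
pose S := [set v : R | A (tglue i j (z, (u, v)))].
have mS : measurable S.
  rewrite -[X in measurable X]setTI.
  have mg : measurable_fun setT (fun v : R => tglue i j (z, (u, v))).
    apply: measurableT_comp (measurable_tglue ij) _.
    apply/measurable_fun_pairP; split; first exact: measurable_cst.
    by apply/measurable_fun_pairP; split; [exact: measurable_cst|exact: measurable_id].
  exact: mg.
transitivity (lebR [set v | S (v + - u)]).
  rewrite -[X in _ = lebR X]setIT -integral_indic//.
    apply: eq_integral => v _; rewrite !indicE; congr ((nat_of_bool _)%:R%:E).
    by apply/idP/idP; rewrite !inE /S /= shear_tglue.
  rewrite -[X in measurable X]setTI.
  have mt : measurable_fun setT (fun v : R => v - u) by exact: measurable_funB.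
  exact: mt.
rewrite lebR_shift// -[X in lebR X = _]setIT -integral_indic//.
Qed.

(** For the parent function of a tree rooted at [k] and [U] the other vertices, the result consists
    of the root value and the increments along the edges; for a constant [pa], of differences to one
    coordinate. *)
Definition parent_diff n (pa : 'I_n -> 'I_n) (U : {set 'I_n}) (x : n.-tuple R) : n.-tuple R :=
  [tuple if k \in U then tnth x k - tnth x (pa k) else tnth x k | k < n].

Lemma measurable_parent_diff n (pa : 'I_n -> 'I_n) U :
  measurable_fun setT (parent_diff pa U).
Proof.
apply/measurable_fun_tnthP => k; rewrite /comp.
under eq_fun do rewrite tnth_mktuple.
by case: (k \in U); [exact: measurable_tnth_diff|exact: measurable_tnth].
Qed.

(** Induction on the size of [U]: an index [j] of minimal depth has its parent outside [U], where
    coordinates are left unchanged, so treating [j] last is a single shear. The depth makes the map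
    triangular with unit diagonal. *)
Lemma leb_parent_diff n (pa : 'I_n -> 'I_n) (dep : 'I_n -> nat) (U : {set 'I_n})
    (A : set (n.-tuple R)) :
  (forall k, k \in U -> (dep (pa k) < dep k)%N) -> measurable A ->
  leb n (parent_diff pa U @^-1` A) = leb n A.
Proof.
move: {2}#|U| (erefl #|U|) => m; elim: m U A => [|m IH] U A.
  move/eqP; rewrite cards_eq0 => /eqP -> _ _; congr (leb n _).
  apply/seteqP; split=> x /=; rewrite (_ : parent_diff pa finset.set0 x = x)//;
    by apply: eq_from_tnth => k; rewrite tnth_mktuple inE.
move=> Um paU mA.
have [k0 k0U] : exists k0, k0 \in U by apply/card_gt0P; rewrite Um.
have [j jU jmin] := arg_minnP dep k0U.
have {}jU : j \in U by [].
have pj : pa j != j by apply/eqP => pj; have := paU j jU; rewrite pj ltnn.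
have -> : parent_diff pa U @^-1` A =
    parent_diff pa (U :\ j) @^-1` (shear (pa j) j @^-1` A).
  have E x : parent_diff pa U x = shear (pa j) j (parent_diff pa (U :\ j) x).
    apply: eq_from_tnth => k; rewrite !tnth_mktuple !inE eqxx/=.
    have -> : pa j \in U = false.
      by apply/negP => /jmin; rewrite leqNgt paU.
    by rewrite andbF; have [->|kj] := eqVneq k j; rewrite /= ?jU.
  by apply/seteqP; split=> x /=; rewrite E.
rewrite IH ?leb_shear//.
- by move: Um; rewrite (cardsD1 j) jU add1n => -[].
- by move=> k; rewrite !inE => /andP[_ kU]; exact: paU.
- by rewrite -[X in measurable X]setTI; exact: measurable_shear.
Qed.

Lemma ge0_integral_parent_diff n (pa : 'I_n -> 'I_n) (dep : 'I_n -> nat) (U : {set 'I_n})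
    (f : n.-tuple R -> \bar R) :
  (forall k, k \in U -> (dep (pa k) < dep k)%N) ->
  measurable_fun setT f -> (forall x, 0 <= f x)%E ->
  (\int[leb n]_x f (parent_diff pa U x) = \int[leb n]_x f x)%E.
Proof.
move=> paU mf f0.
have mp := @measurable_parent_diff n pa U.
have [m' m'E] := image_measure_exists (leb n) mp.
have -> : (\int[leb n]_x f x = \int[m']_x f x)%E.
  by apply: eq_measure_integral => A mA _; rewrite m'E; exact/esym/(leb_parent_diff paU).
by rewrite m'E ge0_integral_pushforward// preimage_setT.
Qed.

Lemma density_change_of_variables n (pa : 'I_n -> 'I_n) (dep : 'I_n -> nat)
    (U : {set 'I_n}) (phi : n.-tuple R -> n.-tuple R) (f : n.-tuple R -> R)
    (Q : set (n.-tuple R) -> \bar R) :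
  (forall k, k \in U -> (dep (pa k) < dep k)%N) ->
  measurable_fun setT phi -> cancel (parent_diff pa U) phi ->
  measurable_fun setT f -> (forall x, 0 <= f x) ->
  (forall A, measurable A -> Q A = (\int[leb n]_(x in phi @^-1` A) (f x)%:E)%E) ->
  is_density (lebesgue_tuple n) Q (f \o parent_diff pa U).
Proof.
move=> paU mphi phiK mf f0 QE; split.
- by apply: measurableT_comp mf _; exact: measurable_parent_diff.
- by move=> x; exact: f0.
move=> A mA; rewrite QE// -lebE integral_mkcond.
rewrite -(ge0_integral_parent_diff paU); last 2 first.
- apply/(measurable_restrictT _ _).1.
    by rewrite -[X in measurable X]setTI; exact: mphi.
  by apply: measurable_funTS; exact/measurable_EFinP.
- by move=> x; rewrite patchE; case: ifP => // _; rewrite lee_fin.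
rewrite [RHS]integral_mkcond; apply: eq_integral => x _.
by rewrite !patchE; congr (if _ then _ else _); apply/idP/idP; rewrite !inE /= phiK.
Qed.

End ChangeOfVariables.

(** * Product densities and independent increments *)

Section DensityMeasure.
Local Open Scope ereal_scope.
Context d (T : measurableType d) (R : realType).
Variables (m : {measure set T -> \bar R}) (f : T -> \bar R).
Hypotheses (mf : measurable_fun setT f) (f0 : forall x, 0 <= f x).

Let md A := \int[m]_(x in A) f x.

Let md0 : md set0 = 0. Proof. by rewrite /md integral_set0. Qed.

Let md_ge0 A : 0 <= md A. Proof. by apply: integral_ge0 => x _; exact: f0. Qed.

Let md_sigma_additive : semi_sigma_additive md.
Proof.
move=> F mF tF mUF; rewrite /md ge0_integral_bigcup//.
  apply: is_cvg_nneseries => n _ _; exact: md_ge0.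
exact: measurable_funTS.
Qed.

HB.instance Definition _ := isMeasure.Build _ _ _ md md0 md_ge0 md_sigma_additive.

Lemma density_measure_exists :
  exists m' : {measure set T -> \bar R}, forall A, m' A = \int[m]_(x in A) f x.
Proof. by exists md. Qed.

End DensityMeasure.

Section ProductDensity.
Context {R : realType}.
Local Open Scope ereal_scope.

Lemma measurable_prod_tnth n (f : 'I_n -> R -> \bar R) :
  (forall i, measurable_fun setT (f i)) ->
  measurable_fun setT (fun x : n.-tuple R => \prod_(i < n) f i (tnth x i)).
Proof.
move=> mf; elim: (index_enum _) => [|i r IH].
  by under eq_fun do rewrite big_nil; exact: measurable_cst.
under eq_fun do rewrite big_cons.
apply: emeasurable_funM => //.
by apply: measurableT_comp => //; exact: measurable_tnth.
Qed.

Lemma ge0_integral_prod_tnth n (f : 'I_n -> R -> \bar R) :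
  (forall i, measurable_fun setT (f i)) -> (forall i x, 0 <= f i x) ->
  \int[leb n]_x (\prod_(i < n) f i (tnth x i)) = \prod_(i < n) \int[lebR]_x f i x.
Proof.
elim: n f => [|n IH] f mf f0.
  rewrite leb0E big_ord0; under eq_integral do rewrite big_ord0.
  by rewrite integral_dirac// diracT mul1e.
rewrite ge0_integral_lebS; last 2 first.
- exact: measurable_prod_tnth.
- by move=> x; apply: prode_ge0 => *; exact: f0.
rewrite big_ord_recl -IH// -ge0_integralZr//; last by apply: integral_ge0 => x _; apply: prode_ge0 => *; exact: f0.
apply: eq_integral => s _; rewrite -ge0_integralZl//; last 2 first.
- exact: (@measurable_prod_tnth n (fun i => f (lift ord0 i))).
- by move=> x _; apply: prode_ge0 => *; exact: f0.
apply: eq_integral => x _; rewrite big_ord_recl tnth0; congr (_ * _).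
by apply: eq_bigr => i _; rewrite tnthS.
Qed.

End ProductDensity.

Section IndependentIncrements.
Context {R : realType}.

(** For [0 < s < a - b] the points [a - s] and [b + s] are convex combinations of [a] and [b] with
    the weights interchanged; in the product of the two inequalities the powers recombine to
    [h a * h b]. Both boundary values of [s] give equality. *)
Lemma logconcave_shift (h : R -> R) (a b s : R) : (forall x, 0 <= h x) ->
  logconcave h -> 0 <= s <= a - b -> h a * h b <= h (a - s) * h (b + s).
Proof.
move=> h0 lh /andP[]; rewrite le_eqVlt => /predU1P[<-|s0].
  by rewrite subr0 addr0.
rewrite le_eqVlt => /predU1P[->|sab].
  by rewrite opprB subrKC subrKC mulrC.
have ab0 : 0 < a - b by exact: lt_trans sab.
pose t := (a - b - s) / (a - b).
have tab : t * (a - b) = a - b - s by rewrite /t divfK ?gt_eqF.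
have t0 : 0 < t by rewrite divr_gt0// subr_gt0.
have t1 : t < 1 by rewrite /t ltr_pdivrMr// mul1r gtrBl.
have t01 : 0 < t < 1 by rewrite t0.
have t01' : 0 < 1 - t < 1 by rewrite subr_gt0 t1 gtrBl.
have := lh a b t t01.
have -> : t * a + (1 - t) * b = a - s by lra.
have := lh a b (1 - t) t01'; rewrite opprB subrKC.
have -> : (1 - t) * a + t * b = b + s by lra.
move=> l1 l2; apply: le_trans (ler_pM _ _ l2 l1); rewrite ?mulr_ge0 ?powR_ge0//.
have pow (c : R) : 0 <= c -> c `^ t * c `^ (1 - t) = c.
  move=> c0; rewrite -powRD; last by rewrite subrKC oner_eq0.
  by rewrite subrKC powRr1.
by rewrite mulrACA (pow _ (h0 a)) [h b `^ _ * _]mulrC (pow _ (h0 b)).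
Qed.

(** If the points [(x, y)] and [(x', y')] are comparable, both sides have the same factors.
    Otherwise joins and meets move the two differences towards each other with their sum unchanged,
    as in [logconcave_shift]. *)
Lemma logconcave_diff_TP2 (h : R -> R) (x y x' y' : R) : (forall x, 0 <= h x) ->
  logconcave h ->
  h (y - x) * h (y' - x') <=
  h (Num.max y y' - Num.max x x') * h (Num.min y y' - Num.min x x').
Proof.
move=> h0 lh.
have core a b c e : a <= b -> c <= e -> h (e - a) * h (c - b) <= h (e - b) * h (c - a).
  move=> ab ce; have := @logconcave_shift h (e - a) (c - b) (b - a) h0 lh.
  have -> : e - a - (b - a) = e - b by ring.
  have -> : c - b + (b - a) = c - a by ring.
  by apply; apply/andP; split; lra.
have [xx'|/ltW x'x] := leP x x'; have [yy'|/ltW y'y] := leP y y'.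
- by rewrite mulrC.
- exact: core.
- by rewrite mulrC; exact: core.
- by [].
Qed.

Lemma pushforward_density n d (T : measurableType d) (M : {measure set T -> \bar R})
    (X : T -> n.-tuple R) (g : 'I_n -> R -> R) :
  measurable_fun setT X -> (forall i, measurable_fun setT (g i)) ->
  (forall i x, 0 <= g i x) -> (M setT < +oo)%E ->
  (forall B : 'I_n -> set R, (forall i, measurable (B i)) ->
    M (X @^-1` box B) = (\prod_(i < n) \int[lebR]_(x in B i) (g i x)%:E)%E) ->
  forall A, measurable A ->
  M (X @^-1` A) = (\int[leb n]_(x in A) (\prod_(i < n) g i (tnth x i))%:E)%E.
Proof.
move=> mX mg g0 Moo MB.
have [m1 m1E] := image_measure_exists M mX.
have mG : measurable_fun setT (fun x : n.-tuple R => (\prod_(i < n) g i (tnth x i))%:E).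
  under eq_fun do rewrite -prodEFin.
  apply: (@measurable_prod_tnth R n (fun i x => (g i x)%:E)) => i.
  exact/measurable_EFinP.
have G0 (x : n.-tuple R) : (0 <= (\prod_(i < n) g i (tnth x i))%:E)%E.
  by rewrite lee_fin prodr_ge0.
have [m2 m2E] := density_measure_exists (leb n) mG G0.
move=> A mA; rewrite -m2E -[LHS]/(pushforward M X A) -m1E.
apply: eq_measure_box mA => [B mB|N].
  rewrite m1E m2E /pushforward MB// integral_mkcond.
  transitivity (\int[leb n]_x
      (\prod_(i < n) ((fun y => (g i y)%:E) \_ (B i)) (tnth x i)))%E.
    rewrite (@ge0_integral_prod_tnth R n (fun i => (fun y => (g i y)%:E) \_ (B i))).
    - by apply: eq_bigr => i _; rewrite integral_mkcond.
    - move=> i; apply/(measurable_restrictT _ _).1 => //.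
      by apply: measurable_funTS; exact/measurable_EFinP.
    - by move=> i x; rewrite patchE; case: ifP => // _; rewrite lee_fin.
  apply: eq_integral => x _.
  rewrite [RHS]patchE; case: ifPn => [|]; rewrite ?inE ?notin_setE => xB.
    rewrite -prodEFin; apply: eq_bigr => i _.
    by rewrite patchE mem_set.
  have [i Bi] : exists i, ~ B i (tnth x i).
    by apply/existsNP => H; exact: xB.
  by rewrite (bigD1 i)//= patchE memNset// mul0e.
rewrite m1E /pushforward; apply: le_lt_trans Moo; apply: le_measure; rewrite ?inE//.
rewrite -[X in measurable X]setTI; apply: mX => //.
exact: measurable_box.
Qed.

(** [X] has the root value at [k] and the increments elsewhere, and [phi] rebuilds the coordinates.
    The density is a product of a function of [y_k], whose two values are at most permuted by max
    and min, and of factors totally positive in a vertex and its parent. The lemma serves for trees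
    and for bivariate margins. *)
Lemma MTP2_increments n (k : 'I_n) (pa : 'I_n -> 'I_n) (dep : 'I_n -> nat)
    (phi : n.-tuple R -> n.-tuple R) (Q : set (n.-tuple R) -> \bar R)
    d (T : measurableType d) (M : {measure set T -> \bar R})
    (X : T -> n.-tuple R) (g : 'I_n -> R -> R) :
  (forall j, j != k -> (dep (pa j) < dep j)%N) ->
  measurable_fun setT phi -> cancel (parent_diff pa [set~ k]%SET) phi ->
  measurable_fun setT X -> (forall i, measurable_fun setT (g i)) ->
  (forall i x, 0 <= g i x) -> (forall i, i != k -> logconcave (g i)) ->
  (M setT < +oo)%E ->
  (forall B : 'I_n -> set R, (forall i, measurable (B i)) ->
    M (X @^-1` box B) = (\prod_(i < n) \int[lebR]_(x in B i) (g i x)%:E)%E) ->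
  (forall A, measurable A -> Q A = M (X @^-1` (phi @^-1` A))) ->
  MTP2 Q.
Proof.
move=> paU mphi phiK mX mg g0 lg Moo MB QE.
pose G (x : n.-tuple R) := \prod_(i < n) g i (tnth x i).
have mG : measurable_fun setT G.
  apply/measurable_EFinP; rewrite /comp /G.
  under eq_fun do rewrite -prodEFin.
  apply: (@measurable_prod_tnth R n (fun i x => (g i x)%:E)) => i.
  exact/measurable_EFinP.
exists (G \o parent_diff pa [set~ k]%SET).
  apply: (@density_change_of_variables R n pa dep _ phi) => //.
  - by move=> j; rewrite !inE => /paU.
  - by move=> x; apply: prodr_ge0 => i _; exact: g0.
  - move=> A mA; rewrite QE// (pushforward_density mX mg g0 Moo MB)//.
    by rewrite -[X in measurable X]setTI; exact: mphi.
move=> x y; rewrite /G /= -!big_split/=; apply: ler_prod => i _.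
rewrite !mulr_ge0//= !tnth_mktuple !inE; case: eqP => /= [->|/eqP ik].
  by case: (leP (tnth x k) (tnth y k)) => _ //; rewrite mulrC.
by apply: logconcave_diff_TP2 => //; exact: lg.
Qed.

End IndependentIncrements.

(** * Trees *)

Section TreePaths.
Variables (n : nat) (T : rel 'I_n).
Hypothesis hT : is_tree T.

Let Tsym : symmetric T. Proof. by case: hT. Qed.

Let Tacyclic c : cycle T c -> uniq c -> (size c <= 2)%N.
Proof. by case: hT => _ _ _ _ H; exact: H. Qed.

(** If the paths start with different neighbours [a] and [b] of [k], these are still connected,
    through the common end, after deleting [k]. A simple path between them avoiding [k] closes up to
    a cycle of length at least 3. *)
Lemma tree_path_unique (k : 'I_n) p q :
  path T k p -> uniq (k :: p) -> path T k q -> uniq (k :: q) ->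
  last k p = last k q -> p = q.
Proof.
elim: p k q => [|a p IH] k [|b q] //=.
- by move=> _ _ _ /andP[kq _] kE; move: kq; rewrite kE -/(last b q) mem_last.
- by move=> _ /andP[kp _] _ _ kE; move: kp; rewrite -kE mem_last.
move=> /andP[ka pa] /andP[kap uap] /andP[kb pb] /andP[kbq ubq] lE.
have [ab|ab] := eqVneq a b.
  by rewrite -ab in pb ubq lE *; rewrite (IH a q).
exfalso; pose T' := [rel x y | [&& T x y, x != k & y != k]].
have T'sym : connect_sym T'.
  by apply: sym_connect_sym => x y /=; rewrite Tsym; congr andb; exact: andbC.
have T'path x s : path T x s -> k \notin x :: s -> path T' x s.
  elim: s x => [//|y s IHs] x /= /andP[xy ys]; rewrite !inE !negb_or.
  move=> /and3P[kx ky ks]; rewrite xy eq_sym kx eq_sym ky /=.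
  by apply: IHs => //; rewrite inE negb_or ky.
have : connect T' a b.
  apply: (@connect_trans _ _ (last a p)).
    by apply/connectP; exists p => //; exact: T'path.
  by rewrite T'sym lE; apply/connectP; exists q => //; exact: T'path.
move=> /connectP[r0 r0p bE]; move: ab pb ubq lE kb kbq; rewrite bE => {bE}.
case/shortenP: r0p => r rp ur _ ab _ _ _ kb kbq.
have kr : k \notin a :: r.
  rewrite inE negb_or; apply/andP; split; first by move: kap; rewrite inE negb_or => /andP[].
  by elim: r a rp {ur ab kb kbq ka pa kap uap} => //= y r IHr x /andP[/and3P[_ _ yk] /IHr];
    rewrite inE negb_or eq_sym yk.
have rT : path T a r by apply: sub_path rp => x y /= /and3P[].
have := @Tacyclic (k :: a :: r).
rewrite /= rcons_path ka rT -[last a r]/(last a r) Tsym kb /= => /(_ isT).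
rewrite -[k \notin _ :: _]/(k \notin a :: r) kr /= => /(_ ur).
by case: r ab {rp ur kb kbq kr rT} => [|//]; rewrite /= eqxx.
Qed.

(** [S] is the component of [i] after the edge is deleted in both directions; a path from [i] to [j]
    inside it would close up to a cycle. *)
Lemma tree_edge_cut (i j : 'I_n) : T i j -> exists S : {set 'I_n},
  [/\ i \in S, j \notin S & forall a b, a \in S -> b \notin S -> T a b -> (a, b) = (i, j)].
Proof.
move=> Tij; have ij : i != j.
  by apply/eqP => ijE; case: hT => _ _ irr _ _; have := irr j; rewrite -{1}ijE Tij.
pose T' := [rel x y | [&& T x y, (x, y) != (i, j) & (x, y) != (j, i)]].
exists [set x | connect T' i x]%SET; rewrite !inE connect0; split => //.
  apply/negP => /connectP[r0 r0p jE]; move: Tij ij; rewrite jE.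
  case/shortenP: r0p jE => r rp ur _ jE Tij ij.
  have rT : path T i r by apply: sub_path rp => x y /= /and3P[].
  have := @Tacyclic (i :: r); rewrite /= rcons_path rT Tsym Tij => /(_ isT ur).
  case: r rp ur jE ij {Tij rT} => [|x [|y r]]//=; first by rewrite eqxx.
  by move=> /andP[/and3P[_ h _] _] _ jx _; move: h; rewrite jx eqxx.
move=> a b; rewrite !inE => ia ib Tab; apply/eqP; apply/negPn/negP => abij.
have [abji|abji] := eqVneq (a, b) (j, i).
  by move: ib; move/(congr1 snd): abji => /= ->; rewrite connect0.
by move/negP: ib; apply; apply: connect_trans ia (connect1 _); rewrite /= Tab abij.
Qed.

Lemma tree_path_exists (k j : 'I_n) : exists p, path T k p /\ uniq (k :: p) /\ last k p = j.
Proof.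
case: hT => _ _ _ conn _; have /connectP[p0 p0p ->] := conn k j.
by case/shortenP: p0p => p pp up _; exists p.
Qed.

Definition tree_path k j : seq 'I_n := projT1 (cid (tree_path_exists k j)).

Lemma tree_pathP k j : path T k (tree_path k j).
Proof. by rewrite /tree_path; case: cid => p [? ?]. Qed.

Lemma tree_path_uniq k j : uniq (k :: tree_path k j).
Proof. by rewrite /tree_path; case: cid => p [? [? ?]]. Qed.

Lemma last_tree_path k j : last k (tree_path k j) = j.
Proof. by rewrite /tree_path; case: cid => p [? [? ?]]. Qed.

Lemma tree_pathE k p : path T k p -> uniq (k :: p) -> tree_path k (last k p) = p.
Proof.
move=> pp up; apply: (tree_path_unique (tree_pathP _ _) (tree_path_uniq _ _) pp up).
exact: last_tree_path.
Qed.

(** The last vertex but one of the path; at [j = k] the path is empty and the value is [k]. *)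
Definition tree_parent k j := last k (take (size (tree_path k j)).-1 (tree_path k j)).

Lemma tree_path_parent k j : j != k ->
  tree_path k j = rcons (tree_path k (tree_parent k j)) j.
Proof.
move=> jk; rewrite /tree_parent.
have := tree_pathP k j; have := tree_path_uniq k j; have := last_tree_path k j.
case/lastP: (tree_path k j) => [/= kj|p x]; first by rewrite kj eqxx in jk.
rewrite last_rcons => ->; rewrite size_rcons /= -cats1 take_size_cat// cats1.
rewrite rcons_path mem_rcons inE negb_or rcons_uniq.
move=> /andP[/andP[_ kp] /andP[_ up]] /andP[pp _]; rewrite tree_pathE//=.
by rewrite kp.
Qed.

Lemma tree_parent_depth k j : j != k ->
  (size (tree_path k (tree_parent k j)) < size (tree_path k j))%N.
Proof. by move=> jk; rewrite (tree_path_parent jk) size_rcons. Qed.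

Lemma zip_path_rcons (k : 'I_n) p j :
  zip (k :: rcons p j) (rcons p j) = rcons (zip (k :: p) p) (last k p, j).
Proof. by elim: p k => //= a p IH k; rewrite -IH. Qed.

Lemma in_ph k i e : (e \in ph T k i) = (e \in zip (k :: tree_path k i) (tree_path k i)).
Proof.
rewrite inE; apply/asboolP/idP => [[p [pp up pi ep]]|ep].
  by rewrite -pi tree_pathE.
exists (tree_path k i); split => //.
- exact: tree_pathP.
- exact: tree_path_uniq.
- exact: last_tree_path.
Qed.

(** [E^k] is hereby indexed by the heads of its edges, which matches edges with the coordinates
    other than [k]. *)
Lemma in_directed_edges k e :
  (e \in directed_edges T k) = (e.2 != k) && (e.1 == tree_parent k e.2).
Proof.
rewrite inE in_ph; case: e => a j /=; apply/idP/idP.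
  move=> /andP[_]; have [->|jk] := eqVneq j k.
    by have -> : tree_path k k = [::] by [rewrite (@tree_pathE k [::])].
  rewrite {1 2}(tree_path_parent jk) zip_path_rcons mem_rcons inE last_tree_path.
  move=> /orP[/eqP[->]|/(map_f snd)]; first by rewrite eqxx.
  rewrite -/(unzip2 _) unzip2_zip//=.
  have := tree_path_uniq k j; rewrite (tree_path_parent jk) /= rcons_uniq.
  by move=> /andP[_ /andP[/negP]].
move=> /andP[jk /eqP ->].
have := tree_pathP k j; rewrite {1 2 3}(tree_path_parent jk) zip_path_rcons.
by rewrite rcons_path mem_rcons inE last_tree_path eqxx => /andP[_ ->].
Qed.

Lemma ph_directed_edges k i e : e \in ph T k i -> e \in directed_edges T k.
Proof.
rewrite in_ph; have := tree_pathP k i; have := tree_path_uniq k i.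
elim/last_ind: (tree_path k i) => [//|p j IH]; rewrite zip_path_rcons mem_rcons inE.
rewrite rcons_path -rcons_cons rcons_uniq => /andP[jp up] /andP[pp Tj] /orP[/eqP ->|]; last exact: IH.
rewrite inE /= Tj in_ph.
have := @tree_pathE k (rcons p j); rewrite last_rcons => ->.
- by rewrite zip_path_rcons mem_rcons mem_head.
- by rewrite rcons_path pp.
- by rewrite -rcons_cons rcons_uniq jp.
Qed.

(** Telescoping along the path; summing increments along paths from the root thus undoes
    [parent_diff]. *)
Lemma sum_ph (V : zmodType) (y : 'I_n -> V) k i :
  (\sum_(e in ph T k i) (y e.2 - y e.1) = y i - y k)%R.
Proof.
have uz : uniq (zip (k :: tree_path k i) (tree_path k i)).
  have := tree_path_uniq k i; rewrite /= => /andP[_].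
  by rewrite -{1}(@unzip2_zip _ _ (k :: tree_path k i) (tree_path k i))//; exact: map_uniq.
rewrite (eq_bigl _ _ (in_ph k i)) -big_uniq//=.
have tele p k' : (\sum_(e <- zip (k' :: p) p) (y e.2 - y e.1) = y (last k' p) - y k')%R.
  elim: p k' => [|a p IH] k' /=; first by rewrite big_nil subrr.
  by rewrite big_cons IH /= addrC addrA subrK.
by rewrite tele last_tree_path.
Qed.

Lemma prod_directed_edges (R : realType) (F : 'I_n * 'I_n -> \bar R) k :
  (\prod_(e in directed_edges T k) F e = \prod_(j | j != k) F (tree_parent k j, j))%E.
Proof.
rewrite (reindex_onto (fun j => (tree_parent k j, j)) snd); last first.
  by move=> [a j]; rewrite in_directed_edges => /andP[_ /eqP /= ->].
by apply: eq_bigl => j; rewrite in_directed_edges /= !eqxx !andbT.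
Qed.

End TreePaths.

(** * Extremal functions and bivariate margins *)

Section ExtremalLaws.
Context {R : realType}.

Lemma image_probability_exists d d' (T1 : measurableType d) (T2 : measurableType d')
    (P : probability T1 R) (f : T1 -> T2) : measurable_fun setT f ->
  exists P' : probability T2 R, forall A, P' A = P (f @^-1` A).
Proof.
move=> mf; pose F : {mfun T1 >-> T2} := HB.pack f (isMeasurableFun.Build _ _ _ _ f mf).
by exists (distribution P F).
Qed.

Lemma product_measure_image d d1 d2 (T : measurableType d) (T1 : measurableType d1)
    (T2 : measurableType d2) (M : probability T R) (m1 : probability T1 R)
    (m2 : probability T2 R) (f : T -> T1) (S : set (T1 * T2)) :
  measurable_fun setT f -> (forall A, measurable A -> m1 A = M (f @^-1` A)) ->
  measurable S ->
  (m1 \x m2)%E S = (M \x m2)%E ((fun p => (f p.1, p.2)) @^-1` S).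
Proof.
move=> mf m1E mS.
have mF : measurable_fun setT (fun p : T * T2 => (f p.1, p.2)).
  apply/measurable_fun_pairP; split; last exact: measurable_snd.
  exact: (measurableT_comp mf measurable_fst).
have [m' m'E] := image_measure_exists (M \x m2)%E mF.
transitivity (m' S); last by rewrite m'E.
apply: product_measure_unique => // A B mA mB.
rewrite m'E /pushforward.
have -> : (fun p : T * T2 => (f p.1, p.2)) @^-1` (A `*` B) = (f @^-1` A) `*` B by [].
rewrite /= product_measure1E ?m1E//.
by rewrite -[X in measurable X]setTI; exact: mf.
Qed.

Definition pswap (A B : Type) (p : A * B) : B * A := (p.2, p.1).

Lemma measurable_pswap d1 d2 (T1 : measurableType d1) (T2 : measurableType d2) :
  measurable_fun setT (@pswap T1 T2).
Proof.
by apply/measurable_fun_pairP; split; [exact: measurable_snd|exact: measurable_fst].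
Qed.

Lemma product_measure_swap d1 d2 (T1 : measurableType d1)
    (T2 : measurableType d2) (m1 : probability T1 R)
    (m2 : probability T2 R) (S : set (T1 * T2)) : measurable S ->
  (m1 \x m2)%E S = (m2 \x m1)%E (@pswap _ _ @^-1` S).
Proof.
move=> mS.
have mF := @measurable_pswap _ _ T2 T1.
have [m' m'E] := image_measure_exists (m2 \x m1)%E mF.
transitivity (m' S); last by rewrite m'E.
apply: product_measure_unique => // A B mA mB.
rewrite m'E /pushforward.
have -> : @pswap T2 T1 @^-1` (A `*` B) = B `*` A.
  by apply/seteqP; split=> -[x y] /= [].
by rewrite /= product_measure1E// muleC.
Qed.

Lemma measurable_tshift n :
  measurable_fun setT (fun p : n.-tuple R * R => tshift p.1 p.2).
Proof.
apply/measurable_fun_tnthP => i; rewrite /comp /tshift.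
under eq_fun do rewrite tnth_mktuple.
have m1 := measurableT_comp (@measurable_tnth _ R n i) (@measurable_fst _ _ (n.-tuple R) R).
exact: (measurable_funD m1 (@measurable_snd _ _ (n.-tuple R) R)).
Qed.

Lemma law_kE n (mu : set (n.-tuple R) -> \bar R) (k : 'I_n)
    (nu : probability (n.-tuple R) R) (A : set (n.-tuple R)) :
  extremal_function mu k nu -> measurable A ->
  law_k mu k A = (nu \x expR1)%E [set p | A (tshift p.1 p.2)].
Proof. by move=> [_ H] mA; exact: H. Qed.

Lemma product_measure_coord0 n (W : probability (n.-tuple R) R) (i : 'I_n)
    (S S' : set (n.-tuple R * R)) :
  W [set w | tnth w i = 0] = 1%E -> measurable S -> measurable S' ->
  (forall w t, tnth w i = 0 -> S (w, t) <-> S' (w, t)) ->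
  (W \x expR1)%E S = (W \x expR1)%E S'.
Proof.
move=> W0 mS mS' SS'.
pose Z : set (n.-tuple R * R) := [set w | tnth w i = 0] `*` setT.
have mz : measurable [set w : n.-tuple R | tnth w i = 0].
  rewrite -[X in measurable X]setTI.
  exact: (@measurable_tnth _ R n i measurableT [set 0] (measurable_set1 0)).
have mZ : measurable Z by exact: measurableX.
have Z1 : (W \x expR1)%E (~` Z) = 0%E.
  have -> : ~` Z = (~` [set w : n.-tuple R | tnth w i = 0]) `*` setT.
    apply/seteqP; split=> -[w t] /=; rewrite /Z /=; first by move=> H; split => // w0; apply: H.
    by move=> [w0 _] [].
  have Wc : W (~` [set w : n.-tuple R | tnth w i = 0]) = 0%E.
    by rewrite probability_setC// W0 subee.
  apply: etrans (product_measure1E _ _ (measurableC mz) measurableT) _.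
  by rewrite [X in (X * _)%E]Wc mul0e.
have null U : measurable U -> (W \x expR1)%E U = (W \x expR1)%E (U `&` Z).
  move=> mSS; rewrite [LHS](measureDI _ mSS mZ).
  rewrite (_ : _ (U `\` Z) = 0%E) ?add0e//.
  apply: (subset_measure0 _ _ _ Z1); first exact: measurableD.
    exact: measurableC.
  by move=> p [].
rewrite (null _ mS) (null _ mS'); congr (_ _).
by apply/seteqP; split=> -[w t] [/= Sw [/= w0 _]]; split => //; exact/(SS' w t w0).
Qed.

Lemma extremal_pair n (mu : set (n.-tuple R) -> \bar R) (i j : 'I_n)
    (W : probability (n.-tuple R) R) : extremal_function mu i W ->
  exists nu : probability R R,
    (forall A, measurable A -> nu A = W [set w | A (tnth w j)]) /\
    (forall A : set (R * R), measurable A ->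
      law_k mu i [set y | A (tnth y i, tnth y j)] =
      (expR1 \x nu)%E [set p | A (p.1, p.1 + p.2)]).
Proof.
move=> hW; have [W0 _] := hW.
have [nu nuE] := image_probability_exists W (@measurable_tnth _ R n j).
exists nu; split; first by move=> A mA; rewrite nuE.
move=> A mA.
have mpair : measurable_fun setT (fun y : n.-tuple R => (tnth y i, tnth y j)).
  by apply/measurable_fun_pairP; split; exact: measurable_tnth.
have mA' : measurable [set y : n.-tuple R | A (tnth y i, tnth y j)].
  by rewrite -[X in measurable X]setTI; exact: mpair.
rewrite (law_kE hW)//.
have msh : measurable_fun setT (fun p : R * R => (p.1, p.1 + p.2)).
  apply/measurable_fun_pairP; split; first exact: measurable_fst.
  exact: (measurable_funD measurable_fst measurable_snd).
have mS : measurable [set p : R * R | A (p.1, p.1 + p.2)].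
  by rewrite -[X in measurable X]setTI; exact: msh.
rewrite (product_measure_swap expR1 nu mS).
have mswap := @measurable_pswap _ _ R R.
have mS' : measurable (@pswap R R @^-1` [set p : R * R | A (p.1, p.1 + p.2)]).
  by rewrite -[X in measurable X]setTI; exact: mswap.
have E := product_measure_image expR1 (@measurable_tnth _ R n j) (fun A _ => nuE A) mS'.
rewrite [RHS]E {E}.
apply: product_measure_coord0 W0 _ _ _.
- by rewrite -[X in measurable X]setTI; exact: measurable_tshift.
- have mf : measurable_fun setT (fun p : n.-tuple R * R => (tnth p.1 j, p.2)).
    apply/measurable_fun_pairP; split; last exact: measurable_snd.
    exact: (measurableT_comp (@measurable_tnth _ R n j) measurable_fst).
  by rewrite -[X in measurable X]setTI; exact: mf.
- by move=> w t w0; rewrite /pswap /= !tnth_mktuple w0 add0r addrC.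
Qed.

End ExtremalLaws.

Section MarginsAndTrees.
Context {R : realType}.

Lemma measurable_gt0_coord n (k : 'I_n) : measurable [set y : n.-tuple R | 0 < tnth y k].
Proof.
have := @measurable_tnth _ R n k measurableT `]0, +oo[%classic (measurable_itv _).
rewrite setTI; congr measurable.
by apply/seteqP; split=> x /=; rewrite in_itv/= andbT.
Qed.

Lemma measurable_calL n : measurable (@calL R n).
Proof.
have -> : @calL R n = \bigcup_(i in [set: 'I_n]) [set y | 0 < tnth y i].
  by apply/seteqP; split=> y /=; [move=> [i yi]; exists i|move=> [i _ yi]; exists i].
apply: fin_bigcup_measurable; first exact: finite_finset.
by move=> i _; exact: measurable_gt0_coord.
Qed.

Lemma measurable_subvec n (I : {set 'I_n}) : measurable_fun setT (@subvec R n I).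
Proof.
apply/measurable_fun_tnthP => a; rewrite /comp /subvec.
by under eq_fun do rewrite tnth_mktuple; exact: measurable_tnth.
Qed.

(** If the conditioning event were null, [cond_law] would vanish identically, a product with factor
    [0] being [0]; but the total mass is 1. *)
Lemma extremal_mass n (mu : probability (n.-tuple R) R) k nu :
  extremal_function mu k nu -> mu [set y | 0 < tnth y k] != 0%E.
Proof.
move=> h; have := law_kE h measurableT.
rewrite (_ : [set p | _] = setT)//.
have -> : (nu \x expR1)%E setT = 1%E.
  exact: (@probability_setT _ _ _ ((nu \x expR1)%E : probability _ R)).
rewrite /law_k /cond_law setTI; apply: contra_eq_neq => ->.
by rewrite mul0e eq_sym onee_neq0.
Qed.

(** A positive coordinate of the subvector makes its maximum positive, so conditioning first on the
    maximum and then on the coordinate is conditioning on the coordinate; the normalising factor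
    cancels. *)
Lemma law_k_margin n (mu : probability (n.-tuple R) R) (I : {set 'I_n}) (k : 'I_#|I|)
    (A : set (#|I|.-tuple R)) :
  mu [set y | 0 < tnth y (enum_val k)] != 0%E -> measurable A ->
  law_k (margin mu I) k A = law_k mu (enum_val k) (subvec I @^-1` A).
Proof.
move=> B0 mA; set i := enum_val k; pose B := [set y : n.-tuple R | 0 < tnth y i].
pose L : set (n.-tuple R) := subvec I @^-1` calL #|I|.
have mL : measurable L.
  rewrite -[X in measurable X]setTI; apply: measurable_subvec => //.
  exact: measurable_calL.
have mB : measurable B by exact: measurable_gt0_coord.
have msA : measurable (subvec I @^-1` A).
  by rewrite -[X in measurable X]setTI; exact: measurable_subvec.
have BL : B `<=` L by move=> y By; exists k; rewrite tnth_mktuple.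
rewrite /law_k /margin /cond_law /pushforward.
have -> : subvec I @^-1` (A `&` [set y | 0 < tnth y k] `&` calL #|I|) =
    subvec I @^-1` A `&` B.
  apply/seteqP; split=> y /=; rewrite tnth_mktuple => -[]; first by case.
  by move=> Ay By; split; [split|exact: BL].
have -> : subvec I @^-1` ([set y | 0 < tnth y k] `&` calL #|I|) = B.
  apply/seteqP; split=> y /=; rewrite tnth_mktuple; first by case.
  by move=> By; split => //; exact: BL.
rewrite -/L -/B.
have L0 : mu L != 0%E.
  apply: contra B0 => /eqP L0; apply/eqP.
  by apply: (subset_measure0 _ _ _ L0).
have fin S : measurable S -> mu S = (fine (mu S))%:E.
  by move=> mS; rewrite fineK// fin_num_measure.
move: B0 L0; rewrite -/B (fin _ mB) (fin _ mL) (fin _ (measurableI _ _ msA mB)) !eqe.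
move=> b0 l0; rewrite !inver (negPf b0) (negPf l0) -!EFinM inver mulf_eq0 invr_eq0.
by rewrite (negPf b0) (negPf l0) /= -EFinM; congr EFin; field; rewrite b0 l0.
Qed.

Lemma has_logconcave_density_eq (mu nu : set R -> \bar R) :
  (forall A, measurable A -> mu A = nu A) ->
  has_logconcave_density mu -> has_logconcave_density nu.
Proof.
move=> E [h [mh h0 hE] lh]; exists h => //; split => // A mA.
by rewrite -E// hE.
Qed.

Lemma EMTP2_extremal_logconcave n (mu : set (n.-tuple R) -> \bar R) (i j : 'I_n)
    (W : probability (n.-tuple R) R) : i != j -> extremal_function mu i W ->
  MTP2 (law_k mu i) -> has_logconcave_density (fun A => W [set w | A (tnth w j)]).
Proof.
move=> ij hW m2; have [nu [nuE QE]] := extremal_pair j hW.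
apply: has_logconcave_density_eq nuE _.
exact: MTP2_difference_logconcave ij m2 QE.
Qed.

Lemma margin_extremal_logconcave n (mu : probability (n.-tuple R) R) (i j : 'I_n)
    (W : probability (n.-tuple R) R) : i != j -> extremal_function mu i W ->
  EMTP2 (margin mu [set i; j]%SET) ->
  has_logconcave_density (fun A => W [set w | A (tnth w j)]).
Proof.
move=> ij hW m2; have [nu [nuE QE]] := extremal_pair j hW.
apply: has_logconcave_density_eq nuE _.
have iI : i \in [set i; j]%SET by rewrite !inE eqxx.
have jI : j \in [set i; j]%SET by rewrite !inE eqxx orbT.
pose i' := enum_rank_in iI i; pose j' := enum_rank_in iI j.
have ei : enum_val i' = i by rewrite enum_rankK_in.
have ej : enum_val j' = j by rewrite enum_rankK_in.
apply: (@MTP2_difference_logconcave _ _ _ i' j' _ _ (m2 i')).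
  by apply: contra ij => /eqP ij'; apply/eqP; move: ei; rewrite ij' ej.
move=> A mA; rewrite law_k_margin ?ei ?(extremal_mass hW)//.
  by rewrite -QE//; congr law_k; apply/seteqP; split=> y /=; rewrite !tnth_mktuple !enum_rankK_in.
have mp : measurable_fun setT (fun z : #|[set i; j]%SET|.-tuple R => (tnth z i', tnth z j')).
  by apply/measurable_fun_pairP; split; exact: measurable_tnth.
by rewrite -[X in measurable X]setTI; exact: mp.
Qed.

Lemma logconcave_density_lebR (mu : set R -> \bar R) : has_logconcave_density mu ->
  exists h : R -> R, [/\ measurable_fun setT h, (forall x, 0 <= h x), logconcave h &
    forall A, measurable A -> mu A = (\int[lebR]_(x in A) (h x)%:E)%E].
Proof.
move=> [h [mh h0 hE] lh]; exists h; split => // A mA.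
rewrite hE// integral_lebR//; first by apply: measurable_funTS; exact/measurable_EFinP.
by move=> x _; rewrite lee_fin.
Qed.

(** The pair is treated as a tree with one edge, rooted at [k], with independent increments [E] and
    [W^i_j]. *)
Lemma logconcave_bivariate_EMTP2 n (mu : probability (n.-tuple R) R) (I : {set 'I_n})
    (W : 'I_n -> probability (n.-tuple R) R) : #|I| = 2%N ->
  (forall k, extremal_function mu k (W k)) ->
  (forall i j, i != j -> has_logconcave_density (fun A => W i [set w | A (tnth w j)])) ->
  EMTP2 (margin mu I).
Proof.
move=> I2 hW lW k; set i := enum_val k.
have [k' kk'] : exists k' : 'I_#|I|, k' != k.
  have /card_gt0P[k' k'k] : (0 < #|[set~ k]%SET|)%N by rewrite cardsC1 card_ord I2.
  by exists k'; rewrite !inE in k'k.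
have two a : a = k \/ a = k'.
  apply: contrapT => /not_orP[/eqP ak /eqP ak'].
  have : uniq [:: a; k; k'] by rewrite /= !inE negb_or ak ak' eq_sym kk'.
  move=> /card_uniqP H.
  have : (3 <= #|{: 'I_(#|I|) }|)%N by rewrite -[3%N]/(size [:: a; k; k']) -H; exact: max_card.
  by rewrite card_ord I2.
set j := enum_val k'.
have ij : i != j by apply: contra kk' => /eqP/enum_val_inj ->.
have [nu [nuE QE]] := extremal_pair j (hW i).
have [h [mh h0 lh hE]] := logconcave_density_lebR
  (has_logconcave_density_eq (fun A mA => esym (nuE A mA)) (lW i j ij)).
pose X (p : R * R) : #|I|.-tuple R := [tuple if a == k then p.1 else p.2 | a < #|I|].
pose phi (x : #|I|.-tuple R) : #|I|.-tuple R :=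
  [tuple if a == k then tnth x k else tnth x k + tnth x a | a < #|I|].
pose g a := if a == k then exponential_pdf (1 : R) else h.
have mX : measurable_fun setT X.
  apply/measurable_fun_tnthP => a; rewrite /comp /X.
  under eq_fun do rewrite tnth_mktuple.
  by case: (a == k); [exact: measurable_fst|exact: measurable_snd].
have mphi : measurable_fun setT phi.
  apply/measurable_fun_tnthP => a; rewrite /comp /phi.
  under eq_fun do rewrite tnth_mktuple.
  case: (a == k); first exact: measurable_tnth.
  by apply: measurable_funD; exact: measurable_tnth.
apply: (@MTP2_increments R _ k (fun=> k) (fun a => nat_of_bool (a != k)) phi _ _ _
  ((expR1 \x nu)%E : {measure set _ -> \bar R}) X g) => //.
- by move=> a ak; rewrite eqxx ak.
- move=> y; apply: eq_from_tnth => a; rewrite !tnth_mktuple !inE eqxx /=.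
  by case: eqP => [->//|_] /=; rewrite subrKC.
- move=> a; rewrite /g; case: ifP => _ //; exact: measurable_exponential_pdf.
- by move=> a x; rewrite /g; case: ifP => _ //; exact: exponential_pdf_ge0.
- by move=> a ak; rewrite /g (negPf ak).
- rewrite [X in (X < _)%E](_ : _ = 1%E) ?ltry//.
  exact: (@probability_setT _ _ _ ((expR1 \x nu)%E : probability _ R)).
- move=> B mB; have -> : X @^-1` box B = B k `*` B k'.
    apply/seteqP; split=> p /=.
      by move=> Bp; split; [have := Bp k|have := Bp k']; rewrite tnth_mktuple ?eqxx ?(negPf kk').
    by move=> [Bk Bk'] a; rewrite tnth_mktuple; case: (two a) => ->; rewrite ?eqxx ?(negPf kk').
  rewrite /= product_measure1E// (bigD1 k)//= (bigD1 k')//= big1 ?mule1.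
    by rewrite /g eqxx (negPf kk') -expR1E// -hE.
  by move=> a /andP[ak ak']; case: (two a) => aE; rewrite aE eqxx in ak ak'.
- move=> A mA; rewrite law_k_margin ?(extremal_mass (hW i))//.
  pose A' := [set p : R * R | A [tuple if a == k then p.1 else p.2 | a < #|I|]].
  have mA' : measurable A' by rewrite -[X in measurable X]setTI; exact: mX.
  rewrite -/i (_ : subvec I @^-1` A = [set y | A' (tnth y i, tnth y j)]); last first.
    have E y : subvec I y = [tuple if a == k then tnth y i else tnth y j | a < #|I|].
      apply: eq_from_tnth => a; rewrite !tnth_mktuple.
      by case: (two a) => ->; rewrite ?eqxx ?(negPf kk').
    by apply/seteqP; split=> y; rewrite /A' /= E.
  have E p : phi (X p) = [tuple if a == k then p.1 else p.1 + p.2 | a < #|I|].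
    by apply: eq_from_tnth => a; rewrite !tnth_mktuple eqxx; case: eqP.
  by rewrite QE//; congr (_ _); apply/seteqP; split=> p; rewrite /A' /= E.
Qed.

End MarginsAndTrees.

(** * Extremal tree models *)

Section TreeModelMTP2.
Context {R : realType}.

Lemma tree_logconcave_MTP2 n (T : rel 'I_n) (hT : is_tree T)
    (mu : set (n.-tuple R) -> \bar R) (W : 'I_n -> probability (n.-tuple R) R) (k : 'I_n)
    d (Omega : measurableType d) (P : probability Omega R)
    (We : 'I_n * 'I_n -> {RV P >-> R}) :
  extremal_function mu k (W k) -> tree_representation T W k We ->
  (forall e, e \in directed_edges T k -> has_logconcave_density (distribution P (We e))) ->
  MTP2 (law_k mu k).
Proof.
move=> hW [indep _ WE] lW.
pose pa := tree_parent hT k.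
have paE j : j != k -> (pa j, j) \in directed_edges T k.
  by move=> jk; rewrite (in_directed_edges hT) /= jk eqxx.
(* One density for each vertex other than the root, that of the edge entering it. The value at [k]
   is a placeholder: [g] has the exponential density of [E] there. *)
have /choice[h hP] : forall j, exists h : R -> R, j != k ->
    [/\ measurable_fun setT h, (forall x, 0 <= h x), logconcave h &
    forall A, measurable A ->
      distribution P (We (pa j, j)) A = (\int[lebR]_(x in A) (h x)%:E)%E].
  move=> j; have [->|jk] := eqVneq j k; first by exists (fun=> 0).
  by have [h hP] := logconcave_density_lebR (lW _ (paE j jk)); exists h.
pose g j := if j == k then exponential_pdf (1 : R) else h j.
pose S (w : Omega) : n.-tuple R := [tuple \sum_(e in ph T k i) We e w | i < n].
pose X (p : Omega * R) : n.-tuple R :=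
  [tuple if j == k then p.2 else We (pa j, j) p.1 | j < n].
pose phi (x : n.-tuple R) : n.-tuple R :=
  [tuple tnth x k + \sum_(e in ph T k i) tnth x e.2 | i < n].
have mWe e : measurable_fun setT (We e) by exact: measurable_funPT.
have mS : measurable_fun setT S.
  apply/measurable_fun_tnthP => i; rewrite /comp /S.
  under eq_fun do rewrite tnth_mktuple.
  by under eq_fun do rewrite -big_enum; exact: measurable_sum.
have mX : measurable_fun setT X.
  apply/measurable_fun_tnthP => j; rewrite /comp /X.
  under eq_fun do rewrite tnth_mktuple.
  case: (j == k); first exact: measurable_snd.
  exact: (measurableT_comp (mWe _) measurable_fst).
have mphi : measurable_fun setT phi.
  apply/measurable_fun_tnthP => i; rewrite /comp /phi.
  under eq_fun do rewrite tnth_mktuple.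
  apply: measurable_funD; first exact: measurable_tnth.
  under eq_fun do rewrite -big_enum.
  by apply: measurable_sum => e; exact: measurable_tnth.
apply: (@MTP2_increments R _ k pa (fun j => size (tree_path hT k j)) phi _ _ _
  ((P \x expR1)%E : {measure set _ -> \bar R}) X g) => //.
- by move=> j; exact: tree_parent_depth.
- move=> y; apply: eq_from_tnth => i; rewrite !tnth_mktuple !inE eqxx /=.
  rewrite (eq_bigr (fun e => tnth y e.2 - tnth y e.1)).
    by rewrite (sum_ph hT (fun j => tnth y j)) subrKC.
  move=> e /(ph_directed_edges hT); rewrite (in_directed_edges hT) => /andP[ek /eqP e1].
  by rewrite tnth_mktuple !inE ek /pa -e1.
- move=> j; rewrite /g; case: eqP => [_|/eqP jk]; first exact: measurable_exponential_pdf.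
  by case: (hP j jk).
- move=> j x; rewrite /g; case: eqP => [_|/eqP jk]; first exact: exponential_pdf_ge0.
  by case: (hP j jk).
- by move=> j jk; rewrite /g (negPf jk); case: (hP j jk).
- rewrite [X in (X < _)%E](_ : _ = 1%E) ?ltry//.
  exact: (@probability_setT _ _ _ ((P \x expR1)%E : probability _ R)).
- move=> B mB.
  have -> : X @^-1` box B =
      [set w | forall e, e \in directed_edges T k -> B e.2 (We e w)] `*` B k.
    apply/seteqP; split=> -[w t] /=.
      move=> Bp; split; last by have := Bp k; rewrite tnth_mktuple eqxx.
      move=> [a j] aj; move: (aj); rewrite (in_directed_edges hT) /= => /andP[jk /eqP ->].
      by have := Bp j; rewrite tnth_mktuple (negPf jk).
    move=> [Bw Bt] j; rewrite tnth_mktuple; case: eqP => [->//|/eqP jk].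
    exact: (Bw _ (paE j jk)).
  have mI : measurable [set w | forall e, e \in directed_edges T k -> B e.2 (We e w)].
    have -> : [set w | forall e, e \in directed_edges T k -> B e.2 (We e w)] =
        \bigcap_(e in [set e | e \in directed_edges T k]) (We e @^-1` B e.2).
      by [].
    apply: fin_bigcap_measurable; first exact: finite_finset.
    by move=> e _; rewrite -[X in measurable X]setTI; exact: mWe.
  rewrite /= product_measure1E//= (indep (fun e => B e.2))//.
  rewrite (bigD1 k)//= muleC; congr (_ * _)%E; first by rewrite /g eqxx -expR1E.
  rewrite -prodEFin (prod_directed_edges hT (fun e => (fine (P (We e @^-1` B e.2)))%:E)).
  apply: eq_bigr => j jk; rewrite /g (negPf jk) fineK; last first.
    apply: fin_num_measure; rewrite -[X in measurable X]setTI; exact: mWe.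
  by case: (hP j jk) => _ _ _ <-.
move=> A mA; rewrite (law_kE hW)//.
have mAs : measurable [set p : n.-tuple R * R | A (tshift p.1 p.2)].
  by rewrite -[X in measurable X]setTI; exact: measurable_tshift.
rewrite (product_measure_image expR1 mS WE mAs).
congr (_ _); apply/seteqP; split=> -[w t]; rewrite /= (_ : tshift (S w) t = phi (X (w, t)))//;
  apply: eq_from_tnth => i; rewrite !tnth_mktuple eqxx /= addrC; congr (_ + _);
  apply: eq_bigr => e /(ph_directed_edges hT); rewrite (in_directed_edges hT) => /andP[ek /eqP e1];
  by rewrite tnth_mktuple (negPf ek) /pa -e1 -surjective_pairing.
Qed.

End TreeModelMTP2.

(** * Conditional independence and strict total positivity *)

Section DensityIntegral.
Context {R : realType}.

Section ProbabilityOfMeasure.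
Context d (T : measurableType d).
Variables (m : {measure set T -> \bar R}) (m1 : m setT = 1%E).

Let m' : set T -> \bar R := m.

HB.instance Definition _ := Measure.on m'.

HB.instance Definition _ := Measure_isProbability.Build _ _ _ m' m1.

Lemma probability_of_measure :
  exists P : probability T R, (P : set T -> \bar R) = m.
Proof. by exists m'. Qed.

End ProbabilityOfMeasure.

(** [f] agrees almost everywhere with the Radon-Nikodym derivative, for which the change of
    variables formula holds. *)
Lemma ge0_integral_density d (T : measurableType d)
    (m : {sigma_finite_measure set T -> \bar R}) (P : probability T R) (f : T -> R)
    (g : T -> \bar R) (D : set T) :
  measurable_fun setT f -> (forall x, 0 <= f x) ->
  (forall A, measurable A -> P A = (\int[m]_(x in A) (f x)%:E)%E) ->
  measurable_fun setT g -> (forall x, 0 <= g x)%E -> measurable D ->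
  (\int[P]_(x in D) g x = \int[m]_(x in D) (g x * (f x)%:E))%E.
Proof.
move=> mf f0 PE mg g0 mD.
have ac : P `<< m.
  move=> A A0 B BA mB; rewrite PE//; apply: null_set_integral => //.
    by apply: measurable_funTS; exact/measurable_EFinP.
  exact: A0.
have mgD : measurable_fun D g by exact: measurable_funTS.
have mfE : measurable_fun setT (EFin \o f) by exact/measurable_EFinP.
rewrite -(Radon_Nikodym_SigmaFinite.change_of_variables ac g0 mD mgD).
have mRN := measurable_int _ (Radon_Nikodym_SigmaFinite.f_integrable ac).
have RN0 := Radon_Nikodym_SigmaFinite.f_ge0 ac.
apply: ge0_ae_eq_integral => //.
- by apply: emeasurable_funM => //; exact: measurable_funTS.
- by apply: emeasurable_funM => //; exact: measurable_funTS.
- by move=> x _; rewrite mule_ge0.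
- by move=> x _; rewrite mule_ge0// lee_fin.
have := @integral_ae_eq _ _ _ m setT measurableT (EFin \o f) _
  (Radon_Nikodym_SigmaFinite.f_integrable ac) mfE.
have H E : E `<=` setT -> measurable E ->
  (\int[m]_(x in E) Radon_Nikodym_SigmaFinite.f P m x = \int[m]_(x in E) (EFin \o f) x)%E.
  by move=> _ mE; rewrite -Radon_Nikodym_SigmaFinite.f_integral//; exact: PE.
move=> /(_ H); apply: filterS => x Hx _; by rewrite Hx.
Qed.

Lemma law_k_probability n (mu : probability (n.-tuple R) R) (k : 'I_n) :
  mu [set y | 0 < tnth y k] != 0%E ->
  exists Q : probability (n.-tuple R) R, (Q : set _ -> \bar R) = law_k mu k.
Proof.
move=> B0; pose B := [set y : n.-tuple R | 0 < tnth y k].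
have mB : measurable B by exact: measurable_gt0_coord.
have Bfin : mu B \is a fin_num by exact: fin_num_measure.
have b0 : fine (mu B) != 0 by rewrite -eqe fineK.
have r0 : 0 <= (fine (mu B))^-1 by rewrite invr_ge0 fine_ge0.
pose m : {measure set (n.-tuple R) -> \bar R} := mscale (NngNum r0) (mrestr mu mB).
have mE : (m : set _ -> \bar R) = law_k mu k.
  apply/funext => A; rewrite /m /= /mscale /mrestr /law_k /cond_law -/B muleC.
  by rewrite -[in RHS](fineK Bfin) inver (negPf b0).
have m1 : m setT = 1%E.
  rewrite mE /law_k /cond_law setTI -/B -(fineK Bfin) inver (negPf b0) -EFinM divff//.
by have [Q QE] := probability_of_measure m1; exists Q; rewrite QE.
Qed.

End DensityIntegral.

(** * The density of [Y^k] from that of [W^k] *)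

Section Insertion.
Context {R : realType}.

Definition tinsert n (k : 'I_n) (p : n.-1.-tuple R * R) : n.-tuple R :=
  [tuple if unlift k i is Some j then tnth p.1 j else p.2 | i < n].

Lemma tinsert_lift n (k : 'I_n) p j : tnth (tinsert k p) (lift k j) = tnth p.1 j.
Proof. by rewrite tnth_mktuple liftK. Qed.

Lemma tinsert_id n (k : 'I_n) p : tnth (tinsert k p) k = p.2.
Proof. by rewrite tnth_mktuple unlift_none. Qed.

Lemma measurable_tinsert n (k : 'I_n) : measurable_fun setT (@tinsert n k).
Proof.
apply/measurable_fun_tnthP => i; rewrite /comp /tinsert.
under eq_fun do rewrite tnth_mktuple.
case: (unlift k i) => [j|]; last exact: measurable_snd.
exact: (measurableT_comp (measurable_tnth j) measurable_fst).
Qed.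

Lemma measurable_drop_comp n (k : 'I_n) : measurable_fun setT (@drop_comp R n k).
Proof.
apply/measurable_fun_tnthP => i; rewrite /comp /drop_comp.
by under eq_fun do rewrite tnth_mktuple; exact: measurable_tnth.
Qed.

Lemma tinsert_preimage_box n (k : 'I_n) (B : 'I_n -> set R) :
  @tinsert n k @^-1` box B = box (fun j => B (lift k j)) `*` B k.
Proof.
apply/seteqP; split=> p /=.
  by move=> Bp; split; [move=> j; have := Bp (lift k j); rewrite tinsert_lift|
    have := Bp k; rewrite tinsert_id].
move=> [Bv Bk] i; case: (unliftP k i) => [j|] ->; first by rewrite tinsert_lift; exact: Bv.
by rewrite tinsert_id.
Qed.

Lemma leb_tinsert n (k : 'I_n) (A : set (n.-tuple R)) : measurable A ->
  leb n A = (leb n.-1 \x lebR)%E (@tinsert n k @^-1` A).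
Proof.
move=> mA; have [m' m'E] := image_measure_exists (leb n.-1 \x lebR)%E (measurable_tinsert k).
transitivity (m' A); last by rewrite m'E.
apply: eq_measure_box mA => [B mB|N]; last exact: leb_cube_lty.
rewrite m'E /pushforward tinsert_preimage_box.
have mb : measurable (box (fun j => B (lift k j))) by exact: measurable_box.
by rewrite /= product_measure1E// !leb_box// (bigD1_ord k)//= muleC.
Qed.

Lemma ge0_integral_tinsert n (k : 'I_n) (f : n.-tuple R -> \bar R) :
  measurable_fun setT f -> (forall x, 0 <= f x)%E ->
  (\int[leb n]_x f x = \int[leb n.-1]_v \int[lebR]_t f (tinsert k (v, t)))%E.
Proof.
move=> mf f0; have mi := @measurable_tinsert n k.
have [m' m'E] := image_measure_exists (leb n.-1 \x lebR)%E mi.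
have -> : (\int[leb n]_x f x = \int[m']_x f x)%E.
  by apply: eq_measure_integral => A mA _; rewrite m'E; exact: leb_tinsert.
rewrite m'E ge0_integral_pushforward// preimage_setT.
rewrite (@fubini_tonelli1 _ _ _ _ _ (leb n.-1) lebR)//.
  exact: measurableT_comp.
by move=> p; exact: f0.
Qed.

End Insertion.

Section ShiftedDensity.
Context {R : realType}.

Lemma law_k_density n (mu : set (n.-tuple R) -> \bar R) (k : 'I_n)
    (nu : probability (n.-tuple R) R) (phi : n.-1.-tuple R -> R) :
  extremal_function mu k nu ->
  is_density (lebesgue_tuple n.-1) (pushforward nu (drop_comp k)) phi ->
  is_density (lebesgue_tuple n) (law_k mu k)
    ((fun x => exponential_pdf 1 (tnth x k) * phi (drop_comp k x)) \o
     parent_diff (fun=> k) [set~ k]%SET).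
Proof.
move=> hnu [mphi phi0 phiE].
pose add_root (x : n.-tuple R) : n.-tuple R :=
  [tuple if i == k then tnth x k else tnth x k + tnth x i | i < n].
have madd : measurable_fun setT add_root.
  apply/measurable_fun_tnthP => i; rewrite /comp /add_root.
  under eq_fun do rewrite tnth_mktuple.
  case: (i == k); first exact: measurable_tnth.
  by apply: measurable_funD; exact: measurable_tnth.
have mpdf := measurableT_comp (measurable_exponential_pdf (1 : R)) (@measurable_tnth _ R n k).
have mf : measurable_fun setT
    (fun x : n.-tuple R => exponential_pdf 1 (tnth x k) * phi (drop_comp k x)).
  apply: measurable_funM; first exact: mpdf.
  exact: (measurableT_comp mphi (@measurable_drop_comp R n k)).
have f0 (x : n.-tuple R) : 0 <= exponential_pdf 1 (tnth x k) * phi (drop_comp k x).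
  by rewrite mulr_ge0// exponential_pdf_ge0.
apply: (@density_change_of_variables R n (fun=> k) (fun i => nat_of_bool (i != k))
  _ add_root) => //.
- by move=> j; rewrite !inE eqxx => ->.
- move=> y; apply: eq_from_tnth => i; rewrite !tnth_mktuple !inE eqxx /=.
  by case: eqP => [->//|_] /=; rewrite subrKC.
move=> A mA; have mS : measurable (add_root @^-1` A).
  by rewrite -[X in measurable X]setTI; exact: madd.
set S := add_root @^-1` A in mS *.
have [nu' nu'E] := image_probability_exists nu (@measurable_drop_comp R n k).
have miS : measurable (@tinsert R n k @^-1` S).
  by rewrite -[X in measurable X]setTI; exact: measurable_tinsert.
rewrite (law_kE hnu mA).
(* [W^k] is determined by its components other than [k], the omitted one being [0] almost surely;
   [tinsert] puts [E] in its place. *)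
transitivity ((nu' \x expR1)%E (@tinsert R n k @^-1` S)).
  rewrite (product_measure_image expR1 (@measurable_drop_comp R n k) (fun A _ => nu'E A) miS).
  apply: (product_measure_coord0 (hnu.1)).
  - by rewrite -[X in measurable X]setTI; exact: measurable_tshift.
  - have mF : measurable_fun setT (fun p : n.-tuple R * R => (drop_comp k p.1, p.2)).
      apply/measurable_fun_pairP; split; last exact: measurable_snd.
      exact: (measurableT_comp (@measurable_drop_comp R n k) measurable_fst).
    by rewrite -[X in measurable X]setTI; exact: mF.
  - move=> w t w0; rewrite /S /=.
    suff -> : tshift w t = add_root (tinsert k (drop_comp k w, t)) by [].
    apply: eq_from_tnth => i; rewrite tnth_mktuple [RHS]tnth_mktuple tinsert_id /=.
    case: eqP => [->|/eqP ik]; first by rewrite w0 add0r.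
    case: (unliftP k i) ik => [j|] ->; last by rewrite eqxx.
    by move=> _; rewrite tinsert_lift tnth_mktuple addrC.
rewrite /product_measure1 [LHS](_ : _ = \int[leb n.-1]_v
    ((expR1 \o xsection (@tinsert R n k @^-1` S)) v * (phi v)%:E))%E; last first.
  apply: ge0_integral_density => //.
  - by move=> B mB; rewrite nu'E -[LHS]/(pushforward nu (drop_comp k) B) phiE// -lebE.
  - exact: measurable_fun_xsection.
rewrite [RHS]integral_mkcond (ge0_integral_tinsert k); last 2 first.
- apply/(measurable_restrictT _ _).1 => //.
  by apply: measurable_funTS; exact/measurable_EFinP.
- by move=> x; rewrite patchE; case: ifP => // _; rewrite lee_fin.
apply: eq_integral => v _ /=.
pose Sv := [set t : R | S (tinsert k (v, t))].
have SvE : xsection (@tinsert R n k @^-1` S) v = Sv.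
  by apply/seteqP; split=> t; rewrite /xsection /= inE.
have mSv : measurable Sv by rewrite -SvE; exact: measurable_xsection.
rewrite SvE expR1E// -ge0_integralZr//; last 3 first.
- apply: measurable_funTS; apply/measurable_EFinP; exact: measurable_exponential_pdf.
- by move=> t _; rewrite lee_fin exponential_pdf_ge0.
- by rewrite lee_fin.
rewrite integral_mkcond; apply: eq_integral => t _; rewrite !patchE.
have -> : (tinsert k (v, t) \in S) = (t \in Sv) by apply/idP/idP; rewrite !inE.
case: ifP => // _; rewrite tinsert_id -EFinM; congr (_ * phi _)%:E.
by apply: eq_from_tnth => j; rewrite tnth_mktuple tinsert_lift.
Qed.

End ShiftedDensity.

(** * Conditional independence in terms of densities *)

Section ConditionalIndependenceDensity.
Context {R : realType} {n : nat}.
Variables (a b : 'I_n).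
Hypothesis ab : a != b.
Implicit Type f : n.-tuple R -> R.

Local Notation C := (~: [set a; b])%SET.

Definition rest_marginal (f : n.-tuple R -> R) (z : #|C|.-tuple R) : \bar R :=
  (\int[lebR]_u \int[lebR]_v (f (tglue a b (z, (u, v))))%:E)%E.

Lemma subvec_tglue z (u v : R) : subvec C (tglue a b (z, (u, v))) = z.
Proof. by apply: eq_from_tnth => c; rewrite tnth_mktuple tglue_rest. Qed.

Lemma measurable_rest_marginal f : measurable_fun setT f -> (forall x, 0 <= f x) ->
  measurable_fun setT (rest_marginal f).
Proof.
move=> mf f0.
have [l2 l2E] := product_sigma_finite_measure_exists (@lebR R) (@lebR R).
have mF : measurable_fun setT (fun p => (f (tglue a b p))%:E).
  by apply/measurable_EFinP; apply: measurableT_comp mf _; exact: measurable_tglue.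
have mG := @measurable_fun_fubini_tonelli_F _ _ _ _ R l2 _ mF
  (fun p => ltac:(rewrite lee_fin; exact: f0)).
apply: eq_measurable_fun mG => z _; rewrite /fubini_F /rest_marginal.
transitivity (\int[lebR \x lebR]_y (f (tglue a b (z, y)))%:E)%E.
  by apply: eq_measure_integral => A mA _; rewrite l2E.
rewrite (@fubini_tonelli1 _ _ _ _ _ (@lebR R) (@lebR R) (fun y => (f (tglue a b (z, y)))%:E))//.
- apply: (measurableT_comp mF).
  by apply/measurable_fun_pairP; split; [exact: measurable_cst|exact: measurable_id].
- by move=> y; rewrite lee_fin.
Qed.

Lemma rest_marginal_ge0 f z : (forall x, 0 <= f x) -> (0 <= rest_marginal f z)%E.
Proof. by move=> f0; apply: integral_ge0 => u _; apply: integral_ge0 => v _; rewrite lee_fin. Qed.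

Lemma measurable_tglue_section z u : measurable_fun setT (fun v : R => tglue a b (z, (u, v))).
Proof.
apply: measurableT_comp (measurable_tglue ab) _.
apply/measurable_fun_pairP; split; first exact: measurable_cst.
by apply/measurable_fun_pairP; split; [exact: measurable_cst|exact: measurable_id].
Qed.

Lemma measurable_tglue_integral (f : n.-tuple R -> R) z (B : set R) :
  measurable_fun setT f -> (forall x, 0 <= f x) -> measurable B ->
  measurable_fun setT (fun u => \int[lebR]_(v in B) (f (tglue a b (z, (u, v))))%:E)%E.
Proof.
move=> mf f0 mB.
pose F (p : R * R) := (fun v => (f (tglue a b (z, (p.1, v))))%:E) \_ B p.2.
have mF0 : measurable_fun setT (fun p : R * R => (f (tglue a b (z, p)))%:E).
  apply/measurable_EFinP; apply: measurableT_comp mf _.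
  apply: measurableT_comp (measurable_tglue ab) _.
  by apply/measurable_fun_pairP; split; [exact: measurable_cst|exact: measurable_id].
have mF : measurable_fun setT F.
  have -> : F = (fun p : R * R => (f (tglue a b (z, p)))%:E) \_ (setT `*` B).
    apply/funext => -[u v]; rewrite /F !patchE /=.
    by have -> : ((u, v) \in setT `*` B) = (v \in B) by apply/idP/idP; rewrite !inE /=; tauto.
  apply/(measurable_restrictT _ _).1; first exact: measurableX.
  exact: measurable_funTS.
have F0 p : (0 <= F p)%E by rewrite /F patchE; case: ifP => // _; rewrite lee_fin.
have mG := @measurable_fun_fubini_tonelli_F _ _ _ _ R (@lebR R) _ mF F0.
by apply: eq_measurable_fun mG => u _; rewrite /fubini_F [RHS]integral_mkcond.
Qed.

Lemma ge0_integral_rest (g : #|C|.-tuple R -> R) f D :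
  measurable_fun setT g -> (forall z, 0 <= g z) ->
  measurable_fun setT f -> (forall x, 0 <= f x) -> measurable D ->
  (\int[leb n]_(y in subvec C @^-1` D) (g (subvec C y) * f y)%:E =
   \int[leb #|C|]_(z in D) ((g z)%:E * rest_marginal f z))%E.
Proof.
move=> mg g0 mf f0 mD.
have mgf : measurable_fun setT (fun y => g (subvec C y) * f y).
  apply: measurable_funM mf.
  exact: (measurableT_comp mg (@measurable_subvec R n C)).
rewrite integral_mkcond (ge0_integral_tglue ab); last 2 first.
- apply/(measurable_restrictT _ _).1.
    by rewrite -[X in measurable X]setTI; exact: measurable_subvec.
  by apply: measurable_funTS; exact/measurable_EFinP.
- by move=> x; rewrite patchE; case: ifP => // _; rewrite lee_fin mulr_ge0.
rewrite [RHS]integral_mkcond; apply: eq_integral => z _; rewrite [RHS]patchE.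
have E u v : (tglue a b (z, (u, v)) \in subvec C @^-1` D) = (z \in D).
  by apply/idP/idP; rewrite !inE /= subvec_tglue.
case: ifPn => zD; last first.
  apply: integral0_eq => u _; apply: integral0_eq => v _.
  by rewrite patchE E (negPf zD).
have f0' x : (0 <= (f x)%:E)%E by rewrite lee_fin.
rewrite /rest_marginal -ge0_integralZl ?lee_fin//; last 2 first.
- exact: measurable_tglue_integral.
- by move=> u _; exact: integral_ge0.
apply: eq_integral => u _; rewrite -ge0_integralZl ?lee_fin//; last first.
  by apply/measurable_EFinP; apply: measurableT_comp mf _; exact: measurable_tglue_section.
by apply: eq_integral => v _; rewrite patchE E zD subvec_tglue EFinM.
Qed.

Variables (Q : probability (n.-tuple R) R) (f : n.-tuple R -> R).
Hypotheses (mf : measurable_fun setT f) (f0 : forall x, 0 <= f x).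
Hypothesis QE : forall A, measurable A -> Q A = (\int[leb n]_(x in A) (f x)%:E)%E.

Let fon (E : set (n.-tuple R)) x : R := \1_E x * f x.

Let mfon E : measurable E -> measurable_fun setT (fon E).
Proof. by move=> mE; apply: measurable_funM. Qed.

Let fon0 E x : 0 <= fon E x. Proof. by rewrite mulr_ge0. Qed.

Let QI E D : measurable E -> measurable D ->
  Q (E `&` subvec C @^-1` D) = (\int[leb #|C|]_(z in D) rest_marginal (fon E) z)%E.
Proof.
move=> mE mD; have mhD : measurable (subvec C @^-1` D : set (n.-tuple R)).
  by rewrite -[X in measurable X]setTI; exact: measurable_subvec.
rewrite QE; last exact: measurableI.
transitivity (\int[leb n]_(y in subvec C @^-1` D) (1 * fon E y)%:E)%E.
  rewrite integral_mkcond [RHS]integral_mkcond; apply: eq_integral => y _.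
  rewrite !patchE in_setI /fon indicE mul1r.
  by case: (y \in E) => /=; case: ifP => // _; rewrite ?mul1r ?mul0r.
rewrite (@ge0_integral_rest (fun=> 1) (fon E))//; last exact: mfon.
by under eq_integral do rewrite mul1e.
Qed.

(** [p] is the ratio of two marginals, as both sides have the same integral over every measurable
    set. The product form avoids dividing where the marginal of [f] vanishes. *)
Lemma cond_prob_density E p : measurable E -> is_cond_prob Q (subvec C) E p ->
  {ae leb #|C|, forall z, ((p z)%:E * rest_marginal f z = rest_marginal (fon E) z)%E}.
Proof.
move=> mE [mp p0 pE].
have mM := measurable_rest_marginal mf f0.
have mME := measurable_rest_marginal (mfon mE) (fon0 E).
have int : (leb #|C|).-integrable setT (rest_marginal (fon E)).
  apply/integrableP; split => //.
  under eq_integral do rewrite gee0_abs ?rest_marginal_ge0//.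
  rewrite -QI// preimage_setT setIT.
  by rewrite ltey_eq fin_num_measure.
have mpM : measurable_fun setT (fun z => (p z)%:E * rest_marginal f z)%E.
  by apply: emeasurable_funM => //; exact/measurable_EFinP.
have := @integral_ae_eq _ _ _ (leb #|C|) setT measurableT _ _ int mpM.
have H D : D `<=` setT -> measurable D ->
    (\int[leb #|C|]_(z in D) rest_marginal (fon E) z =
     \int[leb #|C|]_(z in D) ((p z)%:E * rest_marginal f z))%E.
  move=> _ mD; rewrite -QI// pE// -ge0_integral_rest//.
  have mph : measurable_fun setT (fun y : n.-tuple R => (p (subvec C y))%:E).
    apply/measurable_EFinP; exact: (measurableT_comp mp (@measurable_subvec R n C)).
  rewrite (ge0_integral_density mf f0 QE mph)//.
  - by move=> y; rewrite lee_fin.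
  - by rewrite -[X in measurable X]setTI; exact: measurable_subvec.
by move=> /(_ H); apply: filterS => z Hz; rewrite Hz.
Qed.

(** With [M] the marginal of [f], this is [(pA pB M) M = (pA M) (pB M)]. *)
Lemma cond_indep_density (A B : set R) : measurable A -> measurable B ->
  cond_indep Q (subvec [set a]%SET) (subvec [set b]%SET) (subvec C) ->
  let E1 := [set y : n.-tuple R | A (tnth y a)] in
  let E2 := [set y : n.-tuple R | B (tnth y b)] in
  {ae leb #|C|, forall z, (rest_marginal (fon (E1 `&` E2)) z * rest_marginal f z =
    rest_marginal (fon E1) z * rest_marginal (fon E2) z)%E}.
Proof.
move=> mA mB ci E1 E2.
have single (c : 'I_n) (D : set R) :
    subvec [set c]%SET @^-1` box (fun=> D) = [set y : n.-tuple R | D (tnth y c)].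
  have ec (i : 'I_#|[set c]%SET|) : enum_val i = c by apply/set1P; exact: enum_valP.
  have ic : c \in [set c]%SET by rewrite inE.
  apply/seteqP; split=> y /=.
    by move=> /(_ (enum_rank_in ic c)); rewrite tnth_mktuple ec.
  by move=> Dy i; rewrite tnth_mktuple ec.
have m1 : measurable E1 by rewrite -[X in measurable X]setTI; exact: measurable_tnth.
have m2 : measurable E2 by rewrite -[X in measurable X]setTI; exact: measurable_tnth.
have [pA [pB []]] := ci (box (fun=> A)) (box (fun=> B))
  (measurable_box (fun=> mA)) (measurable_box (fun=> mB)).
rewrite !single => cA cB cAB.
have := cond_prob_density m1 cA; have := cond_prob_density m2 cB.
have := cond_prob_density (measurableI _ _ m1 m2) cAB.
apply: filterS3 => z <- <- <-; rewrite EFinM -muleA [in RHS]muleACA.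
by rewrite -!muleA.
Qed.

End ConditionalIndependenceDensity.

Section StrictTP2.
Context {R : realType}.
Local Open Scope ereal_scope.

Lemma integral_itv_gt0 (l r : R) (g : R -> \bar R) : (l < r)%R ->
  measurable_fun setT g -> (forall x, 0 <= g x) ->
  (forall x, (l < x < r)%R -> 0 < g x) -> 0 < \int[lebR]_(x in `]l, r[) g x.
Proof.
move=> lr mg g0 gpos; rewrite lt_neqAle integral_ge0// andbT; apply/eqP => I0.
have mgD : measurable_fun `]l, r[%classic g by exact: measurable_funTS.
have [H _] := ae_eq_integral_abs lebR (measurable_itv `]l, r[) mgD.
have I0' : \int[lebR]_(x in `]l, r[) `|g x| = 0.
  by rewrite I0; apply: eq_integral => x _; rewrite gee0_abs.
have [x xlr /contrapT gx] := itv_not_negligible (H I0') lr.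
by have := gpos x xlr; rewrite gx ?ltxx//= in_itv.
Qed.

Lemma le_integral_mul (c : R) (g1 g2 g3 g4 : R -> \bar R) (S S' : set R) :
  measurable S -> measurable S' -> (0 <= c)%R ->
  measurable_fun setT g1 -> measurable_fun setT g2 ->
  measurable_fun setT g3 -> measurable_fun setT g4 ->
  (forall x, 0 <= g1 x) -> (forall x, 0 <= g2 x) ->
  (forall x, 0 <= g3 x) -> (forall x, 0 <= g4 x) ->
  (forall s t, S s -> S' t -> c%:E * (g3 s * g4 t) <= g1 s * g2 t) ->
  c%:E * ((\int[lebR]_(s in S) g3 s) * \int[lebR]_(t in S') g4 t) <=
  (\int[lebR]_(s in S) g1 s) * \int[lebR]_(t in S') g2 t.
Proof.
move=> mS mS' c0 m1 m2 m3 m4 p1 p2 p3 p4 H.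
have mT (h : R -> \bar R) (D : set R) : measurable_fun setT h -> measurable_fun D h.
  by move=> mh; exact: measurable_funTS.
have I2 : 0 <= \int[lebR]_(t in S') g2 t by exact: integral_ge0.
have I4 : 0 <= \int[lebR]_(t in S') g4 t by exact: integral_ge0.
rewrite -!ge0_integralZr//; [|exact: mT..].
rewrite -ge0_integralZl ?lee_fin//; last 2 first.
- by apply: emeasurable_funM => //; exact: mT.
- by move=> s _; rewrite mule_ge0.
apply: ge0_le_integral => //.
- by move=> s _; rewrite !mule_ge0// lee_fin.
- by do 2?(apply: emeasurable_funM => //); exact: mT.
- by apply: emeasurable_funM => //; exact: mT.
move=> s Ss; rewrite -!ge0_integralZl ?lee_fin ?mule_ge0//; try exact: mT; last 2 first.
- by apply: emeasurable_funM => //; exact: mT.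
- by move=> t _; rewrite mule_ge0.
apply: ge0_le_integral => //.
- by move=> t _; rewrite !mule_ge0// lee_fin.
- by do 2?(apply: emeasurable_funM => //); exact: mT.
- by apply: emeasurable_funM => //; exact: mT.
by move=> t St; exact: H.
Qed.

Lemma cross_ratio_absurd (c : R) (M w11 w22 w12 w21 A1 A2 B1 B2 : \bar R) :
  (1 < c)%R -> M \is a fin_num -> 0 < M ->
  w11 \is a fin_num -> w22 \is a fin_num -> w12 \is a fin_num -> w21 \is a fin_num ->
  0 < w12 -> 0 < w21 ->
  w11 * M = A1 * B1 -> w22 * M = A2 * B2 -> w12 * M = A1 * B2 -> w21 * M = A2 * B1 ->
  c%:E * (w12 * w21) <= w11 * w22 -> False.
Proof.
move=> c1 Mf M0 f11 f22 f12 f21 p12 p21 e11 e22 e12 e21.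
have : (w11 * w22) * (M * M) = (w12 * w21) * (M * M).
  rewrite muleACA e11 e22 [RHS]muleACA e12 e21 muleACA [RHS]muleACA.
  by congr (_ * _); exact: muleC.
move: Mf M0 f11 f22 f12 f21 p12 p21 {e11 e22 e12 e21}.
case: M => [M| |]// _ M0; case: w11 => [w11| |]// _; case: w22 => [w22| |]// _.
case: w12 => [w12| |]// _; case: w21 => [w21| |]// _; rewrite !lte_fin -!EFinM lee_fin.
move: M0; rewrite lte_fin => M0 p12 p21 [/mulIf]; rewrite mulf_neq0 ?gt_eqF// => /(_ isT) ->.
by rewrite leNgt ltr_pMl ?mulr_gt0// c1.
Qed.

(* Given the remaining coordinates [z], the masses of the four products of unit
   intervals have cross ratio 1 by conditional independence, and at least [c] by
   integration of the last hypothesis. *)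
Lemma cond_indep_not_strict_TP2 n (a b : 'I_n) (Q : probability (n.-tuple R) R)
    (f : n.-tuple R -> R) (c la la' lb lb' : R) : a != b ->
  measurable_fun setT f -> (forall x, (0 <= f x)%R) ->
  (forall A, measurable A -> Q A = \int[leb n]_(x in A) (f x)%:E) ->
  cond_indep Q (subvec [set a]%SET) (subvec [set b]%SET) (subvec (~: [set a; b])%SET) ->
  (forall y, (forall i, (0 < tnth y i)%R) -> (0 < f y)%R) ->
  (1 < c)%R -> (0 <= la)%R -> (0 <= la')%R -> (0 <= lb)%R -> (0 <= lb')%R ->
  (forall z u v u' v', (la < u < la + 1)%R -> (la' < u' < la' + 1)%R ->
    (lb < v < lb + 1)%R -> (lb' < v' < lb' + 1)%R ->
    (c * (f (tglue a b (z, (u, v'))) * f (tglue a b (z, (u', v)))) <=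
     f (tglue a b (z, (u, v))) * f (tglue a b (z, (u', v'))))%R) ->
  False.
Proof.
move=> ab mf f0 QE ci fpos c1 la0 la'0 lb0 lb'0 H.
pose C := (~: [set a; b])%SET.
pose itv (l : R) : set R := `]l, (l + 1)%R[%classic.
have mitv l : measurable (itv l) by exact: measurable_itv.
pose E1 (A : set R) := [set y : n.-tuple R | A (tnth y a)].
pose E2 (B : set R) := [set y : n.-tuple R | B (tnth y b)].
pose fon E (x : n.-tuple R) : R := (\1_E x * f x)%R.
have main (A B : set R) (mA : measurable A) (mB : measurable B) :=
  cond_indep_density ab mf f0 QE mA mB ci.
have Mfin : {ae leb #|C|, forall z, @rest_marginal R n a b f z \is a fin_num}.
  have int : (leb #|C|).-integrable setT (@rest_marginal R n a b f).
    apply/integrableP; split; first exact: measurable_rest_marginal.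
    under eq_integral do rewrite gee0_abs ?rest_marginal_ge0//.
    have := @ge0_integral_rest R n a b ab (fun=> 1%R) f setT.
    rewrite preimage_setT => E.
    rewrite [ltLHS](_ : _ = \int[leb n]_y (1 * f y)%:E); last first.
      rewrite E//; first by under [RHS]eq_integral do rewrite mul1e.
    under eq_integral do rewrite mul1r.
    by rewrite -QE// probability_setT ltry.
  have := integrable_ae measurableT int.
  by apply: filterS => z; exact.
pose m z (A B : set R) :=
  \int[lebR]_(u in A) \int[lebR]_(v in B) (f (tglue a b (z, (u, v))))%:E.
have mE z A B : @rest_marginal R n a b (fon (E1 A `&` E2 B)) z = m z A B.
  rewrite /rest_marginal /m [RHS]integral_mkcond; apply: eq_integral => u _.
  rewrite patchE [X in if _ then X else _]integral_mkcond.
  have E v : (tglue a b (z, (u, v)) \in E1 A `&` E2 B) = (u \in A) && (v \in B).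
    have ta : tnth (tglue a b (z, (u, v))) a = u by exact: tglue_fst.
    have tb : tnth (tglue a b (z, (u, v))) b = v by exact: tglue_snd.
    rewrite in_setI; congr (_ && _).
      by apply/idP/idP => /set_mem h; apply/mem_set; move: h; rewrite /E1 /mkset ta.
    by apply/idP/idP => /set_mem h; apply/mem_set; move: h; rewrite /E2 /mkset tb.
  case: ifPn => uA; last first.
    by apply: integral0_eq => v _; rewrite /fon indicE E (negPf uA) mul0r.
  apply: eq_integral => v _; rewrite patchE /fon indicE E uA /=.
  by case: ifP => _; rewrite ?mul1r ?mul0r.
have mI z (B : set R) : measurable B ->
    measurable_fun setT (fun u => \int[lebR]_(v in B) (f (tglue a b (z, (u, v))))%:E).
  by move=> mB; exact: measurable_tglue_integral.
have ms z u : measurable_fun setT (fun v => (f (tglue a b (z, (u, v))))%:E).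
  by apply/measurable_EFinP; apply: measurableT_comp mf _; exact: measurable_tglue_section.
have f0' x : 0 <= (f x)%:E by rewrite lee_fin.
have I0 z u (B : set R) : 0 <= \int[lebR]_(v in B) (f (tglue a b (z, (u, v))))%:E.
  by apply: integral_ge0 => v _; exact: f0'.
have mpos z l l' : (forall i, (0 < tnth z i)%R) -> (0 <= l)%R -> (0 <= l')%R ->
    0 < m z (itv l) (itv l').
  move=> z0 l0 l'0; apply: integral_itv_gt0; first by rewrite ltrDl.
  - exact: mI.
  - by move=> u; exact: I0.
  move=> u /andP[lu _]; apply: integral_itv_gt0; first by rewrite ltrDl.
  - exact: ms.
  - by move=> v; exact: f0'.
  move=> v /andP[lv _]; rewrite lte_fin; apply: fpos => i.
  have [->|->|[k ->]] := tglue_cases a b i.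
  - rewrite tglue_fst; exact: le_lt_trans l0 lu.
  - rewrite (tglue_snd _ ab); exact: le_lt_trans l'0 lv.
  - rewrite tglue_rest; exact: z0.
have mM z A B : measurable A -> measurable B -> m z A B <= @rest_marginal R n a b f z.
  move=> mA mB.
  apply: (@le_trans _ _ (\int[lebR]_u \int[lebR]_(v in B) (f (tglue a b (z, (u, v))))%:E)).
    by apply: ge0_subset_integral => //; exact: mI.
  apply: ge0_le_integral => //; try exact: mI.
  by move=> u _; apply: ge0_subset_integral => //; exact: ms.
(* The pointwise inequality is integrated over [(v, v')] inside and [(u, u')] outside, keeping the
   constant. *)
have key z : c%:E * (m z (itv la) (itv lb') * m z (itv la') (itv lb)) <=
    m z (itv la) (itv lb) * m z (itv la') (itv lb').
  have c0 : (0 <= c)%R by rewrite (le_trans ler01)// ltW.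
  apply: le_integral_mul => //; try exact: mI; try by move=> u; exact: I0.
  move=> u u' uA uA'; rewrite [X in c%:E * X]muleC.
  apply: le_integral_mul => //; try exact: ms.
  move=> v v' vB vB'; rewrite -!EFinM lee_fin [X in (c * X)%R]mulrC.
  by apply: H; [move: uA|move: uA'|move: vB|move: vB']; rewrite /itv /= in_itv.
have [z [z0 [Mz e1 e2 e3 e4]]] : exists z : #|C|.-tuple R, (forall i, (0 < tnth z i)%R) /\
    [/\ @rest_marginal R n a b f z \is a fin_num,
    @rest_marginal R n a b (fon (E1 (itv la) `&` E2 (itv lb))) z * @rest_marginal R n a b f z =
      @rest_marginal R n a b (fon (E1 (itv la))) z * @rest_marginal R n a b (fon (E2 (itv lb))) z,
    @rest_marginal R n a b (fon (E1 (itv la') `&` E2 (itv lb'))) z * @rest_marginal R n a b f z =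
      @rest_marginal R n a b (fon (E1 (itv la'))) z * @rest_marginal R n a b (fon (E2 (itv lb'))) z,
    @rest_marginal R n a b (fon (E1 (itv la) `&` E2 (itv lb'))) z * @rest_marginal R n a b f z =
      @rest_marginal R n a b (fon (E1 (itv la))) z * @rest_marginal R n a b (fon (E2 (itv lb'))) z &
    @rest_marginal R n a b (fon (E1 (itv la') `&` E2 (itv lb))) z * @rest_marginal R n a b f z =
      @rest_marginal R n a b (fon (E1 (itv la'))) z * @rest_marginal R n a b (fon (E2 (itv lb))) z].
  have [N [mN N0 NP]] := filterI Mfin (filterI
    (filterI (main _ _ (mitv la) (mitv lb)) (main _ _ (mitv la') (mitv lb')))
    (filterI (main _ _ (mitv la) (mitv lb')) (main _ _ (mitv la') (mitv lb)))).
  pose K := box (fun _ : 'I_#|C| => `]0%R, 1%R[%classic : set R).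
  have mK : measurable K by apply: measurable_box => i; exact: measurable_itv.
  have K1 : leb #|C| K = 1.
    rewrite leb_box//; apply: big1 => i _.
    by rewrite lebesgue_measure_itv/= lte_fin ltr01 oppr0 adde0.
  have [z Kz Nz] : exists2 z, K z & ~ N z.
    apply: contrapT => KN; have : leb #|C| K <= leb #|C| N.
      apply: le_measure; rewrite ?inE// => z Kz; apply: contrapT => Nz.
      by apply: KN; exists z.
    by rewrite K1 N0 lee_fin ler10.
  exists z; split; first by move=> i; have := Kz i; rewrite /= in_itv/= => /andP[].
  have /contrapT [Mz [[e1 e2] [e3 e4]]] := contra_not (NP z) Nz.
  exact: (And5 Mz e1 e2 e3 e4).
have M0 : 0 < @rest_marginal R n a b f z.
  exact: lt_le_trans (mpos _ _ _ z0 la0 lb0) (mM _ _ _ (mitv _) (mitv _)).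
have mfin A B : measurable A -> measurable B -> m z A B \is a fin_num.
  move=> mA mB; rewrite ge0_fin_numE; last first.
    by apply: integral_ge0 => u _; exact: I0.
  by apply: le_lt_trans (mM z _ _ mA mB) _; rewrite ltey_eq Mz.
rewrite !mE in e1 e2 e3 e4.
exact: (cross_ratio_absurd c1 Mz M0 (mfin _ _ (mitv la) (mitv lb))
  (mfin _ _ (mitv la') (mitv lb')) (mfin _ _ (mitv la) (mitv lb'))
  (mfin _ _ (mitv la') (mitv lb)) (mpos z la lb' z0 la0 lb'0)
  (mpos z la' lb z0 la'0 lb0) e1 e2 e3 e4 (key z)).
Qed.

End StrictTP2.

(** * Huesler-Reiss tree models *)

Section HueslerReissPrecision.
Context {R : realType} {n : nat}.
Variables (G : 'M[R]_n) (k : 'I_n).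
Hypothesis hG : HR_parameter G.

(** [x *m D] lists the differences [x_j - x_k] for [j != k]; constant vectors are sent to [0]. *)
Definition root_diff_mx : 'M[R]_(n, n.-1) :=
  \matrix_(a, j) ((a == lift k j)%:R - (a == k)%:R).

Local Notation D := root_diff_mx.
Local Notation S := (HR_sigma G k).
Local Notation P := (invmx S).

Lemma mul_root_diff_mx m (M : 'M[R]_(m, n)) i j :
  (M *m D) i j = M i (lift k j) - M i k.
Proof.
rewrite mxE; under eq_bigr do rewrite mxE mulrBr.
by rewrite sumrB (bigD1 (lift k j))//= eqxx mulr1 big1 ?addr0
  => [|a /negPf ->]; rewrite ?mulr0// (bigD1 k)//= eqxx mulr1 big1 ?addr0
  => [|a /negPf ->]; rewrite ?mulr0.
Qed.

Lemma const_root_diff_mx (c : R) : (const_mx c : 'rV[R]_n) *m D = 0.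
Proof. by apply/matrixP => i j; rewrite mul_root_diff_mx !mxE subrr. Qed.

(** As the columns of [D] sum to [0], this congruence turns the negativity of [G] on vectors of sum
    [0] into positive definiteness of [Sigma^(k)]. *)
Lemma HR_sigmaE : S = (- 2^-1) *: (D^T *m G *m D).
Proof.
have [GT G0 _] := hG.
have Gs i j : G i j = G j i by rewrite -[in LHS]GT mxE.
have E i b : (D^T *m G) i b = G (lift k i) b - G k b.
  by rewrite -[D^T *m G]trmxK trmx_mul trmxK mxE mul_root_diff_mx !mxE.
apply/matrixP => i j; rewrite mxE [RHS]mxE mul_root_diff_mx !E G0 (Gs k (lift k j)).
by field.
Qed.

Lemma HR_sigma_tr : S^T = S.
Proof. by rewrite HR_sigmaE linearZ/= !trmx_mul trmxK mulmxA; case: hG => ->. Qed.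

Lemma HR_sigma_pos (v : 'rV[R]_n.-1) : v != 0 -> 0 < (v *m S *m v^T) 0 0.
Proof.
move=> v0; have [_ _ neg] := hG.
have := neg (D *m v^T).
rewrite trmx_mul trmxK !mulmxA => neg'.
rewrite HR_sigmaE -scalemxAr -scalemxAl !mulmxA mxE mulNr oppr_gt0 pmulr_rlt0 ?invr_gt0//; apply: neg'.
  apply: contra v0 => /eqP Dv; apply/eqP/rowP => j.
  have := congr1 (fun M : 'cV_n => M (lift k j) 0) Dv; rewrite !mxE => <-.
  rewrite (bigD1 j)//= big1 => [|j' j'j]; rewrite !mxE ?eqxx ?(negPf (neq_lift k j)).
    by rewrite eq_sym (negPf (neq_lift k j)) subr0 mul1r addr0.
  rewrite (inj_eq lift_inj) eq_sym (negPf j'j) eq_sym (negPf (neq_lift k j)).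
  by rewrite subrr mul0r.
have : ((const_mx 1 : 'rV[R]_n) *m (D *m v^T)) 0 0 = 0.
  by rewrite mulmxA const_root_diff_mx mul0mx mxE.
by rewrite mxE; under eq_bigr do rewrite [const_mx _ _ _]mxE mul1r.
Qed.

Lemma HR_sigma_unit : S \in unitmx.
Proof.
rewrite unitmxE unitfE; apply/det0P => -[v v0 vS].
by have := HR_sigma_pos v0; rewrite vS mul0mx mxE ltxx.
Qed.

Lemma HR_precision_tr : P^T = P.
Proof. by rewrite trmx_inv HR_sigma_tr. Qed.

Definition HR_form (u v : 'rV[R]_n.-1) : R := (u *m P *m v^T) 0 0.

Lemma HR_formDl u u' v : HR_form (u + u') v = HR_form u v + HR_form u' v.
Proof. by rewrite /HR_form !mulmxDl mxE. Qed.

Lemma HR_formDr u v v' : HR_form u (v + v') = HR_form u v + HR_form u v'.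
Proof. by rewrite /HR_form linearD/= mulmxDr mxE. Qed.

Lemma HR_formC u v : HR_form u v = HR_form v u.
Proof.
rewrite /HR_form -[in LHS](trmxK (u *m P *m v^T)) mxE.
by rewrite !trmx_mul trmxK HR_precision_tr mulmxA.
Qed.

Lemma HR_form_ge0 v : 0 <= HR_form v v.
Proof.
have E : v *m P *m v^T = (v *m P) *m S *m (v *m P)^T.
  by rewrite trmx_mul HR_precision_tr !mulmxA mulmxKV// HR_sigma_unit.
rewrite /HR_form E; have [->|vP] := eqVneq (v *m P) 0.
  by rewrite !mul0mx mxE.
exact/ltW/HR_sigma_pos.
Qed.

(** The mixed second difference of a quadratic form is its bilinear form, whatever the base point
    [s]; the mean of the Gaussian factor therefore has no influence on cross ratios. *)
Lemma HR_form_quad s u v :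
  HR_form (s + u + v) (s + u + v) + HR_form s s =
  HR_form (s + u) (s + u) + HR_form (s + v) (s + v) + 2 * HR_form u v.
Proof. by rewrite !HR_formDl !HR_formDr (HR_formC v u); ring. Qed.

(** The Huesler-Reiss precision matrix: the inverse of [Sigma^(k)], completed by a [k]th row and
    column that make all row sums vanish. *)
Definition HR_precision : 'M[R]_n := D *m P *m D^T.

Lemma HR_form_precision (x y : 'rV[R]_n) :
  HR_form (x *m D) (y *m D) = \sum_a \sum_b x 0 a * HR_precision a b * y 0 b.
Proof.
have -> : HR_form (x *m D) (y *m D) = (x *m HR_precision *m y^T) 0 0.
  by rewrite /HR_form /HR_precision trmx_mul !mulmxA.
rewrite mxE exchange_big /=; apply: eq_bigr => b _.
by rewrite !mxE mulr_suml.
Qed.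

(* The indicator vector [x] of one side of an edge satisfies
   [x Theta (1 - x)^T = - x Theta x^T <= 0]. *)
Lemma HR_precision_edge (T : rel 'I_n) (hT : is_tree T) (i j : 'I_n) : T i j ->
  (forall a b, a != b -> ~~ T a b -> HR_precision a b = 0) -> HR_precision i j <= 0.
Proof.
move=> Tij H0; have [U [iU jU cut]] := tree_edge_cut hT Tij.
pose x : 'rV[R]_n := \row_a (a \in U)%:R.
pose y : 'rV[R]_n := \row_a (a \notin U)%:R.
have xy : y *m D = - (x *m D).
  apply/eqP; rewrite -subr_eq0 opprK addrC -mulmxDl; apply/eqP.
  rewrite (_ : x + y = const_mx 1) ?const_root_diff_mx//.
  by apply/rowP => a; rewrite !mxE; case: (a \in U); rewrite ?addr0 ?add0r.
have xE a : x 0 a = (a \in U)%:R by rewrite mxE.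
have yE a : y 0 a = (a \notin U)%:R by rewrite mxE.
have E : HR_form (x *m D) (y *m D) = HR_precision i j.
  rewrite HR_form_precision (bigD1 i)//= (bigD1 j)//= xE !yE iU jU mulr1 mul1r.
  rewrite big1 ?addr0 => [|b bj]; last first.
    rewrite mul1r yE; case: (boolP (b \in U)) => bU; first by rewrite mulr0.
    rewrite H0 ?mul0r//; first by apply: contraNneq bU => <-.
    by apply: contra bj => Tib; have [->] := cut _ _ iU bU Tib.
  rewrite big1 ?addr0// => a ai; apply: big1 => b _; rewrite xE yE.
  case: (boolP (a \in U)) => aU; last by rewrite !mul0r.
  case: (boolP (b \in U)) => bU; first by rewrite mulr0.
  rewrite H0 ?mulr0 ?mul0r//; first by apply: contraNneq bU => <-.
  by apply: contra ai => Tab; have [->] := cut _ _ aU bU Tab.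
rewrite -E xy /HR_form linearN/= mulmxN mxE oppr_le0.
exact: HR_form_ge0.
Qed.

End HueslerReissPrecision.

Section HueslerReissDensity.
Context {R : realType} {n : nat}.
Variables (G : 'M[R]_n) (k : 'I_n).
Hypothesis hG : HR_parameter G.

Local Notation D := (@root_diff_mx R n k).
Local Notation Theta := (HR_precision G k).

Definition row_of_tuple (x : n.-tuple R) : 'rV[R]_n := \row_i tnth x i.

Definition HR_centered (x : 'rV[R]_n) : 'rV[R]_n.-1 :=
  x *m D - \row_j (- HR_sigma G k j j / 2).

Definition HR_density (y : n.-tuple R) : R :=
  exponential_pdf 1 (tnth y k) *
  ((Num.sqrt ((2 * pi) ^+ n.-1 * \det (HR_sigma G k)))^-1 *
   expR (- HR_form G k (HR_centered (row_of_tuple y))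
                       (HR_centered (row_of_tuple y)) / 2)).

Lemma law_k_HR_density (mu : probability (n.-tuple R) R)
    (nu : probability (n.-tuple R) R) : extremal_function mu k nu ->
  is_density (lebesgue_tuple n.-1) (pushforward nu (drop_comp k))
    (mvnormal_pdf (fun j => - HR_sigma G k j j / 2) (HR_sigma G k)) ->
  is_density (lebesgue_tuple n) (law_k mu k) HR_density.
Proof.
move=> hnu hphi; have := law_k_density hnu hphi.
rewrite (_ : _ \o _ = HR_density)//; apply/funext => y /=.
rewrite /HR_density /mvnormal_pdf /HR_form /parent_diff tnth_mktuple !inE eqxx /=.
congr (_ * (_ * expR (- _ / 2))).
rewrite (_ : \row__ _ = HR_centered (row_of_tuple y))//.
apply/rowP => j; rewrite [RHS]mxE mul_root_diff_mx !mxE !tnth_mktuple !inE.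
by rewrite eq_sym neq_lift.
Qed.

Lemma HR_density_ge0 y : 0 <= HR_density y.
Proof. by rewrite !mulr_ge0 ?exponential_pdf_ge0 ?invr_ge0 ?sqrtr_ge0 ?expR_ge0. Qed.

(** The normalising constant is nonzero because otherwise the density would integrate to [0] instead
    of 1. *)
Lemma HR_density_gt0 (Q : probability (n.-tuple R) R) y :
  is_density (lebesgue_tuple n) Q HR_density ->
  0 < tnth y k -> 0 < HR_density y.
Proof.
move=> [_ _ QE] y0; rewrite lt_neqAle HR_density_ge0 andbT eq_sym.
rewrite !mulf_neq0 ?gt_eqF ?expR_gt0//.
  by rewrite /exponential_pdf patchE mem_set ?mul1r ?expR_gt0//= in_itv/= ltW.
have := QE setT measurableT; rewrite probability_setT.
rewrite lt0r invr_ge0 sqrtr_ge0 andbT.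
apply: contraPneq => c0; rewrite -lebE integral0_eq => [/eqP|x _].
  by rewrite onee_eq0.
by rewrite /HR_density c0 mul0r mulr0.
Qed.

(** The cross ratio over a parallelogram depends only on its sides. Sides along two coordinate axes
    detect the entry [Theta a b]; the parallelogram of meet, [x], [y] and join gives total
    positivity. *)
Lemma HR_density_cross (p p' : 'rV[R]_n) (y00 y10 y01 y11 : n.-tuple R) :
  row_of_tuple y10 = row_of_tuple y00 + p ->
  row_of_tuple y01 = row_of_tuple y00 + p' ->
  row_of_tuple y11 = row_of_tuple y00 + p + p' ->
  exponential_pdf 1 (tnth y00 k) * exponential_pdf 1 (tnth y11 k) =
  exponential_pdf 1 (tnth y01 k) * exponential_pdf 1 (tnth y10 k) ->
  HR_density y00 * HR_density y11 =
  expR (- \sum_a \sum_b p 0 a * Theta a b * p' 0 b) *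
  (HR_density y01 * HR_density y10).
Proof.
move=> e10 e01 e11 eE; rewrite -HR_form_precision.
rewrite /HR_density; set c := (Num.sqrt _)^-1.
pose g y := expR (- HR_form G k (HR_centered (row_of_tuple y))
                                (HR_centered (row_of_tuple y)) / 2).
have gE : g y00 * g y11 =
    expR (- HR_form G k (p *m D) (p' *m D)) * (g y01 * g y10).
  rewrite /g -!expRD; congr expR; rewrite e10 e01 e11 /HR_centered !mulmxDl.
  set s := row_of_tuple y00 *m D; set m := \row__ _.
  rewrite (_ : s + p *m D + p' *m D - m = (s - m) + p *m D + p' *m D); last first.
    by rewrite addrAC; congr (_ + _); rewrite addrAC.
  rewrite [s + p *m D - m]addrAC [s + p' *m D - m]addrAC.
  by have := HR_form_quad k hG (s - m) (p *m D) (p' *m D); lra.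
have assemble (e0 e1 e2 e3 g0 g1 g2 g3 q : R) : e0 * e1 = e2 * e3 ->
    g0 * g1 = q * (g2 * g3) -> e0 * (c * g0) * (e1 * (c * g1)) =
    q * (e2 * (c * g2) * (e3 * (c * g3))).
  by move=> he hg; transitivity (e0 * e1 * (c * c) * (g0 * g1));
    [ring | rewrite he hg; ring].
exact: assemble eE gE.
Qed.

Lemma HR_precision_markov (Q : probability (n.-tuple R) R) (a b : 'I_n) :
  is_density (lebesgue_tuple n) Q HR_density -> a != b ->
  cond_indep Q (subvec [set a]%SET) (subvec [set b]%SET) (subvec (~: [set a; b])%SET) ->
  Theta a b = 0.
Proof.
move=> hf ab hci; apply/eqP; apply: contrapT => /negP T0.
have [mf f0 QE] := hf.
have eE (c : R) (e i : 'I_n) : (c *: delta_mx 0 e : 'rV[R]_n) 0 i = c * (i == e)%:R.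
  by rewrite !mxE.
have mxD (x y : 'rV[R]_n) i : (x + y) 0 i = x 0 i + y 0 i by rewrite mxE.
have tE (y : n.-tuple R) i : row_of_tuple y 0 i = tnth y i by rewrite mxE.
have cross z u v u' v' :
    HR_density (tglue a b (z, (u, v))) * HR_density (tglue a b (z, (u', v'))) =
    expR (- ((u' - u) * Theta a b * (v' - v))) *
    (HR_density (tglue a b (z, (u, v'))) * HR_density (tglue a b (z, (u', v)))).
  apply: etrans (@HR_density_cross ((u' - u) *: delta_mx 0 a) ((v' - v) *: delta_mx 0 b)
    (tglue a b (z, (u, v))) (tglue a b (z, (u', v)))
    (tglue a b (z, (u, v'))) (tglue a b (z, (u', v'))) _ _ _ _) _.
  - apply/rowP => i; rewrite !mxD !eE !tE; case: (tglue_cases a b i) => [->|->|[j ->]].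
    + by rewrite !tglue_fst eqxx /=; ring.
    + by rewrite !tglue_snd// eq_sym (negPf ab) /=; ring.
    + have := enum_valP j; rewrite !inE negb_or => /andP[/negPf ja _].
      by rewrite !tglue_rest ja /=; ring.
  - apply/rowP => i; rewrite !mxD !eE !tE; case: (tglue_cases a b i) => [->|->|[j ->]].
    + by rewrite !tglue_fst (negPf ab) /=; ring.
    + by rewrite !tglue_snd// eqxx /=; ring.
    + have := enum_valP j; rewrite !inE negb_or => /andP[_ /negPf jb].
      by rewrite !tglue_rest jb /=; ring.
  - apply/rowP => i; rewrite !mxD !eE !tE; case: (tglue_cases a b i) => [->|->|[j ->]].
    + by rewrite !tglue_fst eqxx (negPf ab) /=; ring.
    + by rewrite !tglue_snd// eqxx eq_sym (negPf ab) /=; ring.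
    + have := enum_valP j; rewrite !inE negb_or => /andP[/negPf ja /negPf jb].
      by rewrite !tglue_rest ja jb /=; ring.
  - case: (tglue_cases a b k) => [->|->|[j ->]].
    + by rewrite !tglue_fst.
    + by rewrite !tglue_snd//= mulrC.
    + by rewrite !tglue_rest.
  - congr (expR (- _) * _); rewrite (bigD1 a)//= (bigD1 b)//= !eE !eqxx !mulr1.
    rewrite !big1 ?addr0// => [i /negPf ia|j /negPf jb].
      by apply: big1 => j _; rewrite !eE ia !(mulr0, mul0r).
    by rewrite !eE jb !mulr0.
have main la la' lb lb' : 0 <= la -> 0 <= la' -> 0 <= lb -> 0 <= lb' ->
    (forall u v u' v', la < u < la + 1 -> la' < u' < la' + 1 ->
      lb < v < lb + 1 -> lb' < v' < lb' + 1 ->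
      `|Theta a b| <= - ((u' - u) * Theta a b * (v' - v))) -> False.
  move=> la0 la'0 lb0 lb'0 H.
  apply: (cond_indep_not_strict_TP2 (c := expR `|Theta a b|) ab mf f0 _ hci _ _
    la0 la'0 lb0 lb'0).
  - by move=> A mA; rewrite lebE; exact: QE.
  - by move=> y y0; exact: HR_density_gt0 hf (y0 k).
  - by rewrite expR_gt1 normr_gt0.
  move=> z u v u' v' hu hu' hv hv'.
  have := cross z u v u' v'; rewrite /=.
  have := HR_density_ge0 (tglue a b (z, (u, v'))).
  have := HR_density_ge0 (tglue a b (z, (u', v))).
  move: (HR_density _) (HR_density _) (HR_density _) (HR_density _) => A B C E A0 B0 ->.
  apply: ler_wpM2r; first exact: mulr_ge0.
  by have := H _ _ _ _ hu hu' hv hv'; rewrite -ler_expR.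
(* The intervals [(0, 1)] and [(2, 3)] keep [u' - u] and the distance of [v] and [v'] at least 1, so
   the cross ratio is at least [expR |Theta a b|]. For a positive entry the intervals of [v] and
   [v'] are exchanged, to reverse the sign. *)
have [Tn|Tp|T00] := ltgtP (Theta a b) 0; last by rewrite T00 eqxx in T0.
- apply: (main 0 2 0 2) => // u v u' v' /andP[_ u1] /andP[u2 _] /andP[_ v1] /andP[v2 _].
  rewrite ltr0_norm// (_ : - (_ * _) = - Theta a b * ((u' - u) * (v' - v))); last by ring.
  by rewrite ler_peMr ?oppr_ge0 ?(ltW Tn)// mulr_ege1//; lra.
- apply: (main 0 2 2 0) => // u v u' v' /andP[_ u1] /andP[u2 _] /andP[v0 _] /andP[_ v1].
  rewrite gtr0_norm// (_ : - (_ * _) = Theta a b * ((u' - u) * (v - v'))); last by ring.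
  by rewrite ler_peMr ?(ltW Tp)// mulr_ege1//; lra.
Qed.

(** In each coordinate one of [x - u] and [y - u] vanishes, where [u] is the meet, and both are
    nonnegative. The diagonal of [Theta] thus drops out, and the off-diagonal terms are
    nonpositive. *)
Lemma HR_density_MTP2 (x y : n.-tuple R) :
  (forall a b, a != b -> Theta a b <= 0) ->
  HR_density x * HR_density y <= HR_density (tmax x y) * HR_density (tmin x y).
Proof.
move=> T0; pose u := row_of_tuple (tmin x y).
suff : HR_density (tmin x y) * HR_density (tmax x y) =
    expR (- \sum_a \sum_b (row_of_tuple x - u) 0 a * Theta a b *
                           (row_of_tuple y - u) 0 b) *
    (HR_density y * HR_density x).
  move: (HR_density_ge0 x) (HR_density_ge0 y).
  move: (HR_density x) (HR_density y) (HR_density (tmin x y)) (HR_density (tmax x y)).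
  move=> fx fy f0 f1 fx0 fy0; rewrite [leLHS]mulrC [leRHS]mulrC => ->.
  rewrite ler_peMl ?mulr_ge0//.
  rewrite -expR0 ler_expR oppr_ge0; apply: sumr_le0 => a _; apply: sumr_le0 => b _.
  have pE (z : n.-tuple R) i : (row_of_tuple z - u) 0 i =
      tnth z i - Num.min (tnth x i) (tnth y i) by rewrite !mxE tnth_mktuple.
  rewrite !pE; have [<-|ab] := eqVneq a b.
    case: (leP (tnth x a) (tnth y a)) => _; first by rewrite subrr !mul0r.
    by rewrite subrr mulr0.
  rewrite mulr_le0_ge0 ?subr_ge0 ?ge_min ?lexx ?orbT//.
  by rewrite mulr_ge0_le0 ?T0 ?subr_ge0 ?ge_min ?lexx.
apply: HR_density_cross.
- by rewrite subrKC.
- by rewrite subrKC.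
- apply/rowP => i; rewrite !mxE !tnth_mktuple.
  by case: (leP (tnth x i) (tnth y i)) => _; ring.
- rewrite !tnth_mktuple; case: (leP (tnth x k) (tnth y k)) => // _.
  by rewrite mulrC.
Qed.

End HueslerReissDensity.

Lemma HR_tree_EMTP2 {R : realType} n (T : rel 'I_n) (hT : is_tree T)
    (mu : probability (n.-tuple R) R) (G : 'M[R]_n) :
  extremal_tree_model T mu -> huesler_reiss mu G -> EMTP2 mu.
Proof.
move=> [_ hM] [hG _ hW] k; have [nu hnu hphi] := hW k.
have hf := law_k_HR_density hnu hphi.
have [Q QE] := law_k_probability (extremal_mass hnu).
have hQ : is_density (lebesgue_tuple n) Q (HR_density G k) by rewrite QE.
have Theta0 a b : a != b -> ~~ T a b -> HR_precision G k a b = 0.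
  by move=> ab Tab; apply: (HR_precision_markov hG hQ ab); rewrite QE; exact: hM ab Tab k.
exists (HR_density G k); first exact: hf.
move=> x y; apply: (HR_density_MTP2 hG) => a b ab.
have [Tab|/(Theta0 _ _ ab)->//] := boolP (T a b).
exact: (HR_precision_edge hG hT Tab Theta0).
Qed.

Theorem proposition4p1 (R : realType) (d : nat) (T : rel 'I_d) (hT : is_tree T)
    (dO : measure_display) (Omega : measurableType dO) (P : probability Omega R)
    (Y : {RV P >-> d.-tuple R})
    (hdens : exists f, is_density (lebesgue_tuple d) (distribution P Y) f)
    (hY : extremal_tree_model T (distribution P Y)) :
  (forall (W : 'I_d -> probability (d.-tuple R) R)
      (hW : forall k, extremal_function (distribution P Y) k (W k))
      (dO' : measure_display) (Omega' : measurableType dO')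
      (P' : probability Omega' R)
      (We : 'I_d -> 'I_d * 'I_d -> {RV P' >-> R})
      (hWe : forall k, tree_representation T W k (We k)),
    (EMTP2 (distribution P Y) <->
      forall I : {set 'I_d}, #|I| = 2%N -> EMTP2 (margin (distribution P Y) I))
    /\
    (EMTP2 (distribution P Y) <->
      forall k e, e \in directed_edges T k ->
        has_logconcave_density (distribution P' (We k e))))
  /\
  (forall G : 'M[R]_d, huesler_reiss (distribution P Y) G ->
    EMTP2 (distribution P Y)).
Proof.
split=> [W hW dO' Omega' P' We hWe|G]; last exact: (HR_tree_EMTP2 hT (mu := distribution P Y) hY).
pose mu := distribution P Y.
have edges_logconcave :
    (forall i j, i != j -> has_logconcave_density (fun A => W i [set w | A (tnth w j)])) ->
    forall k e, e \in directed_edges T k -> has_logconcave_density (distribution P' (We k e)).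
  move=> lW k [i j] ijk; have [_ Tirr _] : [/\ True, irreflexive T & True] by case: hT.
  have ij : i != j.
    by apply/eqP => ij; move: ijk; rewrite inE /= ij Tirr.
  apply: has_logconcave_density_eq (lW i j ij) => A mA.
  by have [_ -> //] := hWe k.
have EMTP2_pairs : EMTP2 mu ->
    forall i j, i != j -> has_logconcave_density (fun A => W i [set w | A (tnth w j)]).
  by move=> m2 i j ij; exact: EMTP2_extremal_logconcave ij (hW i) (m2 i).
have margins_pairs : (forall I : {set 'I_d}, #|I| = 2%N -> EMTP2 (margin mu I)) ->
    forall i j, i != j -> has_logconcave_density (fun A => W i [set w | A (tnth w j)]).
  move=> m2 i j ij; apply: (margin_extremal_logconcave ij (hW i)).
  by apply: m2; rewrite cards2 ij.
have edges_EMTP2 : (forall k e, e \in directed_edges T k ->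
    has_logconcave_density (distribution P' (We k e))) -> EMTP2 mu.
  by move=> lWe k; exact: (tree_logconcave_MTP2 hT (hW k) (hWe k) (lWe k)).
(* The log-concavity for all pairs closes the circle: log-concave edges give EMTP2, which gives all
   pairs and with them the bivariate margins, and these give back all pairs, in particular the
   edges. *)
split; split.
- move=> /EMTP2_pairs lW I I2; exact: logconcave_bivariate_EMTP2 I2 hW lW.
- by move=> /margins_pairs/edges_logconcave/edges_EMTP2.
- by move=> /EMTP2_pairs/edges_logconcave.
- exact: edges_EMTP2.
Qed.
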